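(* (i) The bounded subsets of $\mathcal D'_{L^1}$ and the bounded subsets of $\mathcal D'_{L^1,c}$ coincide with the relatively compact subsets of $\mathcal D'_{L^1,c}$. (ii) They are characterised by: a set $B\subset\mathcal D'_{L^1}$ is bounded if and only if there exist $m\in\mathbb N_0$ and $C_m>0$ such that $B\subset C_m\,L_{-2m}*B_{1,1}$. Moreover, the bounded sets in $\mathcal D'_{L^1}$ yield the usual seminorms on $\mathcal D_{L^\infty}$ and on $\dot{\mathcal B}$: on each of these spaces the seminorms $p_B(\varphi)=\sup_{S\in B}|\langle\varphi,S\rangle|$, $B\subset\mathcal D'_{L^1}$ bounded, generate the same topology as the seminorms $\varphi\mapsto\sup_{|\alpha|\le m}\|\partial^\alpha\varphi\|_\infty$, $m\in\mathbb N_0$, or equivalently as the seminorms $\varphi\mapsto\|L_{-2m}*\varphi\|_\infty$, $m\in\mathbb N_0$.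
   Context: All spaces are on $\mathbb R^n$. $\mathcal D_{L^\infty}$ is the space of smooth functions with all derivatives bounded; $\dot{\mathcal B}$ is its subspace of smooth functions all of whose derivatives vanish at infinity; both carry the topology generated by $\sup_{|\alpha|\le m}\|\partial^\alpha f\|_\infty$, $m\in\mathbb N_0$. $\mathcal D'_{L^1}$ is the dual of $\dot{\mathcal B}$ with the strong topology $\beta(\mathcal D'_{L^1},\dot{\mathcal B})$. $\mathcal D'_{L^1,c}$ is $\mathcal D'_{L^1}$ with the topology $\kappa(\mathcal D'_{L^1},\dot{\mathcal B})$ of uniform convergence on absolutely convex compact subsets of $\dot{\mathcal B}$. Every $S\in\mathcal D'_{L^1}$ is a finite sum $\sum_\alpha\partial^\alpha f_\alpha$ with $f_\alpha\in L^1$, and the pairing with $\varphi\in\mathcal D_{L^\infty}$ is $\langle\varphi,S\rangle=\sum_\alpha(-1)^{|\alpha|}\int f_\alpha\,\partial^\alpha\varphi\,dx$, which extends the pairing with $\dot{\mathcal B}$. $L_{-2m}=(1-\Delta_n)^m\delta$, so $L_{-2m}*f=(1-\Delta_n)^mf$ in the distributional sense. $B_{1,1}=\{f\in L^1:\|f\|_1\le1\}$ and $L_{-2m}*B_{1,1}=\{L_{-2m}*f:f\in B_{1,1}\}$. *)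

(* Defs.v *)
From HB Require Import structures.
From mathcomp Require Import all_boot all_order all_algebra.
From mathcomp Require Import complex.
From mathcomp Require Import all_classical all_reals all_analysis.

Set Implicit Arguments.
Unset Strict Implicit.
Unset Printing Implicit Defensive.

Import Order.TTheory GRing.Theory Num.Theory.
Import numFieldNormedType.Exports ComplexField.Normc.

Local Open Scope classical_set_scope.
Local Open Scope ring_scope.

(* Lebesgue measure on n.-tuple R, by iterated products. It lives on tuples
   because these carry the library's product sigma-algebra; test functions
   live on 'rV[R]_n, which carries the norm needed for derivatives. *)
Section lebesgue_tuple.
Variable R : realType.
Local Notation RM := (measurableTypeR R).

Definition cons_pair n (p : RM * n.-tuple RM) : n.+1.-tuple RM :=
  [tuple of p.1 :: p.2].

Definition uncons n (t : n.+1.-tuple RM) : RM * n.-tuple RM :=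
  (thead t, [tuple of behead t]).

Lemma cons_pairK n : cancel (@cons_pair n) (@uncons n).
Proof.
move=> [x t]; rewrite /uncons/cons_pair/=; congr pair.
exact: val_inj.
Qed.

Lemma measurable_cons_pair n : measurable_fun setT (@cons_pair n).
Proof. exact: measurable_cons. Qed.

Lemma measurable_uncons n : measurable_fun setT (@uncons n).
Proof.
apply/measurable_fun_pairP; split; last exact: measurable_behead.
exact: measurable_tnth.
Qed.

Section step.
Variables (n : nat) (lam : {sigma_finite_measure set RM -> \bar R}).
Variable mu : {sigma_finite_measure set (n.-tuple RM) -> \bar R}.

Definition product_cons : set (n.+1.-tuple RM) -> \bar R :=
  pushforward ((lam \x mu)%E) (@cons_pair n).

HB.instance Definition _ := Measure.copy product_cons
  (measure_function_pushforward__canonical__measure_function_Measure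
    ((lam \x mu)%E) (@measurable_cons_pair n)).

Lemma product_cons_sigma_finite : sigma_finite setT product_cons.
Proof.
have /sigma_finiteP[F [FT ndF Foo]] := sigma_finiteT lam.
have /sigma_finiteP[G [GT ndG Goo]] := sigma_finiteT mu.
exists (fun k => @uncons n @^-1` (F k `*` G k)).
  rewrite -preimage_bigcup (_ : \bigcup_k _ = setT) ?preimage_setT//.
  rewrite -setXTT FT GT predeqE => -[x y]; split.
    by move=> [k _ []/= ? ?]; split; exists k.
  move=> [/= [k _ Fkx] [l _ Gly]]; exists (maxn k l) => //; split => /=.
    by move: x Fkx; exact/subsetPset/ndF/leq_maxl.
  by move: y Gly; exact/subsetPset/ndG/leq_maxr.
move=> k; have [mF Fk] := Foo k; have [mG Gk] := Goo k; split.
  by rewrite -[X in measurable X]setTI; apply: measurable_uncons => //;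
    exact: measurableX.
rewrite /product_cons /pushforward -comp_preimage.
rewrite (_ : _ \o _ = id); last by rewrite funeqE => p; exact: cons_pairK.
by rewrite preimage_id product_measure1E// lte_mul_pinfty// ge0_fin_numE.
Qed.

HB.instance Definition _ := Measure_isSigmaFinite.Build _ _ _ product_cons
  product_cons_sigma_finite.
End step.

Fixpoint lebesgue n : {sigma_finite_measure set (n.-tuple RM) -> \bar R} :=
  match n with
  | 0 => \d_([tuple] : 0.-tuple RM)
  | m.+1 => product_cons (@lebesgue_measure R) (lebesgue m)
  end.

End lebesgue_tuple.

Section integration.
Variables (R : realType) (n : nat).
Local Notation Rn := 'rV[R]_n.
Local Notation C := (R[i]^o).

Definition row_of_tuple (t : n.-tuple (measurableTypeR R)) : Rn :=
  \row_j tnth t j.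

Definition L1 : set (Rn -> C) := [set f |
  (lebesgue R n).-integrable setT (fun t => (complex.Re (f (row_of_tuple t)))%:E) /\
  (lebesgue R n).-integrable setT (fun t => (complex.Im (f (row_of_tuple t)))%:E)].

Definition L1norm (f : Rn -> C) : \bar R :=
  (\int[lebesgue R n]_t (normc (f (row_of_tuple t)))%:E)%E.

Definition integral_Rn (f : Rn -> C) : C :=
  (\int[lebesgue R n]_t complex.Re (f (row_of_tuple t)) +i*
   \int[lebesgue R n]_t complex.Im (f (row_of_tuple t)))%C.

Definition B11 : set (Rn -> C) := [set f | L1 f /\ (L1norm f <= 1)%E].

End integration.

(* Constant-coefficient differential operators, given the action D i of the
   i-th partial derivative on some space E; used both for functions and for
   linear forms on test functions. *)
Section diff_operators.
Variables (n : nat) (E : zmodType) (D : 'I_n -> E -> E).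

Definition iter_deriv (s : seq 'I_n) (u : E) : E := foldr D u s.

Definition multi_index := {ffun 'I_n -> nat}.

Definition mi_order (a : multi_index) : nat := (\sum_i a i)%N.

Definition multi_deriv (a : multi_index) : E -> E :=
  iter_deriv (flatten [seq nseq (a i) i | i <- enum 'I_n]).

Definition one_minus_laplacian (u : E) : E := u - \sum_i D i (D i u).

End diff_operators.

Section functions.
Variables (R : realType) (n : nat).
Local Notation Rn := 'rV[R]_n.
Local Notation C := (R[i]^o).
Implicit Types f g : Rn -> C.

(* Componentwise, since the library gives R[i] no normed module structure
   over R. *)
Definition partial (i : 'I_n) f : Rn -> C := fun x =>
  ('D_(delta_mx 0 i) (fun y => complex.Re (f y)) x +i*
   'D_(delta_mx 0 i) (fun y => complex.Im (f y)) x)%C.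

Definition partially_derivable f := forall (i : 'I_n) (x : Rn),
  derivable (fun y => complex.Re (f y)) x (delta_mx 0 i) /\
  derivable (fun y => complex.Im (f y)) x (delta_mx 0 i).

Definition smooth f := forall s : seq 'I_n,
  continuous (iter_deriv partial s f) /\
  partially_derivable (iter_deriv partial s f).

Definition bounded_fct f := exists M : R, forall x, normc (f x) <= M.

Definition vanishes_at_infinity f := forall e : R, 0 < e ->
  exists r : R, forall x, r < `|x| -> normc (f x) < e.

Definition DLinf_pred : {pred (Rn -> C)} := fun f =>
  `[< smooth f /\ forall a, bounded_fct (multi_deriv partial a f) >].

Definition Bdot_pred : {pred (Rn -> C)} := fun f =>
  `[< smooth f /\ forall a, vanishes_at_infinity (multi_deriv partial a f) >].

Lemma normc_lin (a z w : C) :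
  normc (a * z + w) <= normc a * normc z + normc w.
Proof. by rewrite -normcM; exact: le_normcD. Qed.

Lemma Re_lin (a : R[i]) f g : (fun y => complex.Re ((a *: f + g) y)) =
  complex.Re a *: (fun y => complex.Re (f y)) -
  complex.Im a *: (fun y => complex.Im (f y)) + (fun y => complex.Re (g y)).
Proof.
apply/funext => y; rewrite !fctE.
by case: a (f y) (g y) => [? ?] [? ?] [? ?].
Qed.

Lemma Im_lin (a : R[i]) f g : (fun y => complex.Im ((a *: f + g) y)) =
  complex.Re a *: (fun y => complex.Im (f y)) +
  complex.Im a *: (fun y => complex.Re (f y)) + (fun y => complex.Im (g y)).
Proof.
apply/funext => y; rewrite !fctE.
by case: a (f y) (g y) => [? ?] [? ?] [? ?].
Qed.

Lemma partially_derivable_lin (a : R[i]) f g :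
  partially_derivable f -> partially_derivable g ->
  partially_derivable (a *: f + g).
Proof.
move=> df dg i x; have [df1 df2] := df i x; have [dg1 dg2] := dg i x.
rewrite Re_lin Im_lin; split.
  by apply: derivableD => //; apply: derivableB; exact: derivableZ.
by apply: derivableD => //; apply: derivableD; exact: derivableZ.
Qed.

Lemma partial_lin (a : R[i]) f g i :
  partially_derivable f -> partially_derivable g ->
  partial i (a *: f + g) = a *: partial i f + partial i g.
Proof.
move=> df dg; apply/funext => x.
have [df1 df2] := df i x; have [dg1 dg2] := dg i x.
rewrite /partial Re_lin Im_lin.
have dZ k (h : Rn -> R) : derivable h x (delta_mx 0 i) ->
    derivable (k *: h) x (delta_mx 0 i) by exact: derivableZ.
rewrite (deriveD (derivableB (dZ _ _ df1) (dZ _ _ df2)) dg1).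
rewrite (deriveB (dZ _ _ df1) (dZ _ _ df2)).
rewrite (deriveD (derivableD (dZ _ _ df2) (dZ _ _ df1)) dg2).
rewrite (deriveD (dZ _ _ df2) (dZ _ _ df1)).
by rewrite !deriveZ// !fctE; case: a.
Qed.

Lemma iter_partial_lin (a : R[i]) f g s : smooth f -> smooth g ->
  iter_deriv partial s (a *: f + g) =
  a *: iter_deriv partial s f + iter_deriv partial s g.
Proof.
move=> sf sg; elim: s => [//|i s IH]; rewrite /iter_deriv/= in IH *.
by rewrite IH; apply: partial_lin; [have [] := sf s|have [] := sg s].
Qed.

Lemma smooth_lin (a : R[i]) f g : smooth f -> smooth g -> smooth (a *: f + g).
Proof.
move=> sf sg s; rewrite iter_partial_lin//.
have [cf df] := sf s; have [cg dg] := sg s; split.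
  move=> x; apply: (@cvgD _ C _ _ _ (a *: iter_deriv partial s f)) (cg x).
  exact: (@cvgZl_tmp _ C _ _ _ a (iter_deriv partial s f) _ (cf x)).
exact: partially_derivable_lin.
Qed.

Lemma partial0 i : partial i (0 : Rn -> C) = 0.
Proof.
apply/funext => x; rewrite /partial /=.
by rewrite (derive_cst (0 : R)).
Qed.

Lemma iter_partial0 s : iter_deriv partial s (0 : Rn -> C) = 0.
Proof. by elim: s => [//|i s IH]; rewrite /iter_deriv/= in IH *; rewrite IH partial0. Qed.

Lemma smooth0 : smooth (0 : Rn -> C).
Proof.
move=> s; rewrite iter_partial0; split; first exact: cst_continuous.
by move=> i x; split; exact: derivable_cst.
Qed.

Lemma DLinf_submod_closed : submod_closed DLinf_pred.
Proof.
split.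
  apply/asboolP; split; first exact: smooth0.
  by move=> a; exists 0 => x; rewrite /multi_deriv iter_partial0 normc0.
move=> a f g /asboolP[sf bf] /asboolP[sg bg]; apply/asboolP; split.
  exact: smooth_lin.
move=> al; have [M fM] := bf al; have [N gN] := bg al.
exists (normc (a : C) * M + N) => x.
rewrite /multi_deriv iter_partial_lin//; apply: le_trans (normc_lin _ _ _) _.
have a0 : 0 <= normc (a : C) by case: (a) => ? ?; exact: sqrtr_ge0.
by apply: lerD; [exact: (ler_wpM2l a0 (fM x))|exact: gN].
Qed.

Lemma Bdot_submod_closed : submod_closed Bdot_pred.
Proof.
split.
  apply/asboolP; split; first exact: smooth0.
  move=> a e e0; exists 0 => x _.
  by rewrite /multi_deriv iter_partial0 normc0.
move=> a f g /asboolP[sf bf] /asboolP[sg bg]; apply/asboolP; split.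
  exact: smooth_lin.
move=> al e e0.
have a0 : 0 <= normc (a : C) by case: (a) => ? ?; exact: sqrtr_ge0.
have a1 : 0 < normc (a : C) + 1 by rewrite ltr_wpDl.
have e2 : 0 < e / 2 by rewrite divr_gt0.
have [r fr] := bf al (e / 2 / (normc (a : C) + 1)) (divr_gt0 e2 a1).
have [q gq] := bg al (e / 2) e2.
exists (Num.max r q) => x; rewrite gt_max => /andP[rx qx].
rewrite /multi_deriv iter_partial_lin//; apply: le_lt_trans (normc_lin _ _ _) _.
rewrite [ltRHS]splitr; apply: ler_ltD; last exact: gq.
apply: (@le_trans _ _ (normc (a : C) * (e / 2 / (normc (a : C) + 1)))).
  exact: (ler_wpM2l a0 (ltW (fr _ rx))).
rewrite mulrCA -[leRHS]mulr1; apply: (ler_wpM2l (ltW e2)).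
by rewrite ler_pdivrMr// mul1r lerDl.
Qed.

HB.instance Definition _ := GRing.isSubmodClosed.Build _ _ DLinf_pred
  DLinf_submod_closed.

HB.instance Definition _ := GRing.isSubmodClosed.Build _ _ Bdot_pred
  Bdot_submod_closed.

Record DLinf := MkDLinf { DLinf_val :> Rn -> C; _ : DLinf_val \in DLinf_pred }.
HB.instance Definition _ := [isSub for DLinf_val].
HB.instance Definition _ := [Choice of DLinf by <:].
HB.instance Definition _ := [SubChoice_isSubLmodule of DLinf by <:].

Record Bdot := MkBdot { Bdot_val :> Rn -> C; _ : Bdot_val \in Bdot_pred }.
HB.instance Definition _ := [isSub for Bdot_val].
HB.instance Definition _ := [Choice of Bdot by <:].
HB.instance Definition _ := [SubChoice_isSubLmodule of Bdot by <:].

End functions.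

(* The topology generated by the seminorms p i, i \in D. Values in \bar R so
   that suprema can be written down before they are known to be finite. *)
Section seminorm_topology.
Variables (R : realType) (E : zmodType) (I : choiceType).
Variables (D : set I) (p : I -> E -> \bar R).

Definition seminorm_topology : set_system E := [set U | forall x, U x ->
  exists F : set I, [/\ finite_set F, F `<=` D & exists2 e : R, 0 < e &
    forall y, (forall i, F i -> (p i (y - x) < e%:E)%E) -> U y]].

Lemma seminorm_topologyT : seminorm_topology setT.
Proof.
move=> x _; exists set0; split; [exact: finite_set0|exact: sub0set|].
by exists 1.
Qed.

Lemma seminorm_topologyI : setI_closed seminorm_topology.
Proof.
move=> U V oU oV x [Ux Vx].
have [F [finF FD [d d0 dU]]] := oU x Ux.
have [G [finG GD [e e0 eV]]] := oV x Vx.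
exists (F `|` G); split; [by rewrite finite_setU|by rewrite subUset|].
exists (Num.min d e); first by rewrite lt_min d0.
move=> y FGy; split.
  apply: dU => i Fi; apply: lt_le_trans (FGy i (or_introl Fi)) _.
  by rewrite lee_fin ge_min lexx.
apply: eV => i Gi; apply: lt_le_trans (FGy i (or_intror Gi)) _.
by rewrite lee_fin ge_min lexx orbT.
Qed.

Lemma seminorm_topology_bigU (J : Type) (f : J -> set E) :
  (forall j, seminorm_topology (f j)) -> seminorm_topology (\bigcup_j f j).
Proof.
move=> of_ x [j _ fjx]; have [F [finF FD [e e0 eU]]] := of_ j x fjx.
by exists F; split => //; exists e => // y /eU fjy; exists j.
Qed.

End seminorm_topology.

Section locally_convex.
Variable K : numFieldType.

Definition tvs_bounded (E : preTopologicalLmodType K) (B : set E) : Prop :=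
  forall U, nbhs (0 : E) U ->
    exists2 r : K, 0 < r & forall k, r <= `|k| -> B `<=` [set k *: u | u in U].

Definition absolutely_convex (E : lmodType K) (A : set E) : Prop :=
  convex_set A /\ forall (k : K) u, `|k| <= 1 -> A u -> A (k *: u).

End locally_convex.

Section spaces.
Variables (R : realType) (n : nat).
Local Notation Rn := 'rV[R]_n.
Local Notation C := (R[i]^o).

Definition sup_norm (f : Rn -> C) : \bar R :=
  ereal_sup [set (normc (f x))%:E | x in setT].

(* sup_{|a| <= m} || d^a f ||_oo *)
Definition Cm_norm (m : nat) (f : Rn -> C) : \bar R :=
  ereal_sup [set sup_norm (multi_deriv (@partial R n) a f)
            | a in [set a | (mi_order a <= m)%N]].

Definition bessel_norm (m : nat) (f : Rn -> C) : \bar R :=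
  sup_norm (iter m (one_minus_laplacian (@partial R n)) f).

HB.instance Definition _ := isOpenTopological.Build (DLinf R n)
  (seminorm_topologyT setT (fun m (f : DLinf R n) => Cm_norm m f))
  (@seminorm_topologyI _ _ _ _ _) (@seminorm_topology_bigU _ _ _ _ _).

HB.instance Definition _ := isOpenTopological.Build (Bdot R n)
  (seminorm_topologyT setT (fun m (f : Bdot R n) => Cm_norm m f))
  (@seminorm_topologyI _ _ _ _ _) (@seminorm_topology_bigU _ _ _ _ _).

Definition DL1_pred : {pred (Bdot R n -> C)} := fun S =>
  `[< linear S /\ continuous S >].

Lemma DL1_submod_closed : submod_closed DL1_pred.
Proof.
split.
  apply/asboolP; split; last exact: cst_continuous.
  by move=> a f g /=; rewrite scaler0 addr0.
move=> a S T /asboolP[lS cS] /asboolP[lT cT]; apply/asboolP; split.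
  move=> k u v; rewrite !fctE lS lT !scalerDr !scalerA (mulrC a).
  by rewrite addrACA.
move=> x; apply: (@cvgD _ C _ _ _ (a *: S)) (cT x).
exact: (@cvgZl_tmp _ C _ _ _ a S _ (cS x)).
Qed.

HB.instance Definition _ := GRing.isSubmodClosed.Build _ _ DL1_pred
  DL1_submod_closed.

Record DL1 := MkDL1 { DL1_val :> Bdot R n -> C; _ : DL1_val \in DL1_pred }.
HB.instance Definition _ := [isSub for DL1_val].
HB.instance Definition _ := [Choice of DL1 by <:].
HB.instance Definition _ := [SubChoice_isSubLmodule of DL1 by <:].

Definition DL1c := DL1.
HB.instance Definition _ := GRing.Lmodule.on DL1c.

(* DL1 carries the strong topology, DL1c the topology kappa. *)
Definition beta_emb (S : DL1) : {family @tvs_bounded _ (Bdot R n), Bdot R n -> C} := S.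

HB.instance Definition _ := Topological.copy DL1 (initial_topology beta_emb).

Definition kappa_family : set (set (Bdot R n)) :=
  [set A | absolutely_convex A /\ compact A].

Definition kappa_emb (S : DL1c) : {family kappa_family, Bdot R n -> C} :=
  DL1_val S.

HB.instance Definition _ := Topological.copy DL1c (initial_topology kappa_emb).

(* Linear forms on test functions, and the distributional derivative on
   them; elements of DL1 are compared with them on Bdot. *)
Definition form := (Rn -> C) -> C.

Definition dist_deriv (i : 'I_n) (T : form) : form := fun f => - T (partial i f).

Definition dist_of_fct (f : Rn -> C) : form := fun phi =>
  integral_Rn (fun x => f x * phi x).

Definition represents (T : form) (S : DL1) : Prop :=
  forall phi : Bdot R n, S phi = T phi.

(* L_{-2m} * B_{1,1}: the operator (1 - Laplacian)^m acts on the
   distribution defined by f. *)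
Definition bessel_B11 (m : nat) : set DL1 := [set S | exists2 f, B11 f &
  represents (iter m (one_minus_laplacian dist_deriv) (dist_of_fct f)) S].

(* The extension of the pairing to D_{L^oo}: z is obtained from some
   representation S = \sum_a d^a f_a with f_a in L^1. The value does not depend
   on the representation, and one always exists, so xget is only a choice of
   representation. *)
Definition pairing_graph (phi : Rn -> C) (S : DL1) (z : C) : Prop :=
  exists (r : seq (multi_index n)) (f : multi_index n -> Rn -> C),
  [/\ forall a, a \in r -> L1 (f a),
      represents (\sum_(a <- r) multi_deriv dist_deriv a (dist_of_fct (f a))) S &
      z = \sum_(a <- r) (-1) ^+ mi_order a *
            integral_Rn (fun x => f a x * multi_deriv (@partial R n) a phi x)].

Definition pairing (phi : Rn -> C) (S : DL1) : C :=
  xget 0 (pairing_graph phi S).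

(* For B = set0 these suprema are -oo instead of 0; this imposes no condition
   in seminorm_topology, just as the zero seminorm. *)
Definition sup_pairing (B : set DL1) (phi : DLinf R n) : \bar R :=
  ereal_sup [set (normc (pairing phi S))%:E | S in B].

Definition sup_eval (B : set DL1) (phi : Bdot R n) : \bar R :=
  ereal_sup [set (normc (S phi))%:E | S in B].

End spaces.

(* Main.v *)
Require Import Defs.
From mathcomp Require Import all_boot all_order all_algebra.
From mathcomp Require Import complex.
From mathcomp Require Import all_classical all_reals all_analysis.
From mathcomp Require Import measurable_realfun ring lra.

Set Implicit Arguments.
Unset Strict Implicit.
Unset Printing Implicit Defensive.

Import Order.TTheory GRing.Theory Num.Theory.
Import numFieldNormedType.Exports ComplexField.Normc.

Local Open Scope classical_set_scope.
Local Open Scope ring_scope.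

(** The whole statement reduces to one fact about a bounded set B of linear
    forms on the test functions vanishing at infinity: B is equicontinuous,
    that is, there are m and K such that every S in B satisfies
      |S phi| <= K sup_{|a| <= m} ||d^a phi||_oo          (polar_set m K).
    Equicontinuous sets are bounded for both topologies, because bounded and
    compact sets of test functions have bounded seminorms. Conversely a set
    that is bounded, or relatively compact, for one of the topologies is
    bounded at each test function, and uniform_boundedness then makes it
    equicontinuous, the space of test functions being complete. The polar
    sets are compact for kappa (compact_polar): an ultrafilter on a polar set
    converges pointwise, and by equicontinuity uniformly on compact sets. This
    is the first assertion.

    For the second one, the seminorms of order m are compared with the norms
    ||(1 - Laplacian)^m phi||_oo. The maximum principle gives
    ||u|| <= ||(1 - Laplacian) u|| for bounded smooth u, and the same principle
    applied to a barrier function on a slab gives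
    ||d_i u|| <= 2 ||(1 - Laplacian) u|| (gradient_lap_bound); iterating,
    all derivatives of order m are controlled by (1 - Laplacian)^m. So an
    equicontinuous S is dominated by ||(1 - Laplacian)^m phi||_oo. A density
    for S is found without fundamental solutions of the Laplacian. Let E be
    the product of the kernels s e^{-s} on the half-lines, a probability
    density, and conv the corresponding average. It inverts the product of the
    operators (1 - d_i)^2, which is dominated by 9^n (1 - Laplacian)^(2n) in
    the sup norm; as conv commutes with derivatives,
      ||phi|| <= 9^n ||conv ((1 - Laplacian)^(2n) phi)||   (conv_lap_bound).
    Hence S phi depends boundedly on conv ((1 - Laplacian)^(2n+m) phi), and
    by the Hahn-Banach theorem it is the value there of a bounded linear
    functional L on all bounded functions. Put f y = L (x |-> E (y - x)).
    This function is Lipschitz; approximating integrals by Riemann sums, which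
    L may be exchanged with, one finds that the L^1 norm of f is at most the
    norm of L and that L (conv psi) is the integral of f psi
    (lap_functional_density). So S = (1 - Laplacian)^(2n+m) f with a bound on
    ||f||_1 that depends only on m and K (equicontinuous_density).

    For the pairing with a test function phi that need not vanish at infinity,
    let phi_k be its product with x |-> q (x / (k+1)), where
    q x = 1 / (1 + |x|^2). The phi_k vanish at infinity with all their
    derivatives, are dominated by phi in every seminorm, and their derivatives
    converge pointwise to those of phi. By dominated convergence each
    representation of S yields the limit of S phi_k (pairing_graph_limit), so
    that the pairing is well defined and satisfies the estimate of an
    equicontinuous family. The reverse estimate comes from the bounded sets
    formed by the derivatives of order at most m of all Dirac measures. *)

(** * Continuity and one-variable calculus along lines *)

Section continuity.
Variables (R : realType) (T : topologicalType).
Implicit Types f g : T -> R.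

Lemma fun_continuousD f g : continuous f -> continuous g ->
  continuous (fun x => f x + g x).
Proof. by move=> cf cg x; apply: cvgD; [exact: cf|exact: cg]. Qed.

Lemma fun_continuousB f g : continuous f -> continuous g ->
  continuous (fun x => f x - g x).
Proof. by move=> cf cg x; apply: cvgB; [exact: cf|exact: cg]. Qed.

Lemma fun_continuousM f g : continuous f -> continuous g ->
  continuous (fun x => f x * g x).
Proof. by move=> cf cg x; apply: cvgM; [exact: cf|exact: cg]. Qed.

Lemma fun_continuous_cst (c : R) : continuous (fun _ : T => c).
Proof. by move=> x; exact: cvg_cst. Qed.

Lemma fun_continuous_sum (I : Type) (r : seq I) (F : I -> T -> R) :
  (forall i, continuous (F i)) -> continuous (fun x => \sum_(i <- r) F i x).
Proof.
move=> cF; elim: r => [|i r IH].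
  by under eq_fun do rewrite big_nil; exact: fun_continuous_cst.
by under eq_fun do rewrite big_cons; exact: fun_continuousD.
Qed.

End continuity.

Lemma fun_continuous_comp (R : realType) (S T : topologicalType) (f : S -> T)
  (g : T -> R) : continuous f -> continuous g -> continuous (fun x => g (f x)).
Proof. by move=> cf cg x; apply: continuous_comp; [exact: cf|exact: cg]. Qed.

Lemma dist_halves (R : realFieldType) (a b c e : R) :
  `|a - b| < e / 2 -> `|c - b| < e / 2 -> `|a - c| <= e.
Proof.
rewrite (_ : a - c = (a - b) - (c - b)); last by ring.
by move=> ab cb; apply: le_trans (ler_normB _ _) _; lra.
Qed.

Section line.
Variables (R : realType) (V : normedModType R).
Implicit Types (u : V -> R) (x v : V).

(** The chain rule along a line needs only the derivative in that direction; no
    differentiability of u is assumed. *)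
Lemma is_derive_line u x v (t : R) : derivable u (x + t *: v) v ->
  is_derive t 1 (fun s : R => u (x + s *: v)) ('D_v u (x + t *: v)).
Proof.
have E : (fun h => h^-1 *: (((fun s : R => u (x + s *: v)) \o shift t) (h *: 1) -
      u (x + t *: v))) =
    (fun h => h^-1 *: ((u \o shift (x + t *: v)) (h *: v) - u (x + t *: v))).
  apply/funext => h /=; congr (_ *: (u _ - _)).
  by rewrite [h *: 1]mulr1 scalerDl addrCA.
move=> du; split; first by rewrite /derivable E.
by rewrite /derive E.
Qed.

Lemma line_mvt u x v (h : R) : (forall y, derivable u y v) ->
  exists2 c, `|c| <= `|h| & u (x + h *: v) - u x = h * 'D_v u (x + c *: v).
Proof.
move=> du; pose g (s : R) := u (x + s *: v).
have dg (t : R) : is_derive t 1 g ('D_v u (x + t *: v)) by exact: is_derive_line.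
have cg (a b : R) : {within `[a, b], continuous g}.
  apply: continuous_subspaceT => t; apply: differentiable_continuous.
  by apply/derivable1_diffP; case: (dg t).
have g0 : g 0 = u x by rewrite /g scale0r addr0.
have [h0|h0] := leP 0 h.
  have [c] := MVT_segment h0 (fun t _ => dg t) (cg 0 h).
  rewrite in_itv/= g0 subr0 mulrC => /andP[c0 ch] E.
  by exists c => //; rewrite !ger0_norm.
have [c] := MVT_segment (ltW h0) (fun t _ => dg t) (cg h 0).
rewrite in_itv/= g0 sub0r => /andP[hc c0] E; exists c.
  by rewrite (ltr0_norm h0) ler0_norm// lerN2.
by apply: oppr_inj; rewrite opprB E mulrN mulrC.
Qed.

(** If g2 were positive, g1 would be positive just to the right of 0, where g
    would then increase. *)
Lemma second_derivative_test (g g1 : R -> R) (g2 d : R) : 0 < d ->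
  (forall t : R, is_derive t 1 g (g1 t)) -> is_derive (0 : R) 1 g1 g2 ->
  (forall t, `|t| < d -> g t <= g 0) -> g2 <= 0.
Proof.
move=> d0 dg dg1 gmax.
have g10 : g1 0 = 0.
  have dd : -d <= d by lra.
  have [] : is_derive (0 : R) 1 g 0.
    apply: (@derive1_at_max _ g (-d) d 0) => //.
    - by rewrite in_itv/= oppr_lt0 d0.
    - by move=> t; rewrite in_itv/= -ltr_norml; exact: gmax.
  by case: (dg 0) => _ -> _ ->.
rewrite leNgt; apply/negP => g20.
have [dd1 dd2] := dg1.
have : h^-1 *: ((g1 \o shift 0) (h *: 1) - g1 0) @[h --> 0^'] --> g2.
  by rewrite -dd2; exact: dd1.
move=> /cvgrPdist_lt /(_ g2 g20) [e /= e0 He].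
pose m := Num.min (d / 2) (e / 2).
have m0 : 0 < m by rewrite lt_min !divr_gt0.
have md : m < d by rewrite gt_min ltr_pdivrMr// ltr_pMr// ltr1n.
have me : m < e by rewrite gt_min orbC ltr_pdivrMr// ltr_pMr// ltr1n.
have g1pos t : t \in `]0, m[ -> 0 < g1 t.
  rewrite in_itv/= => /andP[t0 tm].
  have /= := He t; rewrite sub0r normrN gtr0_norm// (lt_trans tm me).
  rewrite gt_eqF// g10 subr0 addr0 [t *: 1]mulr1 => /(_ isT isT).
  rewrite ltr_norml => /andP[_]; rewrite ltrBlDr ltrDl.
  by rewrite [_ *: _]/(_ * _) pmulr_rgt0 ?invr_gt0.
have cg : {within `[0, m], continuous g}.
  apply: continuous_subspaceT => t; apply: differentiable_continuous.
  by apply/derivable1_diffP; case: (dg t).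
have [c c0m E] := MVT m0 (fun t _ => dg t) cg.
have : 0 < g m - g 0 by rewrite E subr0 mulr_gt0 ?g1pos.
by rewrite subr_gt0 ltNge gmax// gtr0_norm.
Qed.

Lemma is_derive_translate u y v h : derivable u (y + h) v ->
  is_derive y v (fun z => u (z + h)) ('D_v u (y + h)).
Proof.
move=> du; have E : (fun r => r^-1 *: (((fun z => u (z + h)) \o shift y) (r *: v) -
    u (y + h))) = (fun r => r^-1 *: ((u \o shift (y + h)) (r *: v) - u (y + h))).
  by apply/funext => r /=; rewrite addrA.
by split; rewrite /derivable /derive E.
Qed.

End line.

(** * Smooth functions, symmetry of derivatives, the maximum principle *)

Section real_calculus.
Variables (R : realType) (n : nat).
Local Notation Rn := 'rV[R]_n.
Implicit Types (u w : Rn -> R) (x y : Rn) (i j : 'I_n) (s : seq 'I_n).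

Definition unit_vec i : Rn := delta_mx 0 i.
Definition rpartial i u : Rn -> R := fun x => 'D_(unit_vec i) u x.
(** Smoothness of real functions through words of partial derivatives, as for
    the components of a complex function; a one-constructor predicate keeps the
    quantifier over words from being unfolded by tactics. *)
Variant rsmooth u : Prop := Rsmooth of forall s,
  continuous (iter_deriv rpartial s u) /\
  forall i x, derivable (iter_deriv rpartial s u) x (unit_vec i).

Lemma rsmoothP u s : rsmooth u -> continuous (iter_deriv rpartial s u) /\
  forall i x, derivable (iter_deriv rpartial s u) x (unit_vec i).
Proof. by case. Qed.

Lemma rsmooth_continuous u : rsmooth u -> continuous u.
Proof. by move=> /(rsmoothP [::])[]. Qed.

Lemma rsmooth_derivable u i x : rsmooth u -> derivable u x (unit_vec i).
Proof. by move=> /(rsmoothP [::])[]. Qed.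

Lemma iter_deriv_cat (E : zmodType) (D : 'I_n -> E -> E) s1 s2 (a : E) :
  iter_deriv D (s1 ++ s2) a = iter_deriv D s1 (iter_deriv D s2 a).
Proof. by rewrite /iter_deriv foldr_cat. Qed.

Lemma iter_deriv_cons (E : zmodType) (D : 'I_n -> E -> E) i s (a : E) :
  iter_deriv D (i :: s) a = D i (iter_deriv D s a).
Proof. by []. Qed.

Lemma rsmooth_iter u s : rsmooth u -> rsmooth (iter_deriv rpartial s u).
Proof. by move=> su; split=> t; rewrite -iter_deriv_cat; exact: rsmoothP. Qed.

Lemma rsmooth_partial u i : rsmooth u -> rsmooth (rpartial i u).
Proof. exact: (rsmooth_iter [:: i]). Qed.

Lemma rsmooth_is_derive u i x (t : R) : rsmooth u ->
  is_derive t 1 (fun s : R => u (x + s *: unit_vec i))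
    (rpartial i u (x + t *: unit_vec i)).
Proof. by move=> su; apply: is_derive_line; exact: rsmooth_derivable. Qed.

Lemma norm_unit_vec i : `|unit_vec i| = 1.
Proof.
apply/le_anti/andP; split.
  rewrite [`|_|]mx_normrE; apply/bigmax_leP; split => // -[a b] _ /=.
  by rewrite mxE; case: (_ && _); rewrite ?normr1 ?normr0.
rewrite [`|_|]mx_normrE; apply: le_trans (le_bigmax _ _ (0, i)) => /=.
by rewrite mxE !eqxx normr1.
Qed.

Lemma norm_coord x i : `|x 0 i| <= `|x|.
Proof.
rewrite [`|x|]mx_normrE.
exact: le_trans (le_bigmax _ (fun ij : 'I_1 * 'I_n => `|x ij.1 ij.2|) (0, i)).
Qed.

Local Opaque unit_vec.

(** Both mixed derivatives are limits of the same second difference quotient,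
    which the mean value theorem turns into a mixed derivative at a nearby
    point, in either order. *)
Lemma rpartialC u i j : rsmooth u ->
  rpartial i (rpartial j u) = rpartial j (rpartial i u).
Proof.
move=> su; apply/funext => x.
have [cij _] := rsmoothP [:: i; j] su; have [cji _] := rsmoothP [:: j; i] su.
apply/eqP; rewrite -subr_eq0 -normr_le0; apply/ler_addgt0Pr => e e0.
rewrite add0r.
have e2 : 0 < e / 2 by rewrite divr_gt0.
have /cvgrPdist_lt /(_ _ e2) /nbhs_normP [d1 /= d10 H1] := cij x.
have /cvgrPdist_lt /(_ _ e2) /nbhs_normP [d2 /= d20 H2] := cji x.
pose h := Num.min (d1 / 3) (d2 / 3).
have h0 : 0 < h by rewrite lt_min !divr_gt0.
have near12 (a b : R) (k l : 'I_n) : `|a| <= h -> `|b| <= h ->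
    `|x - (x + a *: unit_vec k + b *: unit_vec l)| < Num.min d1 d2.
  move=> ah bh; rewrite -addrA opprD addrA subrr sub0r normrN.
  apply: le_lt_trans (ler_normD _ _) _; rewrite !normrZ !norm_unit_vec !mulr1.
  apply: le_lt_trans (lerD ah bh) _.
  rewrite lt_min /h /Num.min; case: ifP => [|/negbT]; rewrite -?leNgt => ?; lra.
pose a i := h *: unit_vec i.
pose Dl := u (x + a i + a j) - u (x + a i) - (u (x + a j) - u x).
have hh : `|h| = h by rewrite gtr0_norm.
have DlE (k l : 'I_n) : exists c c', [/\ `|c| <= h, `|c'| <= h &
    u (x + a k + a l) - u (x + a k) - (u (x + a l) - u x) =
    h * (h * rpartial l (rpartial k u) (x + c *: unit_vec k + c' *: unit_vec l))].
  pose w y := u (y + a l) - u y.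
  have dS y : is_derive y (unit_vec k) (fun z => u (z + a l))
      (rpartial k u (y + a l)).
    by apply: is_derive_translate; exact: rsmooth_derivable.
  have dw y : derivable w y (unit_vec k).
    by apply: derivableB; [case: (dS y)|exact: rsmooth_derivable].
  have [c ch E] := line_mvt x h dw.
  have [c' ch' E'] := line_mvt (x + c *: unit_vec k) h
     (fun y => @rsmooth_derivable _ l y (rsmooth_partial k su)).
  exists c, c'; rewrite -hh; split=> //; rewrite hh.
  have Ew : 'D_(unit_vec k) w (x + c *: unit_vec k) =
      rpartial k u (x + c *: unit_vec k + a l) - rpartial k u (x + c *: unit_vec k).
    have [d1' d2'] := dS (x + c *: unit_vec k).
    rewrite (deriveB d1'); last exact: rsmooth_derivable.
    by rewrite d2'.
  rewrite Ew E' /w in E; rewrite -E /a.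
  by [].
have [c [c' [ch ch' E1]]] := DlE i j.
have [b [b' [bh bh' E2]]] := DlE j i.
(* The second difference does not depend on the order of the two increments. *)
have swap (p q r z : R) : p - q - (r - z) = p - r - (q - z) by ring.
have Eij : rpartial j (rpartial i u) (x + c *: unit_vec i + c' *: unit_vec j) =
   rpartial i (rpartial j u) (x + b *: unit_vec j + b' *: unit_vec i).
  have h00 := lt0r_neq0 h0; apply: (mulfI h00); apply: (mulfI h00).
  rewrite (addrAC x (a j)) in E2.
  exact: etrans (esym E1) (etrans (swap _ _ _ _) E2).
have := near12 c c' i j ch ch'; rewrite lt_min => /andP[_ /H2 /=].
have := near12 b b' j i bh bh'; rewrite lt_min => /andP[/H1 /= + _].
rewrite /iter_deriv /= Eij.
exact: dist_halves.
Qed.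

Lemma rpartial_lin (a : R) u w i : rsmooth u -> rsmooth w ->
  rpartial i (a *: u + w) = a *: rpartial i u + rpartial i w.
Proof.
move=> su sw; apply/funext => x; rewrite /rpartial.
have du := @rsmooth_derivable u i x su; have dw := @rsmooth_derivable w i x sw.
by rewrite deriveD ?deriveZ//; exact: derivableZ.
Qed.

Lemma rpartial_cst (c : R) i : rpartial i (cst c) = 0.
Proof. by apply/funext => x; rewrite /rpartial derive_cst. Qed.

Local Opaque rpartial.

Lemma iter_rpartial_lin (a : R) u w s : rsmooth u -> rsmooth w ->
  iter_deriv rpartial s (a *: u + w) =
  a *: iter_deriv rpartial s u + iter_deriv rpartial s w.
Proof.
move=> su sw; elim: s => [//|i s IH]; rewrite !iter_deriv_cons IH.
by rewrite rpartial_lin//; exact: rsmooth_iter.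
Qed.

Lemma rsmooth_lin (a : R) u w : rsmooth u -> rsmooth w -> rsmooth (a *: u + w).
Proof.
move=> su sw; split=> s; rewrite iter_rpartial_lin//.
have [cu du] := rsmoothP s su; have [cw dw] := rsmoothP s sw; split.
  by move=> x; apply: cvgD (cw x); apply: cvgZl_tmp (cu x).
by move=> i x; apply: derivableD => //; exact: derivableZ.
Qed.

Lemma iter_rpartial_cst (c : R) s : iter_deriv rpartial s (cst c) =
  cst (if s is [::] then c else 0).
Proof.
elim: s => [//|i s IH]; rewrite iter_deriv_cons IH.
by rewrite rpartial_cst.
Qed.

Lemma rsmooth_cst (c : R) : rsmooth (cst c).
Proof.
split=> s; rewrite iter_rpartial_cst; split; first exact: cst_continuous.
by move=> i x; exact: derivable_cst.
Qed.

Lemma rsmooth0 : rsmooth (0 : Rn -> R).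
Proof. exact: rsmooth_cst 0. Qed.

Lemma rsmoothZ (a : R) u : rsmooth u -> rsmooth (a *: u).
Proof. by move=> su; rewrite -[_ *: _]addr0; apply: rsmooth_lin => //; exact: rsmooth0. Qed.

Lemma rsmoothD u w : rsmooth u -> rsmooth w -> rsmooth (u + w).
Proof. by move=> su sw; rewrite -[u]scale1r; exact: rsmooth_lin. Qed.

Lemma rsmoothN u : rsmooth u -> rsmooth (- u).
Proof. by rewrite -scaleN1r; exact: rsmoothZ. Qed.

Lemma rsmooth_sum (I : Type) (r : seq I) (F : I -> Rn -> R) :
  (forall k, rsmooth (F k)) -> rsmooth (\sum_(k <- r) F k).
Proof.
move=> sF; elim: r => [|k r IH]; first by rewrite big_nil; exact: rsmooth0.
by rewrite big_cons; exact: rsmoothD.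
Qed.

Lemma rpartial2_lin (a : R) u w i : rsmooth u -> rsmooth w ->
  rpartial i (rpartial i (a *: u + w)) =
  a *: rpartial i (rpartial i u) + rpartial i (rpartial i w).
Proof. by move=> su sw; rewrite !rpartial_lin//; exact: rsmooth_partial. Qed.

Lemma rpartialN u i : rsmooth u -> rpartial i (- u) = - rpartial i u.
Proof.
move=> su; rewrite -scaleN1r -[_ *: u]addr0 rpartial_lin//; last exact: rsmooth0.
by rewrite (rpartial_cst 0) addr0 scaleN1r.
Qed.

Lemma rpartial2N u i : rsmooth u ->
  rpartial i (rpartial i (- u)) = - rpartial i (rpartial i u).
Proof. by move=> su; rewrite !rpartialN//; exact: rsmooth_partial. Qed.

Lemma iter_rpartial0 s : iter_deriv rpartial s 0 = 0.
Proof. by have := iter_rpartial_cst 0 s; case: s. Qed.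

Lemma iter_rpartialZ (a : R) u s : rsmooth u ->
  iter_deriv rpartial s (a *: u) = a *: iter_deriv rpartial s u.
Proof.
move=> su; rewrite -[_ *: u]addr0 iter_rpartial_lin//; last exact: rsmooth0.
by rewrite iter_rpartial0 addr0.
Qed.

Lemma iter_rpartialN u s : rsmooth u ->
  iter_deriv rpartial s (- u) = - iter_deriv rpartial s u.
Proof. by move=> su; rewrite -scaleN1r iter_rpartialZ// scaleN1r. Qed.

Lemma iter_rpartialD u w s : rsmooth u -> rsmooth w ->
  iter_deriv rpartial s (u + w) =
  iter_deriv rpartial s u + iter_deriv rpartial s w.
Proof.
by move=> su sw; rewrite -[u in LHS]scale1r iter_rpartial_lin// scale1r.
Qed.

Lemma iter_rpartial_sum (I : Type) (r : seq I) (F : I -> Rn -> R) s :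
  (forall k, rsmooth (F k)) -> iter_deriv rpartial s (\sum_(k <- r) F k) =
  \sum_(k <- r) iter_deriv rpartial s (F k).
Proof.
move=> sF; elim: r => [|k r IH]; first by rewrite !big_nil iter_rpartial0.
by rewrite !big_cons iter_rpartialD ?IH//; exact: rsmooth_sum.
Qed.

Lemma iter_rpartialC u s t : rsmooth u ->
  iter_deriv rpartial s (iter_deriv rpartial t u) =
  iter_deriv rpartial t (iter_deriv rpartial s u).
Proof.
move=> su; elim: s => [//|i s IH]; rewrite !iter_deriv_cons IH.
move: (rsmooth_iter s su) => {IH su}; move: (iter_deriv _ s u) => w sw.
elim: t => [//|j t IHt]; rewrite !iter_deriv_cons -IHt.
by rewrite rpartialC//; exact: rsmooth_iter.
Qed.

(** By this the bounds on the derivatives indexed by multi-indices extend to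
    derivatives taken in any order. *)
Lemma iter_rpartial_perm u s t : rsmooth u -> perm_eq s t ->
  iter_deriv rpartial s u = iter_deriv rpartial t u.
Proof.
move=> su st; apply: (catCA_perm_ind (P := fun t => iter_deriv rpartial s u =
  iter_deriv rpartial t u)) st _ => //.
move=> s1 s2 s3; rewrite !iter_deriv_cat iter_rpartialC//.
exact: rsmooth_iter.
Qed.

Definition mi_seq (a : multi_index n) : seq 'I_n :=
  flatten [seq nseq (a i) i | i <- enum 'I_n].

(** The multi-index of a word; mi_seq lists the word by which multi_deriv
    differentiates. *)
Definition mi_of s : multi_index n := [ffun i => count_mem i s].

Lemma size_mi_seq a : size (mi_seq a) = mi_order a.
Proof.
rewrite size_flatten /shape -map_comp sumnE big_map big_enum.
by apply: eq_bigr => i _ /=; rewrite size_nseq.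
Qed.

Lemma perm_mi_of s : perm_eq s (mi_seq (mi_of s)).
Proof.
apply/allP => i _; apply/eqP => /=; rewrite count_flatten -map_comp sumnE big_map.
rewrite big_enum (bigD1 i)//= count_nseq/= eqxx mul1n ffunE big1 ?addn0// => j ji.
by rewrite count_nseq/= (negbTE ji).
Qed.

Lemma mi_order_of s : mi_order (mi_of s) = size s.
Proof. by rewrite -size_mi_seq; apply/esym/perm_size/perm_mi_of. Qed.

Local Notation rlap := (one_minus_laplacian rpartial).

Lemma rlapE u x : rlap u x = u x - \sum_i rpartial i (rpartial i u) x.
Proof. by rewrite /one_minus_laplacian !fctE fct_sumE. Qed.

Lemma rsmooth_lap u : rsmooth u -> rsmooth (rlap u).
Proof.
move=> su; apply: rsmoothD => //; apply: rsmoothN; apply: rsmooth_sum => i.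
by do 2 apply: rsmooth_partial.
Qed.

Lemma rsmooth_iter_lap m u : rsmooth u -> rsmooth (iter m rlap u).
Proof. by move=> su; elim: m => // m IH; rewrite iterS; exact: rsmooth_lap. Qed.

Lemma iter_rpartial_lap u s : rsmooth u ->
  iter_deriv rpartial s (rlap u) = rlap (iter_deriv rpartial s u).
Proof.
move=> su; have spp i : rsmooth (rpartial i (rpartial i u)).
  by do 2 apply: rsmooth_partial.
rewrite /one_minus_laplacian iter_rpartialD//; last first.
  by apply/rsmoothN/rsmooth_sum.
rewrite iter_rpartialN; last exact: rsmooth_sum.
rewrite iter_rpartial_sum//; congr (_ - _); apply: eq_bigr => i _.
exact: (iter_rpartialC s [:: i; i]).
Qed.

Lemma iter_rpartial_iter_lap m u s : rsmooth u ->
  iter_deriv rpartial s (iter m rlap u) = iter m rlap (iter_deriv rpartial s u).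
Proof.
move=> su; elim: m => // m IH; rewrite !iterS iter_rpartial_lap ?IH//.
exact: rsmooth_iter_lap.
Qed.

Lemma sum_comb (K : comPzRingType) (F G H : 'I_n -> K) (a p q r : K) :
  (forall i, F i = a * G i + H i) -> p = a * q + r ->
  p - \sum_i F i = a * (q - \sum_i G i) + (r - \sum_i H i).
Proof.
move=> FE ->; rewrite (eq_bigr _ (fun i _ => FE i)) big_split/= -mulr_sumr.
by ring.
Qed.

Lemma rlap_lin (a : R) u w : rsmooth u -> rsmooth w ->
  rlap (a *: u + w) = a *: rlap u + rlap w.
Proof.
move=> su sw; apply/funext => x; rewrite -[RHS]/(a * rlap u x + rlap w x) !rlapE.
by apply: sum_comb => // i; rewrite rpartial2_lin.
Qed.

Lemma iter_lap_lin m (a : R) u w : rsmooth u -> rsmooth w ->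
  iter m rlap (a *: u + w) = a *: iter m rlap u + iter m rlap w.
Proof.
move=> su sw; elim: m => // m IH; rewrite !iterS IH.
by apply: rlap_lin; exact: rsmooth_iter_lap.
Qed.

Definition sqnorm x : R := \sum_j x 0 j ^+ 2.

Lemma sqnorm_ge0 x : 0 <= sqnorm x.
Proof. by apply: sumr_ge0 => j _; exact: sqr_ge0. Qed.

Lemma coord_line x i j (t : R) : (x + t *: unit_vec i) 0 j = x 0 j + t * (j == i)%:R.
Proof. by rewrite !mxE eqxx. Qed.

Lemma sqnorm_line x i (t : R) :
  sqnorm (x + t *: unit_vec i) = sqnorm x + (2 * x 0 i * t + t ^+ 2).
Proof.
rewrite /sqnorm (bigD1 i)//= [in RHS](bigD1 i)//= coord_line eqxx mulr1.
under eq_bigr => j ji do rewrite coord_line (negbTE ji) mulr0 addr0.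
by ring.
Qed.

Lemma norm_le_sqnorm x : `|x| ^+ 2 <= sqnorm x.
Proof.
have [->|x0] := eqVneq x 0; first by rewrite normr0 expr0n/= sqnorm_ge0.
have x0' : mx_norm x != 0 by apply: contra_neq x0 => /mx_norm_eq0.
have [[a i] E] := mx_norm_neq0 x0'.
rewrite [`|x|]E/= real_normK ?num_real// (ord1 a) /sqnorm (bigD1 i)//= lerDl.
by apply: sumr_ge0 => j _; exact: sqr_ge0.
Qed.

Lemma continuous_coord i : continuous (fun x => x 0 i).
Proof. exact: coord_continuous. Qed.

Lemma sqnorm_continuous : continuous sqnorm.
Proof.
apply: fun_continuous_sum => j.
by apply: fun_continuousM; exact: continuous_coord.
Qed.

Lemma compact_ball_closed (r : R) : compact [set x : Rn | `|x| <= r].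
Proof.
apply: bounded_closed_compact.
  exists r; split; first exact: num_real.
  by move=> M rM x /= xr; apply: le_trans xr (ltW rM).
rewrite (_ : [set _ | _] = (fun x : Rn => `|x|) @^-1` [set y | y <= r])//.
by apply: closed_comp => // x _; exact: norm_continuous.
Qed.

(** Coercivity of G outside a ball replaces compactness of D. *)
Lemma max_on_closed (D : set Rn) (G : Rn -> R) x (r : R) : closed D -> D x ->
  continuous G -> (forall y, D y -> r < `|y| -> G y <= G x) ->
  exists2 y, D y & forall z, D z -> G z <= G y.
Proof.
move=> cD Dx cG Gr; pose A := [set y | `|y| <= Num.max r `|x|] `&` D.
have Ax : A x by split => //=; rewrite le_max lexx orbT.
have cA : compact A.
  by apply: compact_closedI cD; exact: compact_ball_closed.
have [y + ymax] := @EVT_max_rV R n G A (ex_intro _ x Ax) cA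
  (continuous_subspaceT cG).
rewrite inE => -[_ Dy]; exists y => // z Dz.
have [zr|zr] := leP `|z| (Num.max r `|x|).
  by apply: ymax; rewrite inE.
apply: le_trans (ymax x _); last by rewrite inE.
by apply: Gr => //; apply: le_lt_trans zr; rewrite le_max lexx.
Qed.

Lemma rpartial2_is_derive u i x : rsmooth u ->
  is_derive (0 : R) 1 (fun t : R => rpartial i u (x + t *: unit_vec i))
    (rpartial i (rpartial i u) x).
Proof.
move=> su; have := rsmooth_is_derive i x 0 (rsmooth_partial i su).
by rewrite scale0r addr0.
Qed.

Lemma rsmooth_is_deriveN u i x (t : R) : rsmooth u ->
  is_derive t 1 (fun s : R => u (x + (- s) *: unit_vec i))
    (- rpartial i u (x + (- t) *: unit_vec i)).
Proof.
move=> su; have dx := rsmooth_is_derive i x (- t) su.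
have := @is_derive1_comp _ (fun s : R => u (x + s *: unit_vec i)) -%R t _ _
  dx (is_deriveN (is_derive_id t 1)).
by rewrite mulrN1.
Qed.

(** At a maximum of u - e |x|^2 the second derivatives of u are at most 2 e; the
    penalty e |x|^2 forces a maximum to exist. *)
Lemma max_principle u (K M : R) : rsmooth u -> (forall x, u x <= M) ->
  (forall x, rlap u x <= K) -> forall x, u x <= K.
Proof.
move=> su uM uK x; apply/ler_addgt0Pr => e' e'0.
(* With e = e' / c the penalty costs at most e' in total. *)
pose c : R := 2 * n%:R + sqnorm x + 1.
have c0 : 0 < c by rewrite ltr_wpDl// addr_ge0// ?sqnorm_ge0// mulr_ge0.
pose e := e' / c; have e0 : 0 < e by rewrite divr_gt0.
pose G y := u y - e * sqnorm y.
have cG : continuous G.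
  apply: fun_continuousB; first exact: rsmooth_continuous.
  by apply: fun_continuousM; [exact: fun_continuous_cst|exact: sqnorm_continuous].
pose r := (M - G x) / e + 1.
have MG : 0 <= (M - G x) / e.
  rewrite divr_ge0// ?(ltW e0)// subr_ge0 /G lerBlDr.
  by apply: le_trans (uM x) _; rewrite lerDl mulr_ge0 ?sqnorm_ge0// ltW.
have [|y _ ymax] := @max_on_closed setT G x r closedT I cG.
  move=> y _ ry; rewrite /G -/(G x) lerBlDr -lerBlDl.
  apply: (@le_trans _ _ (M - G x)); first by rewrite lerD2r.
  rewrite (mulrC e) -ler_pdivrMr//; apply: le_trans (norm_le_sqnorm y).
  have r1 : 1 <= r by rewrite /r lerDr.
  have ry1 : r <= `|y| by exact: ltW.
  have y1 : 1 <= `|y| by exact: le_trans ry1.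
  apply: (@le_trans _ _ r); first by rewrite /r lerDl.
  by apply: le_trans ry1 _; rewrite expr2 ler_peMr.
have dii i : rpartial i (rpartial i u) y <= 2 * e.
  rewrite -subr_le0.
  pose g1 (t : R) := rpartial i u (y + t *: unit_vec i) - e * (2 * y 0 i + 2 * t).
  apply: (@second_derivative_test R (fun t : R => G (y + t *: unit_vec i)) g1 _ 1) => //.
  - move=> t; rewrite /G /g1.
    under eq_fun do rewrite sqnorm_line.
    have := rsmooth_is_derive i y t su => ?.
    apply: is_derive_eq; rewrite /GRing.scale/=; ring.
  - rewrite /g1; have := rpartial2_is_derive i y su => ?.
    apply: is_derive_eq; rewrite /GRing.scale/=; ring.
  - by move=> t _; rewrite scale0r addr0; exact: ymax.
have uy : u y <= K + 2 * n%:R * e.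
  have := uK y; rewrite rlapE lerBlDr => /le_trans; apply.
  rewrite lerD2l; apply: le_trans (ler_sum _ (fun i _ => dii i)) _.
  by rewrite sumr_const card_ord -mulr_natr; lra.
have -> : u x = G x + e * sqnorm x by rewrite /G subrK.
apply: le_trans (lerD (ymax x I) (lexx _)) _.
have : G y <= u y by rewrite /G lerBlDr lerDl mulr_ge0 ?sqnorm_ge0// ltW.
have -> : e' = e * c by rewrite /e mulfVK// gt_eqF.
by rewrite /c; lra.
Qed.

Lemma derive_le_slope (F : R -> R) (d K : R) : is_derive (0 : R) 1 F d ->
  (forall t, 0 < t -> t < 1 -> F t <= F 0 + K * t) -> d <= K.
Proof.
move=> [dF dE] FK; apply/ler_addgt0Pr => e e0.
have : h^-1 *: ((F \o shift 0) (h *: 1) - F 0) @[h --> 0^'] --> d.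
  by rewrite -dE; exact: dF.
move=> /cvgrPdist_lt /(_ e e0) [r /= r0 Hr].
pose t := Num.min (r / 2) (1 / 2).
have t0 : 0 < t by rewrite lt_min !divr_gt0.
have tr : t < r by rewrite /t gt_min; apply/orP; left; lra.
have t1 : t < 1 by rewrite /t gt_min; apply/orP; right; lra.
have := Hr t; rewrite /= sub0r normrN gtr0_norm// gt_eqF// => /(_ tr isT).
rewrite addr0 [t *: 1]mulr1 => /ltr_distlDr; rewrite addrC => /ltW /le_trans; apply.
rewrite [leRHS]addrC lerD2l /GRing.scale/= mulrC ler_pdivrMr//.
by rewrite lerBlDl; exact: FK.
Qed.

Lemma is_derive_barrier (P Q : R -> R) (p q t m k y e : R) :
  is_derive t 1 P p -> is_derive t 1 Q q ->
  is_derive t 1 (fun t => P t + Q t - (m + k * (1 - 2 * (y + t))) -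
    e * (2 * y + 2 * t)) (p + q + 2 * k - 2 * e).
Proof. by move=> dP dQ; apply: is_derive_eq; rewrite /GRing.scale/=; ring. Qed.

Lemma is_derive_penalty (P Q : R -> R) (p q t y e : R) :
  is_derive t 1 P p -> is_derive t 1 Q q ->
  is_derive t 1 (fun t => P t - Q t - e * (2 * y + 2 * t)) (p - q - 2 * e).
Proof. by move=> dP dQ; apply: is_derive_eq; rewrite /GRing.scale/=; ring. Qed.

Lemma sum_second_derivatives (F G : 'I_n -> R) (i : 'I_n) (K e : R) :
  (forall j, F j - G j + (j == i)%:R * K - 2 * e <= 0) ->
  \sum_j F j - \sum_j G j + K - n%:R * (2 * e) <= 0.
Proof.
move=> H; have := ler_sum (index_enum 'I_n) (fun j (_ : true) => H j).
rewrite big1_eq sumrB big_split/= sumrB sumr_const card_ord -mulr_suml.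
have -> : \sum_j (j == i)%:R = 1 :> R.
  by rewrite (bigD1 i)//= eqxx big1 ?addr0// => j /negbTE ->.
rewrite mul1r.
by rewrite (mulr_natl _ n).
Qed.

Lemma barrier_contra (p q N a e : R) : 0 < e -> `|p| <= N -> `|q| <= N ->
  ~ p - q + 2 * (N + (a + 1) * e) - a * (2 * e) <= 0.
Proof. by rewrite !ler_norml => e0 /andP[p1 p2] /andP[q1 q2]; lra. Qed.

(** The difference b y = u (x + y) - u (x + y'), with y' the reflection of y in
    the hyperplane y_i = 0, is compared on the slab 0 <= y_i <= 1 with a barrier w
    depending on y_i only: w is 0 at 0 and 2 M at 1, where it dominates b, and its
    second derivative is below - 2 N, whereas the Laplacian of b is at least
    - 2 N. Hence b - w cannot have a positive maximum, and the slopes at 0 of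
    b <= w give the estimate. *)
Lemma gradient_upper_bound u (M N : R) i : rsmooth u -> (forall x, `|u x| <= M) ->
  (forall x, `|\sum_j rpartial j (rpartial j u) x| <= N) ->
  forall x, rpartial i u x <= M + N / 2.
Proof.
move=> su uM uN x.
have M0 : 0 <= M by exact: le_trans (normr_ge0 _) (uM 0).
have N0 : 0 <= N by exact: le_trans (normr_ge0 _) (uN 0).
pose refl y := x + y - (2 * y 0 i) *: unit_vec i.
pose b y := u (x + y) - u (refl y).
pose w (c s : R) := 2 * M * s + (N + c) * (s * (1 - s)).
(* The term c makes the inequality at a maximum strict, the term e |y|^2 makes
   the maximum exist; e tends to 0 at the end. *)
have barrier (e : R) : 0 < e -> forall y, 0 <= y 0 i -> y 0 i <= 1 ->
    b y <= w ((n%:R + 1) * e) (y 0 i) + e * sqnorm y.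
  move=> e0 y0 y00 y01; set c := (n%:R + 1) * e.
  have c0 : 0 <= c by rewrite mulr_ge0// ?addr_ge0// ltW.
  pose H y := b y - w c (y 0 i) - e * sqnorm y.
  suff : H y0 <= 0 by rewrite /H !lerBlDr add0r (addrC (w _ _)).
  rewrite leNgt; apply/negP => Hy0.
  pose D := [set y : Rn | 0 <= y 0 i <= 1].
  have w0 (s : R) : 0 <= s <= 1 -> 0 <= w c s.
    move=> /andP[s0 s1]; have s1' : 0 <= 1 - s by rewrite subr_ge0.
    by rewrite /w addr_ge0 ?mulr_ge0// ?addr_ge0.
  have b2M y : b y <= 2 * M.
    rewrite /b; have := uM (x + y); have := uM (refl y).
    rewrite !ler_norml => /andP[? ?] /andP[? ?]; lra.
  have crefl : continuous refl.
    move=> y; apply: continuousB.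
      by apply: continuousD; [exact: cst_continuous|exact: cvg_id].
    apply: continuousZr_tmp.
    by apply: fun_continuousM; [exact: fun_continuous_cst|exact: continuous_coord].
  have cxy : continuous (fun y => x + y).
    by move=> y; apply: continuousD; [exact: cst_continuous|exact: cvg_id].
  have cu := rsmooth_continuous su; have ci := @continuous_coord i.
  have cc z : continuous (fun _ : Rn => z : R) by exact: fun_continuous_cst.
  have cH : continuous H.
    apply: fun_continuousB; last first.
      by apply: fun_continuousM => //; exact: sqnorm_continuous.
    apply: fun_continuousB; first apply: fun_continuousB.
    - exact: (fun_continuous_comp _ cu).
    - exact: (fun_continuous_comp _ cu).
    apply: fun_continuousD; first exact: fun_continuousM.
    apply: fun_continuousM => //; apply: fun_continuousM => //.
    exact: fun_continuousB.
  have cD : closed D.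
    rewrite (_ : D = (fun y : Rn => y 0 i) @^-1` [set` `[0, 1]]); last first.
      by apply/seteqP; split => z /=; rewrite in_itv.
    by apply: closed_comp; [move=> z _; exact: continuous_coord|exact: itv_closed].
  pose r := 2 * M / e + 1.
  have Me0 : 0 <= 2 * M / e by rewrite divr_ge0 ?mulr_ge0// ltW.
  have [||y Dy ymax] := @max_on_closed D H y0 r cD _ cH.
  - by rewrite /D/= y00 y01.
  - move=> y Dy ry; apply: le_trans (ltW Hy0).
    rewrite /H subr_le0; apply: (@le_trans _ _ (2 * M)).
      by rewrite lerBlDr; apply: le_trans (b2M y) _; rewrite lerDl w0.
    rewrite (mulrC e) -ler_pdivrMr//; apply: le_trans (norm_le_sqnorm y).
    have r1 : 1 <= r by rewrite /r lerDr.
    have ry1 : r <= `|y| by exact: ltW.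
    have y1 : 1 <= `|y| by exact: le_trans ry1.
    apply: (@le_trans _ _ r); first by rewrite /r lerDl.
    by apply: le_trans ry1 _; rewrite expr2 ler_peMr.
  have Hy : 0 < H y by apply: lt_le_trans Hy0 (ymax _ _); rewrite /D/= y00 y01.
  have /andP[yi0 yi1] := Dy.
  have yi0' : 0 < y 0 i.
    rewrite lt_neqAle yi0 andbT; apply/eqP => yi.
    move: Hy; rewrite /H /b /refl -yi mulr0 scale0r !subr0 subrr /w.
    have := sqnorm_ge0 y => s0; have : 0 <= e * sqnorm y by rewrite mulr_ge0// ltW.
    by lra.
  have yi1' : y 0 i < 1.
    rewrite lt_neqAle yi1 andbT; apply/eqP => yi.
    move: Hy; rewrite /H yi /w.
    have := sqnorm_ge0 y => s0; have : 0 <= e * sqnorm y by rewrite mulr_ge0// ltW.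
    have := b2M y; lra.
  pose d := Num.min (y 0 i) (1 - y 0 i).
  have d0 : 0 < d by rewrite lt_min yi0' subr_gt0.
  have Dd j (t : R) : `|t| < d -> D (y + t *: unit_vec j).
    rewrite lt_min !ltr_norml => /andP[/andP[t1 t2] /andP[t3 t4]].
    by rewrite /D/= coord_line; case: (i == j); rewrite ?mulr1 ?mulr0; lra.
  pose X := x + y; pose Y := refl y.
  have lineX j (t : R) : x + (y + t *: unit_vec j) = X + t *: unit_vec j.
    by rewrite addrA.
  have lineY j (t : R) : j != i -> refl (y + t *: unit_vec j) = Y + t *: unit_vec j.
    by move=> ji; rewrite /refl coord_line eq_sym (negbTE ji) mulr0 addr0 lineX addrAC.
  have lineYi (t : R) : refl (y + t *: unit_vec i) = Y + (- t) *: unit_vec i.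
    rewrite /refl coord_line eqxx mulr1 /Y /refl -!addrA; congr (_ + (_ + _)).
    by rewrite -!scaleNr -!scalerDl; congr (_ *: _); rewrite /GRing.scale/=; ring.
  have dj j : rpartial j (rpartial j u) X - rpartial j (rpartial j u) Y +
      (j == i)%:R * (2 * (N + c)) - 2 * e <= 0.
    have HjE (t : R) : `|t| < d -> H (y + t *: unit_vec j) <= H (y + 0 *: unit_vec j).
      by move=> td; rewrite scale0r addr0; apply: ymax; exact: Dd.
    have [ji|ji] := eqVneq j i.
      subst j.
      pose g1 (t : R) := rpartial i u (X + t *: unit_vec i) +
        rpartial i u (Y + (- t) *: unit_vec i) -
        (2 * M + (N + c) * (1 - 2 * (y 0 i + t))) - e * (2 * y 0 i + 2 * t).
      apply: (@second_derivative_test R _ g1 _ d) HjE => //.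
      - move=> t; rewrite /H /b /w /g1.
        under eq_fun do rewrite sqnorm_line coord_line eqxx mulr1 lineX lineYi.
        have := rsmooth_is_derive i X t su => ?.
        have := rsmooth_is_deriveN i Y t su => ?.
        apply: is_derive_eq; rewrite /GRing.scale/=; ring.
      - rewrite /g1; have dX := rpartial2_is_derive i X su.
        have := rsmooth_is_deriveN i Y 0 (rsmooth_partial i su).
        rewrite oppr0 scale0r addr0 => dY; rewrite mul1r.
        exact: is_derive_barrier.
    pose g1 (t : R) := rpartial j u (X + t *: unit_vec j) -
        rpartial j u (Y + t *: unit_vec j) - e * (2 * y 0 j + 2 * t).
    apply: (@second_derivative_test R _ g1 _ d) HjE => //.
    - move=> t; rewrite /H /b /w /g1.
      under eq_fun do rewrite sqnorm_line coord_line eq_sym (negbTE ji) mulr0 addr0 lineX (lineY _ _ ji).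
      have := rsmooth_is_derive j X t su => ?.
      have := rsmooth_is_derive j Y t su => ?.
      apply: is_derive_eq; rewrite /GRing.scale/=; ring.
    - rewrite mul0r addr0; apply: is_derive_penalty; exact: rpartial2_is_derive.
  have := sum_second_derivatives dj.
  exact: barrier_contra e0 (uN X) (uN Y).
have slope (t : R) : 0 < t -> t < 1 ->
    u (x + t *: unit_vec i) - u (x + (- t) *: unit_vec i) <= 2 * M * t + N * (t * (1 - t)).
  move=> t0 t1; apply/ler_addgt0Pr => e' e'0.
  pose c : R := (n%:R + 1) * (t * (1 - t)) + t ^+ 2.
  have c0 : 0 < c.
    have t2 : 0 <= 1 - t by rewrite subr_ge0 ltW.
    by rewrite ltr_wpDl ?exprn_gt0// !mulr_ge0 ?(ltW t0)// addr_ge0.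
  pose y := t *: unit_vec i.
  have yi : y 0 i = t by rewrite !mxE !eqxx mulr1.
  have := @barrier (e' / c) (divr_gt0 e'0 c0) y; rewrite yi => /(_ (ltW t0) (ltW t1)).
  have -> : sqnorm y = t ^+ 2.
    rewrite -[y]add0r sqnorm_line mxE mulr0 mul0r add0r /sqnorm.
    by rewrite big1 ?add0r// => j _; rewrite mxE expr0n.
  rewrite /b /refl yi -addrA -scaleNr -scalerDl (_ : t - 2 * t = - t); last by ring.
  rewrite {1}/y => /le_trans; apply; rewrite /w.
  have -> : e' = e' / c * c by rewrite mulfVK// gt_eqF.
  set k := e' / c; have -> : k * c / c = k by rewrite mulfK// gt_eqF.
  rewrite /c; lra.
have dx := rsmooth_is_derive i x 0 su; rewrite scale0r addr0 in dx.
have := rsmooth_is_deriveN i x 0 su; rewrite oppr0 scale0r addr0 => ?.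
have dF : is_derive (0 : R) 1 (fun t : R => u (x + t *: unit_vec i) -
    u (x + (- t) *: unit_vec i)) (2 * rpartial i u x).
  by apply: is_derive_eq; rewrite /GRing.scale/=; ring.
have : 2 * rpartial i u x <= 2 * M + N.
  apply: derive_le_slope dF _ => t t0 t1; rewrite oppr0 subrr add0r.
  apply: le_trans (slope t t0 t1) _.
  have : 0 <= N * (t * t) by rewrite !mulr_ge0// ltW.
  by lra.
by lra.
Qed.

Lemma lap_bound u (K M : R) : rsmooth u -> (forall x, `|u x| <= M) ->
  (forall x, `|rlap u x| <= K) -> forall x, `|u x| <= K.
Proof.
move=> su uM uK x; rewrite ler_norml lerNl; apply/andP; split.
  apply: (@max_principle (- u) K M (rsmoothN su)) => y.
    by apply: le_trans (uM y); rewrite -normrN ler_norm.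
  rewrite /one_minus_laplacian.
  under eq_bigr => i _ do rewrite rpartial2N//.
  rewrite sumrN -opprD; apply: le_trans (uK y); rewrite -normrN.
  exact: ler_norm.
apply: (@max_principle u K M su) => y; first by apply: le_trans (uM y); exact: ler_norm.
by apply: le_trans (uK y); exact: ler_norm.
Qed.

(** The Laplacian of u is u - (1 - Laplacian) u, hence bounded by 2 K. *)
Lemma gradient_lap_bound u (K M : R) i : rsmooth u -> (forall x, `|u x| <= M) ->
  (forall x, `|rlap u x| <= K) -> forall x, `|rpartial i u x| <= 2 * K.
Proof.
move=> su uM uK x; have uK0 := lap_bound su uM uK.
have N y : `|\sum_j rpartial j (rpartial j u) y| <= 2 * K.
  have -> : \sum_j rpartial j (rpartial j u) y = u y - rlap u y.
    by rewrite rlapE; ring.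
  by apply: le_trans (ler_normB _ _) _; have := uK0 y; have := uK y; lra.
rewrite ler_norml lerNl; apply/andP; split.
  have := @gradient_upper_bound (- u) K (2 * K) i (rsmoothN su) _ _ x.
  rewrite rpartialN// => H; apply: le_trans (H _ _) _; last by lra.
    by move=> y; rewrite normrN.
  move=> y; under eq_bigr => j _ do rewrite rpartial2N//.
  by rewrite sumrN normrN; exact: N.
apply: le_trans (gradient_upper_bound i su uK0 N x) _; lra.
Qed.

End real_calculus.

(** * Integration over R^n *)

Section measurability.
Variables (R : realType) (n : nat).
Local Notation Rn := 'rV[R]_n.

(** A countable base of boxes, so that preimages of open sets under coordinatewise
    measurable maps are countable unions of measurable sets. *)
Definition rat_box (p : {ffun 'I_n -> rat} * nat) : set Rn :=
  [set y | forall i, `|y 0 i - ratr (p.1 i)| < p.2.+1%:R^-1].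

Lemma rat_box_in_open (U : set Rn) x : open U -> U x ->
  exists2 p, rat_box p x & rat_box p `<=` U.
Proof.
rewrite openE => oU /oU /nbhs_normP [d /= d0 dU].
pose k := Num.trunc (2 / d); pose e : R := k.+1%:R^-1.
have e0 : 0 < e by rewrite invr_gt0.
have ed : e + e < d.
  have : 2 / d < k.+1%:R by apply: truncnS_gt.
  rewrite ltr_pdivrMr// => h.
  by rewrite -mulr2n -mulr_natl ltr_pdivrMr// mulrC.
have Q i : exists q : rat, `|x 0 i - ratr q| < e.
  have [|q] := @rat_in_itvoo R (x 0 i - e) (x 0 i + e); first by lra.
  rewrite in_itv/= => /andP[h1 h2]; exists q; rewrite ltr_norml; lra.
have [q qE] := choice Q.
exists ([ffun i => q i], k) => [i|y yb]; first by rewrite /= ffunE.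
apply: dU => /=; apply: le_lt_trans ed; rewrite [`|_|]mx_normrE.
apply/bigmax_leP; split=> [|[a i] _ /=]; first by rewrite addr_ge0// ltW.
rewrite (ord1 a) !mxE.
have := yb i; have := qE i; rewrite /= ffunE => h1 h2.
rewrite (_ : _ - _ = (x 0 i - ratr (q i)) - (y 0 i - ratr (q i))); last by ring.
by apply: le_trans (ler_normB _ _) _; rewrite ltW// ltrD.
Qed.

Lemma measurable_fun_continuous_row d (T : measurableType d) (h : T -> Rn)
    (g : Rn -> R) : (forall i, measurable_fun setT (fun t => h t 0 i)) ->
  continuous g -> measurable_fun setT (fun t => g (h t)).
Proof.
move=> mh cg; apply: (measurability _ (RGenInftyO.measurableE R)).
move=> _ [_ [a ->] <-]; rewrite setTI.
rewrite (_ : _ @^-1` _ = h @^-1` [set y | g y < a]); last first.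
  by apply/seteqP; split => t /=; rewrite in_itv.
have oU : open [set y : Rn | g y < a].
  rewrite (_ : [set y | g y < a] = g @^-1` [set r | r < a])//.
  by apply: open_comp => // x _; exact: cg.
pose B p : set Rn := if `[< rat_box p `<=` [set y | g y < a] >] then rat_box p else set0.
rewrite (_ : [set y | g y < a] = \bigcup_p B p); last first.
  apply/seteqP; split => [x Ux|x [p _]].
    have [p px pU] := rat_box_in_open oU Ux.
    by exists p => //; rewrite /B; case: asboolP.
  by rewrite /B; case: asboolP => // pU; exact: pU.
rewrite preimage_bigcup; apply: countable_bigcupT_measurable.
  exact: countableP.
move=> p; rewrite /B; case: asboolP => _; last by rewrite preimage_set0.
rewrite (_ : _ @^-1` _ = \bigcap_(i : 'I_n)
    ((fun t => h t 0 i - ratr (p.1 i)) @^-1` [set r | `|r| < p.2.+1%:R^-1])); last first.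
  by apply/seteqP; split => [t H i _|t H i]; [exact: H|exact: (H i I)].
apply: fin_bigcap_measurable => // i _.
rewrite -[X in measurable X]setTI; apply: measurable_funB (mh i) _ _ _ _ => //.
rewrite (_ : [set r | _] = `](- p.2.+1%:R^-1), p.2.+1%:R^-1[%classic).
  exact: measurable_itv.
by apply/seteqP; split => r /=; rewrite in_itv/= ltr_norml.
Qed.

End measurability.

Section lebesgue_tonelli.
Variable R : realType.
Local Notation RM := (measurableTypeR R).

Lemma integral_lebesgueS n (F : n.+1.-tuple RM -> \bar R) :
  measurable_fun setT F -> (forall t, 0 <= F t)%E ->
  (\int[lebesgue R n.+1]_t F t =
   \int[@lebesgue_measure R]_s \int[lebesgue R n]_t F (cons_pair (s, t)))%E.
Proof.
move=> mF F0; transitivity (\int[pushforward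
    ((@lebesgue_measure R) \x lebesgue R n)%E (@cons_pair R n)]_t F t)%E => //.
rewrite ge0_integral_pushforward//; last exact: measurable_cons_pair.
rewrite (_ : _ @^-1` _ = setT)// fubini_tonelli1//.
  exact: (measurableT_comp mF (@measurable_cons_pair R n)).
by move=> x; exact: F0.
Qed.

Lemma measurable_integral_lebesgueS n (F : n.+1.-tuple RM -> \bar R) :
  measurable_fun setT F -> (forall t, 0 <= F t)%E ->
  measurable_fun setT
    (fun s : RM => \int[lebesgue R n]_t F (cons_pair (s, t)))%E.
Proof.
move=> mF F0.
apply: (@measurable_fun_fubini_tonelli_F _ _ _ _ _ (lebesgue R n)
  (F \o @cons_pair R n)) => [|x]; last exact: F0.
exact: (measurableT_comp mF (@measurable_cons_pair R n)).
Qed.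

Lemma lebesgue_measure_shift (c : R) (A : set RM) : measurable A ->
  pushforward (@lebesgue_measure R) (fun s : RM => c + s : RM) A = lebesgue_measure A.
Proof.
have mc : measurable_fun setT (fun s : RM => c + s : RM).
  by apply: measurable_funD.
move=> mA; apply/esym.
apply: (@lebesgue_measure_unique _
  (measure_function_pushforward__canonical__measure_function_Measure
    (@lebesgue_measure R) mc)) => //.
move=> _ [[a b]] _ <-; rewrite /= /pushforward.
rewrite (_ : _ @^-1` _ = `]a - c, b - c]%classic); last first.
  by apply/seteqP; split => s /=; rewrite !in_itv/= ltrBlDl lerBrDl.
rewrite !lebesgue_measure_itv/= !lte_fin ltrD2r; case: ifP => // _.
by congr (_%:E); ring.
Qed.

Lemma ge0_integral_shift (c : R) (f : RM -> \bar R) : measurable_fun setT f ->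
  (forall s, 0 <= f s)%E ->
  (\int[@lebesgue_measure R]_s f (c + s)%R = \int[@lebesgue_measure R]_s f s)%E.
Proof.
move=> mf f0; have mc : measurable_fun setT (fun s : RM => c + s : RM).
  by apply: measurable_funD.
rewrite -[LHS](@ge0_integral_pushforward _ _ _ _ _ _ mc _ setT f)//.
by apply: eq_measure_integral => A mA _; exact: lebesgue_measure_shift.
Qed.

Definition shift_tuple n (c t : n.-tuple RM) : n.-tuple RM :=
  [tuple (tnth c i + tnth t i : RM) | i < n].

Lemma measurable_shift_tuple n (c : n.-tuple RM) :
  measurable_fun setT (shift_tuple c).
Proof.
apply/measurable_fun_tnthP => i.
rewrite (_ : _ \o _ = fun t => tnth c i + tnth t i); last first.
  by apply/funext => t /=; rewrite tnth_mktuple.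
by apply: measurable_funD => //; exact: measurable_tnth.
Qed.

Lemma shift_cons n (c : n.+1.-tuple RM) (s : RM) (t : n.-tuple RM) :
  shift_tuple c (cons_pair (s, t)) =
  cons_pair (thead c + s : RM, shift_tuple [tuple of behead c] t).
Proof.
apply: eq_from_tnth => i; rewrite tnth_mktuple.
case: (unliftP ord0 i) => [j|] ->; last by rewrite !tnth0.
rewrite !tnthS /= tnth_mktuple; congr (_ + _).
by rewrite (tuple_eta c) tnthS; congr tnth; exact: val_inj.
Qed.

(** Translation invariance of the iterated Lebesgue measure, one coordinate at a
    time by Tonelli. *)
Lemma ge0_integral_shift_tuple n (c : n.-tuple RM) (F : n.-tuple RM -> \bar R) :
  measurable_fun setT F -> (forall t, 0 <= F t)%E ->
  (\int[lebesgue R n]_t F (shift_tuple c t) = \int[lebesgue R n]_t F t)%E.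
Proof.
elim: n c F => [|n IH] c F mF F0.
  by apply: eq_integral => t _; rewrite (tuple0 t) (tuple0 (shift_tuple _ _)).
rewrite [RHS]integral_lebesgueS// integral_lebesgueS//; last first.
  exact: measurableT_comp mF (measurable_shift_tuple c).
have mFs (s : RM) : measurable_fun setT (fun t : n.-tuple RM => F (cons_pair (s, t))).
  apply: (measurableT_comp mF); apply: (measurableT_comp (@measurable_cons_pair R n)).
  exact: measurable_pair1.
under eq_integral => s _.
  under eq_integral do rewrite shift_cons.
  rewrite (IH _ (fun t => F (cons_pair (thead c + s : RM, t))))//.
  over.
rewrite (@ge0_integral_shift _ (fun s => \int[lebesgue R n]_t F (cons_pair (s, t)))%E)//.
  exact: measurable_integral_lebesgueS.
by move=> s; exact: integral_ge0.
Qed.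

End lebesgue_tonelli.

(** * The half-line kernel and the inverse of (1 - d/ds)^2 *)

Section kernel.
Variable R : realType.
Implicit Types s t : R.

(** The one-dimensional kernel s e^{-s} on the half-line, the fundamental
    solution of the transpose of (1 - d/ds)^2. *)
Definition ker1 s : R := Num.max s 0 * expR (- s).

Lemma ker1_ge0 s : 0 <= ker1 s.
Proof. by rewrite mulr_ge0 ?expR_ge0// le_max lexx orbT. Qed.

Lemma ker1_lt0 s : s < 0 -> ker1 s = 0.
Proof. by move=> s0; rewrite /ker1 max_r ?mul0r// ltW. Qed.

Lemma ker1_pos s : 0 <= s -> ker1 s = s * expR (- s).
Proof. by move=> s0; rewrite /ker1 max_l. Qed.

Lemma expR_ge1D (s : R) : 1 + s <= expR s.
Proof. exact: expR_ge1Dx. Qed.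

Lemma ker1_le1 s : ker1 s <= 1.
Proof.
have [s0|s0] := leP 0 s; last by rewrite ker1_lt0.
rewrite ker1_pos// expRN ler_pdivrMr ?expR_gt0// mul1r.
by apply: le_trans (expR_ge1D s); lra.
Qed.

Lemma is_derive_sexp (s : R) :
  is_derive s 1 (fun s => s * expR (- s)) ((1 - s) * expR (- s)).
Proof.
have ? := @is_derive1_comp _ expR -%R s _ _ (is_derive_expR (- s))
  (is_deriveN (is_derive_id s 1)).
by apply: is_derive_eq; rewrite /GRing.scale/=; ring.
Qed.

Lemma sexp_lipschitz s t : 0 <= s -> 0 <= t ->
  `|s * expR (- s) - t * expR (- t)| <= `|s - t|.
Proof.
wlog st : s t / t <= s.
  move=> H s0 t0; have [/H|/ltW /H] := leP t s; first exact.
  by rewrite distrC (distrC s) => ->.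
move=> s0 t0; pose g (x : R) := x * expR (- x).
have cg : {within `[t, s], continuous g}.
  apply: continuous_subspaceT => x; apply: differentiable_continuous.
  by apply/derivable1_diffP; case: (is_derive_sexp x).
have [c + E] := MVT_segment st (fun x _ => is_derive_sexp x) cg.
rewrite in_itv/= => /andP[tc cs]; have c0 : 0 <= c by exact: le_trans tc.
rewrite -/(g s) -/(g t) E normrM ler_piMl// normrM (ger0_norm (expR_ge0 _)).
rewrite expRN ler_pdivrMr ?expR_gt0// mul1r.
by apply: le_trans (expR_ge1D c); rewrite ler_norml; lra.
Qed.

Lemma ker1_lipschitz s t : `|ker1 s - ker1 t| <= `|s - t|.
Proof.
have E x : ker1 x = Num.max x 0 * expR (- Num.max x 0).
  have [x0|x0] := leP 0 x; first by rewrite /ker1 max_l.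
  by rewrite ker1_lt0// mul0r.
rewrite !E; apply: le_trans (sexp_lipschitz _ _) _; rewrite ?le_max ?lexx ?orbT//.
have [s0|s0] := leP s 0; have [t0|t0] := leP t 0;
  rewrite ?subrr ?normr0// ?sub0r ?subr0 ?normrN.
- by rewrite gtr0_norm// ler0_norm; lra.
- by rewrite gtr0_norm// ger0_norm; lra.
Qed.

Lemma ker1_continuous : continuous ker1.
Proof.
move=> s; apply/cvgrPdist_lt => e e0; near=> t.
apply: le_lt_trans (ker1_lipschitz _ _) _.
by near: t; apply: cvgr_dist_lt.
Unshelve. all: by end_near. Qed.

Lemma sexp_decay s : 0 <= s -> (1 + s) * expR (- s) <= 4 / (1 + s).
Proof.
move=> s0; have s1 : 0 < 1 + s by rewrite ltr_pwDl.
rewrite expRN ler_pdivlMr// mulrAC ler_pdivrMr ?expR_gt0//.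
have -> : expR s = expR (s / 2) ^+ 2 by rewrite -expRM_natl mulrC -mulrA mulVf ?mulr1.
have : 1 + s / 2 <= expR (s / 2) by exact: expR_ge1D.
move: (expR (s / 2)) => r rs; have : (1 + s / 2) ^+ 2 <= r ^+ 2.
  by rewrite ler_sqr ?nnegrE; lra.
by rewrite !expr2; nra.
Qed.

(** The function - e^{-s} (p + s (p - p')) is an antiderivative of the integrand
    and tends to 0 at infinity. The sign condition allows the improper integral
    of a nonnegative function to be used. *)
Lemma ker1_integral (p p1 p2 : R -> R) (M : R) :
  (forall s, is_derive s 1 p (p1 s)) -> (forall s, is_derive s 1 p1 (p2 s)) ->
  continuous p2 -> (forall s, `|p s| <= M) -> (forall s, `|p1 s| <= M) ->
  (forall s, 0 <= p s - 2 * p1 s + p2 s) ->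
  (\int[@lebesgue_measure R]_s (ker1 s * (p s - 2 * p1 s + p2 s))%:E = (p 0)%:E)%E.
Proof.
move=> dp dp1 cp2 pM p1M g0.
pose g s := p s - 2 * p1 s + p2 s.
pose F s := - (expR (- s) * (p s + s * (p s - p1 s))).
have cont (h h1 : R -> R) : (forall s, is_derive s 1 h (h1 s)) -> continuous h.
  move=> dh s; apply: differentiable_continuous.
  by apply/derivable1_diffP; case: (dh s).
have cg : continuous g.
  apply: fun_continuousD => //; apply: fun_continuousB; first exact: cont dp.
  by apply: fun_continuousM; [exact: fun_continuous_cst|exact: cont dp1].
have dF (s : R) : is_derive s 1 F (s * expR (- s) * g s).
  have ? := @is_derive1_comp _ expR -%R s _ _ (is_derive_expR (- s))
    (is_deriveN (is_derive_id s 1)).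
  have ? := dp s; have ? := dp1 s.
  by rewrite /F /g; apply: is_derive_eq; rewrite /GRing.scale/=; ring.
have M0 : 0 <= M by exact: le_trans (pM 0).
have Fy : F x @[x --> +oo] --> (0 : R).
  apply/cvgrPdist_lt => e e0; near=> s.
  have s0 : 0 < s by near: s; exact: nbhs_pinfty_gt.
  have s1 : 0 < 1 + s by rewrite ltr_pwDl// ltW.
  rewrite sub0r normrN /F normrN normrM (gtr0_norm (expR_gt0 _)).
  apply: (@le_lt_trans _ _ (expR (- s) * (2 * M * (1 + s)))).
    rewrite ler_wpM2l ?expR_ge0//; apply: le_trans (ler_normD _ _) _.
    rewrite normrM (gtr0_norm s0).
    have : `|p s - p1 s| <= 2 * M.
      by apply: le_trans (ler_normB _ _) _; have := pM s; have := p1M s; lra.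
    have := pM s => h1 h2.
    have : s * `|p s - p1 s| <= s * (2 * M) by rewrite ler_pM2l.
    by nra.
  rewrite mulrC -!mulrA.
  rewrite mulrA; apply: le_lt_trans (ler_wpM2l (mulr_ge0 (ler0n _ 2) M0) (sexp_decay (ltW s0))) _.
  rewrite mulrA ltr_pdivrMr//.
  have : (2 * M * 4) / e < s.
    by near: s; apply: nbhs_pinfty_gt; exact: num_real.
  by rewrite ltr_pdivrMr// => /lt_trans; apply; rewrite mulrC ltr_pM2l// ltrDr.
have F0 : F 0 = - p 0 by rewrite /F oppr0 expR0 mul1r mul0r addr0.
have := @ge0_continuous_FTC2y R (fun s => s * expR (- s) * g s) F 0 0.
rewrite F0 -EFinB sub0r opprK => <-; last 6 first.
- by move=> x x0; rewrite !mulr_ge0 ?expR_ge0//; exact: g0.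
- apply: continuous_subspaceT => s; apply: fun_continuousM => //.
  by apply: cont => t; exact: is_derive_sexp.
- exact: Fy.
- by move=> x _; case: (dF x).
- rewrite -F0; apply: cvg_at_right_filter; exact: (cont _ _ dF).
- by move=> x _; rewrite derive1E; case: (dF x).
rewrite [RHS]integral_mkcond; apply: eq_integral => s _; rewrite /patch.
have [s0|s0] := leP 0 (s : R); first by rewrite mem_set ?ker1_pos//= in_itv/= s0.
rewrite memNset ?ker1_lt0 ?mul0r//= in_itv/= andbT.
by apply/negP; rewrite -ltNge.
Unshelve. all: by end_near. Qed.

End kernel.

(** * Functions with bounded derivatives and the product kernel *)

Section bounded_derivatives.
Variables (R : realType) (n : nat).
Local Notation Rn := 'rV[R]_n.
Implicit Types (u w : Rn -> R).

(** The real counterpart of the space of smooth functions with bounded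
    derivatives. *)
Variant bounded_derivs u : Prop := BoundedDerivs of rsmooth u &
  forall s, exists M : R, forall x, `|iter_deriv (@rpartial R n) s u x| <= M.

Lemma bounded_derivs_smooth u : bounded_derivs u -> rsmooth u.
Proof. by case. Qed.

Lemma bounded_derivsP u s : bounded_derivs u ->
  exists2 M : R, 0 <= M & forall x, `|iter_deriv (@rpartial R n) s u x| <= M.
Proof.
by case=> _ /(_ s) [M uM]; exists M => //; apply: le_trans (uM 0).
Qed.

Lemma bounded_derivs_iter u s : bounded_derivs u ->
  bounded_derivs (iter_deriv (@rpartial R n) s u).
Proof.
move=> bu; split; first exact/rsmooth_iter/bounded_derivs_smooth.
move=> t; have [M _ uM] := bounded_derivsP (t ++ s) bu.
by exists M; rewrite -iter_deriv_cat.
Qed.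

Lemma bounded_derivs_partial u i : bounded_derivs u ->
  bounded_derivs (rpartial i u).
Proof. exact: (@bounded_derivs_iter u [:: i]). Qed.

Lemma bounded_derivs_lin (a : R) u w : bounded_derivs u -> bounded_derivs w ->
  bounded_derivs (a *: u + w).
Proof.
move=> bu bw; have su := bounded_derivs_smooth bu.
have sw := bounded_derivs_smooth bw; split; first exact: rsmooth_lin.
move=> s; have [M _ uM] := bounded_derivsP s bu.
have [N _ wN] := bounded_derivsP s bw.
exists (`|a| * M + N) => x; rewrite iter_rpartial_lin//.
apply: le_trans (ler_normD _ _) _; apply: lerD => //.
by rewrite [X in `|X|]/(a * _) normrM ler_wpM2l.
Qed.

Lemma bounded_derivs_cst (c : R) : bounded_derivs (cst c).
Proof.
split; first exact: rsmooth_cst.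
by move=> s; exists `|if s is [::] then c else 0| => x; rewrite iter_rpartial_cst.
Qed.

Lemma bounded_derivsD u w : bounded_derivs u -> bounded_derivs w ->
  bounded_derivs (u + w).
Proof. by move=> bu bw; rewrite -[u]scale1r; exact: bounded_derivs_lin. Qed.

Lemma bounded_derivsZ (a : R) u : bounded_derivs u -> bounded_derivs (a *: u).
Proof.
move=> bu; rewrite -[_ *: _]addr0; apply: bounded_derivs_lin => //.
exact: (bounded_derivs_cst 0).
Qed.

Lemma bounded_derivs_lap u : bounded_derivs u ->
  bounded_derivs (one_minus_laplacian (@rpartial R n) u).
Proof.
move=> bu; apply: bounded_derivsD => //; rewrite -scaleN1r.
apply: bounded_derivsZ; elim: (index_enum _) => [|i r IH].
  by rewrite big_nil; exact: (bounded_derivs_cst 0).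
by rewrite big_cons; apply: bounded_derivsD => //; do 2 apply: bounded_derivs_partial.
Qed.

Lemma bounded_derivs_iter_lap m u : bounded_derivs u ->
  bounded_derivs (iter m (one_minus_laplacian (@rpartial R n)) u).
Proof. by move=> bu; elim: m => // m IH; rewrite iterS; exact: bounded_derivs_lap. Qed.

Local Notation rlap := (one_minus_laplacian (@rpartial R n)).

(** Each derivative costs one factor 1 - Laplacian and a factor 2. *)
Lemma iter_deriv_lap_bound u s (K : R) : bounded_derivs u ->
  (forall x, `|iter (size s) rlap u x| <= K) ->
  forall x, `|iter_deriv (@rpartial R n) s u x| <= 2 ^+ size s * K.
Proof.
elim: s u K => [|i s IH] u K bu uK x.
  by rewrite expr0 mul1r; exact: uK.
have bs := bounded_derivs_iter s bu; have su := bounded_derivs_smooth bu.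
have [M _ sM] := bounded_derivsP [::] bs.
rewrite [size _]/= exprS -mulrA.
apply: (gradient_lap_bound i (bounded_derivs_smooth bs) sM) => {}x.
rewrite -iter_rpartial_lap//; apply: IH; first exact: bounded_derivs_lap.
by move=> y; rewrite -iterSr.
Qed.

(** The maximum principle makes the norms of (1 - Laplacian)^m u increase with m. *)
Lemma iter_lap_mono u k m (K : R) : bounded_derivs u -> (k <= m)%N ->
  (forall x, `|iter m rlap u x| <= K) -> forall x, `|iter k rlap u x| <= K.
Proof.
move=> bu km uK; rewrite -(subnK km) in uK; elim: (m - k)%N uK => // d IH uK.
apply: IH; have bd := bounded_derivs_iter_lap (d + k) bu.
have [M _ dM] := bounded_derivsP [::] bd.
exact: lap_bound (bounded_derivs_smooth bd) dM uK.
Qed.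

(** The operator (1 - d_i)^2, inverse to averaging along e_i with ker1. *)
Definition sqop i u := u - 2 *: rpartial i u + rpartial i (rpartial i u).

Lemma sqopE i u : sqop i u = (-2) *: rpartial i u + (rpartial i (rpartial i u) + u).
Proof. by rewrite /sqop scaleNr addrC (addrC u) addrCA. Qed.

Lemma bounded_derivs_sqop i u : bounded_derivs u -> bounded_derivs (sqop i u).
Proof.
move=> bu; rewrite sqopE; apply: bounded_derivs_lin; first exact: bounded_derivs_partial.
by apply: bounded_derivsD => //; do 2 apply: bounded_derivs_partial.
Qed.

(** The product of the operators (1 - d_i)^2 over the directions c k. The
    directions are a parameter so that the product over all coordinates can be
    reached by induction on the number m of factors. *)
Fixpoint tensor_op m : ('I_m -> 'I_n) -> (Rn -> R) -> (Rn -> R) :=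
  match m with
  | 0 => fun _ u => u
  | k.+1 => fun c u => tensor_op (fun i => c (lift ord0 i)) (sqop (c ord0) u)
  end.

Lemma bounded_derivs_tensor m (c : 'I_m -> 'I_n) u : bounded_derivs u ->
  bounded_derivs (tensor_op c u).
Proof. by elim: m c u => // m IH c u bu /=; apply: IH; exact: bounded_derivs_sqop. Qed.

Lemma sqop_lap i u m : rsmooth u -> iter m rlap (sqop i u) = sqop i (iter m rlap u).
Proof.
move=> su; have s1 := rsmooth_partial i su; have s2 := rsmooth_partial i s1.
rewrite !sqopE iter_lap_lin//; last exact: rsmoothD.
rewrite -[rpartial i (rpartial i u)]scale1r iter_lap_lin// !scale1r.
rewrite -(iter_rpartial_iter_lap m [:: i])//.
by rewrite -(iter_rpartial_iter_lap m [:: i; i]).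
Qed.

Lemma sqop_bound i u (K : R) : bounded_derivs u ->
  (forall x, `|iter 2 rlap u x| <= K) -> forall x, `|sqop i u x| <= 9 * K.
Proof.
move=> bu uK x; have K0 : 0 <= K by exact: le_trans (uK 0).
have h0 := iter_lap_mono bu (isT : (0 <= 2)%N) uK x.
have h1 := iter_deriv_lap_bound (s := [:: i]) bu
  (iter_lap_mono bu (isT : (1 <= 2)%N) uK) x.
have h2 := iter_deriv_lap_bound (s := [:: i; i]) bu uK x.
have -> : sqop i u x = u x - 2 * rpartial i u x + rpartial i (rpartial i u) x by [].
have := ler_normD (u x - 2 * rpartial i u x) (rpartial i (rpartial i u) x).
have := ler_normB (u x) (2 * rpartial i u x); rewrite normrM normr_nat.
move: h0 h1 h2; rewrite /iter_deriv/= expr1 expr2; lra.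
Qed.

(** Since 1 - 2 d_i + d_i^2 is bounded by 1 + 4 + 4 in terms of
    (1 - Laplacian)^2. *)
Lemma tensor_op_bound m (c : 'I_m -> 'I_n) u (K : R) : bounded_derivs u ->
  (forall x, `|iter (2 * m)%N rlap u x| <= K) ->
  forall x, `|tensor_op c u x| <= 9 ^+ m * K.
Proof.
elim: m c u K => [|m IH] c u K bu uK x; first by rewrite mul1r; exact: uK.
rewrite exprSr -mulrA /=; apply: IH; first exact: bounded_derivs_sqop.
move=> y; rewrite sqop_lap; last exact: bounded_derivs_smooth.
apply: sqop_bound; first exact: bounded_derivs_iter_lap.
by move=> z; rewrite -iterD -mulnS.
Qed.

Lemma rsmooth_line_continuous u i x : rsmooth u ->
  continuous (fun s : R => u (x + s *: unit_vec R i)).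
Proof.
move=> su s; apply: differentiable_continuous; apply/derivable1_diffP.
by case: (rsmooth_is_derive i x s su).
Qed.

Lemma sqop_ker1 i u x : bounded_derivs u -> (forall y, 0 <= sqop i u y) ->
  (\int[@lebesgue_measure R]_s (ker1 s * sqop i u (x + s *: unit_vec R i))%:E
   = (u x)%:E)%E.
Proof.
move=> bu u0; have su := bounded_derivs_smooth bu.
have [M M0 uM] := bounded_derivsP [::] bu.
have [N N0 uN] := bounded_derivsP [:: i] bu.
rewrite -[in RHS](addr0 x) -[in RHS](scale0r (unit_vec R i)).
apply: (@ker1_integral R (fun s => u (x + s *: unit_vec R i))
  (fun s => rpartial i u (x + s *: unit_vec R i))
  (fun s => rpartial i (rpartial i u) (x + s *: unit_vec R i)) (M + N)).
- by move=> s; exact: rsmooth_is_derive.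
- by move=> s; apply: rsmooth_is_derive; exact: rsmooth_partial.
- by apply: rsmooth_line_continuous; do 2 apply: rsmooth_partial.
- by move=> s; apply: le_trans (uM _) _; rewrite lerDl.
- by move=> s; apply: le_trans (uN _) _; rewrite lerDr.
- by move=> s; exact: u0.
Qed.

Local Notation RM := (measurableTypeR R).

Definition walk m (c : 'I_m -> 'I_n) (x : Rn) (t : m.-tuple RM) : Rn :=
  x + \sum_(k < m) (tnth t k : R) *: unit_vec R (c k).

Definition ker_prod m (t : m.-tuple RM) : R := \prod_(k < m) ker1 (tnth t k).

Lemma walk_cons m (c : 'I_m.+1 -> 'I_n) x (s : RM) (t : m.-tuple RM) :
  walk c x (cons_pair (s, t)) =
  walk (fun i => c (lift ord0 i)) (x + (s : R) *: unit_vec R (c ord0)) t.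
Proof.
rewrite /walk big_ord_recl tnth0/= addrA; congr (_ + _).
by apply: eq_bigr => k _; rewrite tnthS; congr (tnth _ _ *: _); exact: val_inj.
Qed.

Lemma ker_prod_cons m (s : RM) (t : m.-tuple RM) :
  ker_prod (cons_pair (s, t)) = ker1 s * ker_prod t.
Proof.
rewrite /ker_prod big_ord_recl tnth0/=; congr (_ * _).
by apply: eq_bigr => k _; rewrite tnthS; congr (ker1 (tnth _ _)); exact: val_inj.
Qed.

Lemma ker_prod_ge0 m (t : m.-tuple RM) : 0 <= ker_prod t.
Proof. by apply: prodr_ge0 => k _; exact: ker1_ge0. Qed.

Lemma measurable_ker_prod m : measurable_fun setT (@ker_prod m).
Proof.
apply: (@measurable_prod _ _ _ _ _ _ (fun k (t : m.-tuple RM) => ker1 (tnth t k))).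
move=> k _; apply: (measurableT_comp _ (@measurable_tnth _ _ m k)).
exact: continuous_measurable_fun (@ker1_continuous R).
Qed.

Lemma measurable_walk m (c : 'I_m -> 'I_n) x (g : Rn -> R) : continuous g ->
  measurable_fun setT (fun t : m.-tuple RM => g (walk c x t)).
Proof.
move=> cg; apply: measurable_fun_continuous_row => // i.
rewrite (_ : (fun t => _) = fun t : m.-tuple RM =>
    x 0 i + \sum_(k < m) tnth t k * unit_vec R (c k) 0 i); last first.
  apply/funext => t; rewrite /walk mxE summxE; congr (_ + _).
  by apply: eq_bigr => k _; rewrite mxE.
apply: measurable_funD => //; apply: measurable_sum => k.
by apply: measurable_funM => //; exact: measurable_tnth.
Qed.

(** One application of ker1_integral per coordinate. Nonnegativity lets Tonelli
    apply. *)
Lemma ker_prod_inverse m (c : 'I_m -> 'I_n) u x : bounded_derivs u ->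
  (forall y, 0 <= tensor_op c u y) ->
  (\int[lebesgue R m]_t (ker_prod t * tensor_op c u (walk c x t))%:E = (u x)%:E)%E.
Proof.
elim: m c u x => [|m IH] c u x bu u0.
  have E t : (ker_prod t * tensor_op c u (walk c x t))%:E = (u x)%:E.
    by rewrite /ker_prod big_ord0 mul1r /walk big_ord0 addr0.
  rewrite (eq_integral (cst (u x)%:E)) => [|t _]; last exact: E.
  by rewrite [LHS]integral_cst//= diracE mem_set ?mule1.
have bs := bounded_derivs_sqop (c ord0) bu.
have bt := bounded_derivs_tensor c bu.
have ct := rsmooth_continuous (bounded_derivs_smooth bt).
rewrite integral_lebesgueS; last 2 first.
- apply/measurable_EFinP; apply: measurable_funM; first exact: measurable_ker_prod.
  exact: measurable_walk.
- by move=> t; rewrite lee_fin mulr_ge0// ker_prod_ge0.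
pose c' i := c (lift ord0 i).
have E y : (\int[lebesgue R m]_t
    (ker_prod t * tensor_op c' (sqop (c ord0) u) (walk c' y t))%:E =
    (sqop (c ord0) u y)%:E)%E by exact: IH.
have s0 y : 0 <= sqop (c ord0) u y.
  rewrite -lee_fin -E; apply: integral_ge0 => t _.
  by rewrite lee_fin mulr_ge0// ?ker_prod_ge0//; exact: u0.
rewrite -(sqop_ker1 x bu s0); apply: eq_integral => s _.
rewrite EFinM -E -ge0_integralZl_EFin ?ker1_ge0//; first last.
- apply/measurable_EFinP; apply: measurable_funM; first exact: measurable_ker_prod.
  exact: (measurable_walk c' _ ct).
- by move=> t _; rewrite lee_fin mulr_ge0// ?ker_prod_ge0//; exact: u0.
apply: eq_integral => t _.
by rewrite ker_prod_cons walk_cons -EFinM mulrA.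
Qed.

End bounded_derivatives.

Local Opaque rpartial unit_vec.

(** * Convolution with the product kernel *)

Section quadratic_error.
Variables (R : realType) (V : normedModType R).

(** A quadratic error is what second-order bounds give, and such bounds survive
    both averaging and pointwise limits; this is how derivatives are taken under
    conv and of limits of sequences. *)
Lemma is_derive_quadratic (u : V -> R) x v (d M : R) :
  (forall h : R, `|u (x + h *: v) - u x - h * d| <= M * h ^+ 2) ->
  is_derive x v u d.
Proof.
move=> H; have M0 : 0 <= M.
  by have := H 1; rewrite expr1n mulr1; apply: le_trans.
have cv : h^-1 *: ((u \o shift x) (h *: v) - u x) @[h --> 0^'] --> d.
  apply/cvgrPdist_le => e e0; near=> h.
  have h0 : h != 0 by near: h; exact: nbhs_dnbhs_neq.
  have hM : `|h| * (M + 1) <= e.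
    rewrite -ler_pdivlMr; last by rewrite ltr_wpDl.
    near: h; apply: dnbhs0_le; rewrite divr_gt0//; first by rewrite ltr_wpDl.
  rewrite /= distrC [h *: v + x]addrC /GRing.scale/=.
  rewrite (_ : _ - d = h^-1 * (u (x + h *: v) - u x - h * d)); last first.
    by rewrite [in RHS]mulrBr mulKf.
  rewrite normrM normfV mulrC ler_pdivrMr ?normr_gt0//.
  apply: le_trans (H h) _; rewrite -real_normK ?num_real// expr2.
  have := normr_ge0 h; move: hM; move: `|h| => k; nra.
split; first by apply/cvg_ex; exists d.
exact: (cvg_lim (@Rhausdorff R)) cv.
Unshelve. all: by end_near. Qed.

End quadratic_error.

Section convolution.
Variables (R : realType) (n : nat).
Local Notation Rn := 'rV[R]_n.
Local Notation RM := (measurableTypeR R).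
Local Notation mu := (lebesgue R n).
Local Notation rlap := (one_minus_laplacian (@rpartial R n)).
Implicit Types (u g : Rn -> R).

(** One mean value theorem per coordinate. *)
Lemma lipschitz_of_partials u (M : R) : rsmooth u ->
  (forall i x, `|rpartial i u x| <= M) ->
  forall x h, `|u (x + h) - u x| <= n%:R * M * `|h|.
Proof.
move=> su uM x h.
have step (r : seq 'I_n) (y : Rn) :
    `|u (y + \sum_(i <- r) h 0 i *: unit_vec R i) - u y| <= (size r)%:R * (M * `|h|).
  elim: r y => [|i r IH] y; first by rewrite big_nil addr0 subrr normr0 mul0r.
  rewrite big_cons addrA; set z := y + _.
  have [c _ E] := line_mvt y (h 0 i) (fun z => @rsmooth_derivable _ _ u i z su).
  rewrite (_ : _ - u y = (u (z + \sum_(i <- r) h 0 i *: unit_vec R i) - u z) +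
    (u z - u y)); last by ring.
  apply: le_trans (ler_normD _ _) _.
  rewrite [size _]/= -natr1 mulrDl mul1r; apply: lerD => //.
  rewrite {}/z E normrM mulrC; apply: ler_pM => //; first exact: uM.
  exact: norm_coord.
have := step (index_enum 'I_n) x.
rewrite -mulrA (_ : size _ = n); last by rewrite -[RHS]card_ord cardT enumT.
suff -> : \sum_(i < n) h 0 i *: unit_vec R i = h by [].
by rewrite [RHS]row_sum_delta.
Qed.

Lemma bounded_derivs_lipschitz u : bounded_derivs u ->
  exists2 L : R, 0 <= L & forall x y, `|u x - u y| <= L * `|x - y|.
Proof.
move=> bu; have P i : exists M : R, 0 <= M /\ forall x, `|rpartial i u x| <= M.
  by have [M M0 uM] := bounded_derivsP [:: i] bu; exists M.
have [M HM] := choice P.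
exists (n%:R * \sum_i M i) => [|x y].
  by rewrite mulr_ge0// sumr_ge0// => i _; case: (HM i).
have := @lipschitz_of_partials u (\sum_i M i) (bounded_derivs_smooth bu) _ y (x - y).
rewrite subrKC => H; apply: H => i z; apply: le_trans ((HM i).2 _) _.
by rewrite (bigD1 i)//= lerDl sumr_ge0// => j _; case: (HM j).
Qed.

Lemma prod_ker1_le1 (r : seq 'I_n) (z : Rn) : \prod_(i <- r) ker1 (z 0 i) <= 1.
Proof.
elim: r => [|i r IH]; first by rewrite big_nil.
rewrite big_cons mulr_ile1 ?ker1_ge0 ?ker1_le1//.
by apply: prodr_ge0 => j _; exact: ker1_ge0.
Qed.

Definition ker (z : Rn) : R := \prod_i ker1 (z 0 i).

Lemma ker_row (t : n.-tuple RM) : ker (row_of_tuple t) = ker_prod t.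
Proof. by apply: eq_bigr => i _; rewrite mxE. Qed.

Lemma ker_ge0 z : 0 <= ker z.
Proof. by apply: prodr_ge0 => i _; exact: ker1_ge0. Qed.

Lemma ker_le1 z : ker z <= 1.
Proof. exact: prod_ker1_le1. Qed.

Lemma ker_lipschitz z y : `|ker z - ker y| <= n%:R * `|z - y|.
Proof.
have step (r : seq 'I_n) :
    `|\prod_(i <- r) ker1 (z 0 i) - \prod_(i <- r) ker1 (y 0 i)| <= (size r)%:R * `|z - y|.
  elim: r => [|i r IH]; first by rewrite !big_nil subrr normr0 mul0r.
  rewrite !big_cons; set p := \prod_(_ <- _) _; set q := \prod_(_ <- r) ker1 (y 0 _).
  rewrite (_ : _ - _ = ker1 (z 0 i) * (p - q) + (ker1 (z 0 i) - ker1 (y 0 i)) * q);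
    last by ring.
  apply: le_trans (ler_normD _ _) _;
  rewrite [size _]/= -natr1 (mulrDl _ 1) (mul1r `|z - y|) normrM.
  rewrite (normrM (_ - _) q); apply: lerD.
    by apply: le_trans IH; rewrite ler_piMl// ger0_norm ?ker1_ge0 ?ker1_le1.
  have q1 : `|q| <= 1.
    rewrite ger0_norm; first exact: prod_ker1_le1.
    by apply: prodr_ge0 => j _; exact: ker1_ge0.
  apply: (@le_trans _ _ `|ker1 (z 0 i) - ker1 (y 0 i)|); first by rewrite ler_piMr.
  apply: le_trans (ker1_lipschitz _ _) _.
  by have := norm_coord (z - y) i; rewrite !mxE.
have := step (index_enum 'I_n).
by rewrite (_ : size _ = n)//; rewrite -[RHS]card_ord cardT enumT.
Qed.

Lemma lipschitz_fun_continuous u (L : R) :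
  (forall x y, `|u x - u y| <= L * `|x - y|) -> continuous u.
Proof.
move=> uL x P /nbhs_ballP [e /= e0 eP]; apply/(@nbhs_normP R Rn).
have L1 : 0 < `|L| + 1 by rewrite ltr_wpDl.
exists (e / (`|L| + 1)) => [|y /= xy]; first by rewrite /= divr_gt0.
apply: eP => /=; apply: le_lt_trans (uL x y) _.
apply: (@le_lt_trans _ _ ((`|L| + 1) * `|x - y|)).
  by rewrite ler_wpM2r// (le_trans (ler_norm L))// lerDl.
by rewrite mulrC -ltr_pdivlMr.
Qed.

Lemma ker_continuous : continuous ker.
Proof. exact: lipschitz_fun_continuous ker_lipschitz. Qed.

Lemma walk_id x (t : n.-tuple RM) : walk id x t = x + row_of_tuple t.
Proof.
rewrite /walk; congr (_ + _); rewrite [RHS]row_sum_delta.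
by apply: eq_bigr => i _; rewrite mxE.
Qed.

Lemma measurable_row (g : Rn -> R) : continuous g ->
  measurable_fun setT (fun t : n.-tuple RM => g (row_of_tuple t)).
Proof.
move=> cg; have := measurable_walk id 0 cg.
by under eq_fun do rewrite walk_id add0r.
Qed.

Lemma continuous_translate g x : continuous g -> continuous (fun y : Rn => g (x + y)).
Proof.
move=> cg; apply: fun_continuous_comp cg => y.
by apply: continuousD; [exact: cst_continuous|exact: cvg_id].
Qed.

Lemma sqop_cst i (c : R) : sqop i (cst c) = cst c :> (Rn -> R).
Proof.
rewrite /sqop rpartial_cst scaler0 subr0.
by rewrite (rpartial_cst 0 i : rpartial i 0 = 0) addr0.
Qed.

Lemma tensor_op_cst m (e : 'I_m -> 'I_n) (c : R) : tensor_op e (cst c) = cst c.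
Proof. by elim: m e => //= m IH e; rewrite sqop_cst. Qed.

Lemma integral_ker_prod : (\int[mu]_t (ker_prod t)%:E = 1)%E.
Proof.
have := @ker_prod_inverse R n n id (cst 1) 0 (bounded_derivs_cst n 1).
rewrite tensor_op_cst => <- //; apply: eq_integral => t _.
by rewrite /cst mulr1.
Qed.

Lemma integrable_ker_prod : mu.-integrable setT (EFin \o @ker_prod R n).
Proof.
apply/integrableP; split; first by apply/measurable_EFinP; exact: measurable_ker_prod.
under eq_integral => t _ do rewrite /= ger0_norm ?ker_prod_ge0//.
by rewrite integral_ker_prod ltry.
Qed.

Definition conv g x : R := \int[mu]_t (ker_prod t * g (x + row_of_tuple t)).

Lemma integrable_conv g x (K : R) : continuous g -> (forall y, `|g y| <= K) ->
  mu.-integrable setT (EFin \o (fun t => ker_prod t * g (x + row_of_tuple t))).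
Proof.
move=> cg gK; have := integrableZl measurableT K integrable_ker_prod.
apply: le_integrable => //.
  apply/measurable_EFinP; apply: measurable_funM; first exact: measurable_ker_prod.
  exact: (measurable_row (@continuous_translate g x cg)).
move=> t _; rewrite /= lee_fin normrM mulrC normrM ler_wpM2r//.
by apply: le_trans (gK _) _; rewrite ler_norm.
Qed.

Lemma conv_bound g (K : R) : continuous g -> (forall y, `|g y| <= K) ->
  forall x, `|conv g x| <= K.
Proof.
move=> cg gK x; have K0 : 0 <= K by exact: le_trans (gK 0).
have ig := integrable_conv x cg gK.
apply: le_trans (le_normr_Rintegral measurableT ig) _.
have -> : K = \int[mu]_t (K * ker_prod t).
  rewrite RintegralZl//; last exact: integrable_ker_prod.
  by rewrite /Rintegral integral_ker_prod mulr1.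
apply: le_Rintegral => //.
- rewrite [X in integrable _ _ X](_ : _ = (abse \o (EFin \o (fun t => ker_prod t * g (x + row_of_tuple t)))))//.
  exact: integrable_abse.
- exact: integrableZl integrable_ker_prod.
- move=> t _; rewrite normrM (ger0_norm (ker_prod_ge0 _)) mulrC.
  by rewrite ler_wpM2r// ker_prod_ge0.
Qed.

Lemma conv_lin (a : R) g u (K L : R) : continuous g -> continuous u ->
  (forall y, `|g y| <= K) -> (forall y, `|u y| <= L) ->
  conv (a *: g + u) = a *: conv g + conv u.
Proof.
move=> cg cu gK uL; apply/funext => x.
have ig := integrable_conv x cg gK; have iu := integrable_conv x cu uL.
rewrite -[RHS]/(a * conv g x + conv u x) /conv -RintegralZl// -RintegralD//; last first.
  exact: (integrableZl measurableT a ig).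
apply: eq_Rintegral => t _.
have -> : (a *: g + u) (x + row_of_tuple t) =
  a * g (x + row_of_tuple t) + u (x + row_of_tuple t) by [].
by rewrite mulrDr mulrCA.
Qed.

Lemma conv_translate g x h : conv g (x + h) = conv (fun y => g (y + h)) x.
Proof. by apply: eq_Rintegral => t _; rewrite addrAC. Qed.

Lemma sqop_lin i (a : R) u w : rsmooth u -> rsmooth w ->
  sqop i (a *: u + w) = a *: sqop i u + sqop i w.
Proof.
move=> su sw; rewrite /sqop rpartial2_lin// rpartial_lin//.
move: (rpartial i (rpartial i u)) (rpartial i (rpartial i w)) => r1 r2.
move: (rpartial i u) (rpartial i w) => p1 p2; apply/funext => x.
have H (a1 a2 a3 b1 b2 b3 : R) : a * a1 + b1 - 2 * (a * a2 + b2) + (a * a3 + b3) =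
  a * (a1 - 2 * a2 + a3) + (b1 - 2 * b2 + b3) by ring.
exact: H.
Qed.

Lemma rsmooth_sqop i u : rsmooth u -> rsmooth (sqop i u).
Proof.
move=> su; rewrite sqopE; apply: rsmooth_lin; first exact: rsmooth_partial.
by apply: rsmoothD => //; do 2 apply: rsmooth_partial.
Qed.

Lemma tensor_op_lin m (e : 'I_m -> 'I_n) (a : R) u w : rsmooth u -> rsmooth w ->
  tensor_op e (a *: u + w) = a *: tensor_op e u + tensor_op e w.
Proof.
elim: m e u w => //= m IH e u w su sw.
by rewrite sqop_lin// IH//; exact: rsmooth_sqop.
Qed.

(** Adding a constant to u makes ker_prod_inverse applicable; both sides are
    linear and preserve constants. *)
Lemma conv_inverse u : bounded_derivs u -> conv (tensor_op id u) = u.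
Proof.
move=> bu; apply/funext => x.
have bt := bounded_derivs_tensor id bu.
have [K K0 tK] := bounded_derivsP [::] bt.
have ct := rsmooth_continuous (bounded_derivs_smooth bt).
have bK : bounded_derivs (1 *: u + cst K).
  by apply: bounded_derivs_lin => //; exact: bounded_derivs_cst.
have tE y : tensor_op id (1 *: u + cst K) y = tensor_op id u y + K.
  rewrite tensor_op_lin; [|exact: bounded_derivs_smooth|exact: rsmooth_cst].
  by rewrite tensor_op_cst scale1r.
have := @ker_prod_inverse R n n id _ x bK.
have iu := integrable_conv x ct tK.
have -> : (1 *: u + cst K) x = u x + K by rewrite scale1r.
move=> H; apply: (addIr K); apply/eqP; rewrite -eqe -H => [|y]; last first.
  by rewrite tE -lerBlDr sub0r; have := tK y; rewrite ler_norml => /andP[].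
rewrite (eq_integral (fun t => ((ker_prod t * tensor_op id u (x + row_of_tuple t))%:E +
    K%:E * (ker_prod t)%:E)%E)); last first.
  by move=> t _; rewrite walk_id tE -EFinM -EFinD mulrDr (mulrC K).
rewrite integralD//; last by apply: integrableZl => //; exact: integrable_ker_prod.
rewrite integralZl//; last exact: integrable_ker_prod.
rewrite integral_ker_prod mule1 EFinD /conv /Rintegral fineK//.
exact: integrable_fin_num.
Qed.

Lemma bounded_derivs_continuous u : bounded_derivs u -> continuous u.
Proof. by move/bounded_derivs_smooth/rsmooth_continuous. Qed.

Lemma conv_lin_derivs (a : R) u w : bounded_derivs u -> bounded_derivs w ->
  conv (a *: u + w) = a *: conv u + conv w.
Proof.
move=> bu bw; have [K _ uK] := bounded_derivsP [::] bu.
have [L _ wL] := bounded_derivsP [::] bw.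
by apply: (conv_lin _ _ _ uK wL); exact: bounded_derivs_continuous.
Qed.

Lemma conv_bound_derivs u (K : R) : bounded_derivs u -> (forall y, `|u y| <= K) ->
  forall x, `|conv u x| <= K.
Proof. by move=> bu; apply: conv_bound; exact: bounded_derivs_continuous. Qed.

Lemma bounded_derivs_translate u (h : Rn) : bounded_derivs u ->
  bounded_derivs (fun y => u (y + h)).
Proof.
move=> bu; have su := bounded_derivs_smooth bu.
have E s : iter_deriv (@rpartial R n) s (fun y => u (y + h)) =
    (fun y => iter_deriv (@rpartial R n) s u (y + h)).
  elim: s => // i s IH; rewrite !iter_deriv_cons IH; apply/funext => y.
  by case: (is_derive_translate
    (@rsmooth_derivable R n _ i (y + h) (rsmooth_iter s su))).
split; [split=> s|move=> s]; rewrite E; last first.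
  by have [M _ uM] := bounded_derivsP s bu; exists M.
have ss := rsmooth_iter s su; split.
  under eq_fun do rewrite addrC; apply: continuous_translate.
  exact: rsmooth_continuous.
by move=> i y; case: (is_derive_translate
    (@rsmooth_derivable R n _ i (y + h) ss)).
Qed.

Lemma taylor_bound u i x h (M : R) : rsmooth u ->
  (forall y, `|rpartial i (rpartial i u) y| <= M) ->
  `|u (x + h *: unit_vec R i) - u x - h * rpartial i u x| <= M * h ^+ 2.
Proof.
move=> su uM; have M0 : 0 <= M by exact: le_trans (uM 0).
have [c ch ->] := line_mvt x h (fun z => @rsmooth_derivable _ _ u i z su).
have [d _ E] := line_mvt x c
  (fun z => @rsmooth_derivable _ _ _ i z (rsmooth_partial i su)).
rewrite -mulrBr E !normrM -(real_normK (num_real h)) expr2 (mulrC M) -mulrA.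
rewrite ler_wpM2l//; apply: ler_pM => //; exact: uM.
Qed.

Lemma conv_is_derive u i x : bounded_derivs u ->
  is_derive x (unit_vec R i) (conv u) (conv (rpartial i u) x).
Proof.
move=> bu; have su := bounded_derivs_smooth bu.
have b1 := bounded_derivs_partial i bu.
have [M _ uM] := bounded_derivsP [:: i; i] bu.
apply: (@is_derive_quadratic R _ _ x _ _ M) => h.
pose v : Rn := h *: unit_vec R i.
have bv := bounded_derivs_translate v bu.
have bw := bounded_derivs_lin (-1) bu bv.
have -> : conv u (x + v) - conv u x - h * conv (rpartial i u) x =
    conv ((- h) *: rpartial i u + ((-1) *: u + (fun y => u (y + v)))) x.
  rewrite !conv_lin_derivs// conv_translate.
  rewrite -[RHS]/((- h) * conv (rpartial i u) x + ((-1) * conv u x + conv _ x)).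
  by ring.
apply: conv_bound_derivs => [|y]; first exact: bounded_derivs_lin.
rewrite (_ : _ y = u (y + v) - u y - h * rpartial i u y).
  exact: taylor_bound.
rewrite -[LHS]/((- h) * rpartial i u y + ((-1) * u y + u (y + v))); ring.
Qed.

Lemma conv_rpartial u i : bounded_derivs u ->
  rpartial i (conv u) = conv (rpartial i u).
Proof. by move=> bu; apply/funext => x; case: (conv_is_derive i x bu). Qed.

Lemma conv_iter u s : bounded_derivs u ->
  iter_deriv (@rpartial R n) s (conv u) = conv (iter_deriv (@rpartial R n) s u).
Proof.
move=> bu; elim: s => // i s IH; rewrite !iter_deriv_cons IH conv_rpartial//.
exact: bounded_derivs_iter.
Qed.

Lemma conv_lipschitz u (L : R) : (forall x y, `|u x - u y| <= L * `|x - y|) ->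
  bounded_derivs u -> forall x y, `|conv u x - conv u y| <= L * `|x - y|.
Proof.
move=> uL bu x y; pose v : Rn := x - y; have bv := bounded_derivs_translate v bu.
have -> : conv u x - conv u y = conv ((-1) *: u + (fun z => u (z + v))) y.
  rewrite conv_lin_derivs// -[RHS]/((-1) * conv u y + conv _ y).
  by rewrite -conv_translate /v subrKC mulN1r addrC.
apply: conv_bound_derivs => [|z]; first exact: bounded_derivs_lin.
rewrite -[X in `|X|]/((-1) * u z + u (z + v)) mulN1r addrC.
by apply: le_trans (uL _ _) _; rewrite addrAC subrr add0r.
Qed.

Lemma bounded_derivs_conv u : bounded_derivs u -> bounded_derivs (conv u).
Proof.
move=> bu; split; first split=> s; rewrite ?conv_iter//; last first.
  move=> s; have bs := bounded_derivs_iter s bu.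
  have [K _ uK] := bounded_derivsP s bu; exists K; rewrite conv_iter//.
  exact: conv_bound_derivs.
have bs := bounded_derivs_iter s bu; split.
  have [L _ uL] := bounded_derivs_lipschitz bs.
  exact: lipschitz_fun_continuous (conv_lipschitz uL bs).
by move=> i x; case: (conv_is_derive i x bs).
Qed.

Lemma conv_sqop i u : bounded_derivs u -> sqop i (conv u) = conv (sqop i u).
Proof.
move=> bu; have b1 := bounded_derivs_partial i bu.
have b2 := bounded_derivs_partial i b1.
have bD := bounded_derivsD b2 bu.
rewrite !sqopE conv_lin_derivs// !conv_rpartial//; congr (_ + _).
by rewrite -[in RHS](scale1r (rpartial i (rpartial i u))) conv_lin_derivs// scale1r.
Qed.

Lemma conv_tensor m (e : 'I_m -> 'I_n) u : bounded_derivs u ->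
  tensor_op e (conv u) = conv (tensor_op e u).
Proof.
elim: m e u => //= m IH e u bu; rewrite conv_sqop// IH//.
exact: bounded_derivs_sqop.
Qed.

Lemma conv_lap u : bounded_derivs u -> rlap (conv u) = conv (rlap u).
Proof.
move=> bu; have bd2 i : bounded_derivs (rpartial i (rpartial i u)).
  by do 2 apply: bounded_derivs_partial.
have sumE (r : seq 'I_n) : conv (\sum_(i <- r) rpartial i (rpartial i u)) =
      \sum_(i <- r) conv (rpartial i (rpartial i u)) /\
    bounded_derivs (\sum_(i <- r) rpartial i (rpartial i u)).
  have b0 := bounded_derivs_cst n (0 : R).
  elim: r => [|i r [IH bs]]; rewrite ?big_nil ?big_cons; split => //.
  - apply/funext => x; apply/eqP; rewrite -normr_le0.
    by apply: conv_bound_derivs => // y; rewrite normr0.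
  - by rewrite -IH -[X in conv (X + _)]scale1r conv_lin_derivs// scale1r.
  - exact: bounded_derivsD.
have [cE bs] := sumE (index_enum 'I_n).
have E (v w : Rn -> R) : v - w = (-1) *: w + v by rewrite scaleN1r addrC.
rewrite [RHS](_ : _ = conv ((-1) *: \sum_i rpartial i (rpartial i u) + u)); last first.
  by rewrite -E.
rewrite conv_lin_derivs// cE -E; congr (_ - _); apply: eq_bigr => i _.
by rewrite !conv_rpartial//; exact: bounded_derivs_partial.
Qed.

Lemma conv_iter_lap m u : bounded_derivs u ->
  iter m rlap (conv u) = conv (iter m rlap u).
Proof.
move=> bu; elim: m => // m IH; rewrite !iterS IH conv_lap//.
exact: bounded_derivs_iter_lap.
Qed.

(** Since u = conv (tensor_op u) = tensor_op (conv u), and tensor_op is dominated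
    by (1 - Laplacian)^(2n). The point is that on the right the function enters
    only through its average. *)
Lemma conv_lap_bound u (K : R) : bounded_derivs u ->
  (forall x, `|conv (iter (2 * n)%N rlap u) x| <= K) ->
  forall x, `|u x| <= 9 ^+ n * K.
Proof.
move=> bu uK x; rewrite -(conv_inverse bu) -conv_tensor//.
apply: tensor_op_bound; first exact: bounded_derivs_conv.
by move=> y; rewrite conv_iter_lap.
Qed.

Lemma row_of_shift (x : Rn) (t : n.-tuple RM) :
  row_of_tuple (shift_tuple [tuple (x 0 i : RM) | i < n] t) = x + row_of_tuple t.
Proof. by apply/rowP => i; rewrite !mxE !tnth_mktuple. Qed.

(** Translation invariance turns the average over x + t into an integral against
    the translated kernel, which is Lipschitz in x. *)
Lemma conv_kernel_form g x (K : R) : continuous g -> (forall y, `|g y| <= K) ->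
  conv g x = \int[mu]_t (ker (row_of_tuple t - x) * g (row_of_tuple t)).
Proof.
move=> cg gK; pose F (t : n.-tuple RM) := ker (row_of_tuple t - x) * g (row_of_tuple t).
have cs : continuous (fun y : Rn => ker (y - x) * g y).
  apply: fun_continuousM => //; under eq_fun do rewrite addrC.
  exact: continuous_translate ker_continuous.
have mF : measurable_fun setT (EFin \o F).
  by apply/measurable_EFinP; exact: (@measurable_row (fun y => ker (y - x) * g y)).
pose c := [tuple (x 0 i : RM) | i < n].
have shiftE (h : R -> \bar R) : measurable_fun setT (h \o F) ->
    (forall t, 0 <= h (F t))%E ->
    (\int[mu]_t h (ker_prod t * g (x + row_of_tuple t))%R = \int[mu]_t h (F t))%E.
  move=> mh h0; rewrite -(ge0_integral_shift_tuple c mh h0).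
  apply: eq_integral => t _; rewrite /F /= row_of_shift.
  by rewrite addrAC subrr add0r ker_row.
rewrite /conv /Rintegral; congr fine; rewrite integralE [RHS]integralE.
congr (_ - _)%E.
  rewrite (funepos_comp EFin (fun t => ker_prod t * g (x + row_of_tuple t))).
  rewrite [in RHS](funepos_comp EFin F); apply: shiftE => [|t].
    by rewrite -funepos_comp; exact: measurable_funepos.
  exact: funepos_ge0.
rewrite (funeneg_comp EFin (fun t => ker_prod t * g (x + row_of_tuple t))).
rewrite [in RHS](funeneg_comp EFin F); apply: shiftE => [|t].
  by rewrite -funeneg_comp; exact: measurable_funeneg.
exact: funeneg_ge0.
Qed.

End convolution.

(** * Extension of functionals to all bounded functions *)

Section hahn_banach.
Variables (R : realType) (X : Type) (C : R).
Implicit Types (g h : X -> R) (A : set ((X -> R) * R)).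

Definition bounded_fun g := exists K : R, forall x, `|g x| <= K.

(** Graphs of linear functionals of norm at most C on spaces of bounded functions
    with the sup norm. Subsets of the product are convenient for Zorn's lemma:
    unions of chains are graphs again. *)
Definition bounded_linear_graph A := [/\
  (forall (a : R) p q, A p -> A q -> A (a *: p.1 + q.1, a * p.2 + q.2)),
  (forall p, A p -> bounded_fun p.1) &
  (forall p (K : R), A p -> (forall x, `|p.1 x| <= K) -> `|p.2| <= C * K)].

Lemma graph_zero A p : bounded_linear_graph A -> A p -> A (0, 0).
Proof.
move=> [lA _ _] Ap; have := lA (-1) p p Ap Ap.
by rewrite scaleN1r addNr mulN1r addNr.
Qed.

Lemma graph_scale A p (a : R) : bounded_linear_graph A -> A p ->
  A (a *: p.1, a * p.2).
Proof.
move=> bA Ap; have A0 := graph_zero bA Ap; case: bA => lA _ _.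
by have := lA a _ _ Ap A0; rewrite !addr0.
Qed.

Lemma graph_functional A g r r' : bounded_linear_graph A ->
  A (g, r) -> A (g, r') -> r = r'.
Proof.
move=> [lA _ nA] Ar Ar'; have := nA _ 0 (lA (-1) _ _ Ar' Ar).
rewrite /= mulr0 normr_le0 scaleN1r addNr mulN1r addrC subr_eq0 => H.
by apply/eqP/H => x; rewrite normr0.
Qed.

(** The value at g0 is chosen between the bounds that the functional imposes from
    below and, by cross, from above. *)
Lemma graph_extension A g0 : bounded_linear_graph A -> A (0, 0) ->
  bounded_fun g0 -> exists2 B, bounded_linear_graph B & A `<=` B /\ exists r, B (g0, r).
Proof.
move=> bA A0 [K0 g0K]; have [lA dA nA] := bA.
pose close (p : (X -> R) * R) K := forall x, `|p.1 x - g0 x| <= K :> R.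
have cross p q (K L : R) : A p -> A q -> close p K -> close q L ->
    p.2 - C * K <= q.2 + C * L.
  move=> Ap Aq pK qL; have := nA _ (K + L) (lA (-1) _ _ Aq Ap).
  have H x : `|(-1 *: q.1 + p.1) x| <= K + L.
    rewrite -[(_ + _) x]/(-1 * q.1 x + p.1 x).
    rewrite (_ : -1 * q.1 x + p.1 x = (p.1 x - g0 x) - (q.1 x - g0 x)); last by ring.
    by apply: le_trans (ler_normB _ _) _; apply: lerD.
  by move=> /(_ H) /=; rewrite ler_norml => /andP[_]; lra.
pose S := [set r | exists p K, [/\ A p, close p K & r = p.2 - C * K]].
have S0 : S (0 - C * K0).
  by exists (0, 0), K0; split => // x; rewrite /= sub0r normrN.
have ubS q (L : R) : A q -> close q L -> ubound S (q.2 + C * L).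
  by move=> Aq qL _ [p [K [Ap pK ->]]]; exact: cross.
have hS : has_sup S.
  split; first by exists (0 - C * K0).
  exists (0 + C * K0); apply: (ubS (0 : X -> R, 0 : R) K0 A0) => x.
  by rewrite /= sub0r normrN.
pose al := sup S.
have alP p (K : R) : A p -> close p K -> `|p.2 - al| <= C * K.
  move=> Ap pK; rewrite ler_norml.
  have h1 : p.2 - C * K <= al by apply: ub_le_sup; [case: hS|exists p, K].
  have h2 : al <= p.2 + C * K by apply: ge_sup; [case: hS|exact: ubS].
  by lra.
pose B := [set q | exists p t, A p /\ q = (p.1 + t *: g0, p.2 + t * al)].
exists B; last split.
- split.
  + move=> a _ _ [p [t [Ap ->]]] [q [s [Aq ->]]].
    exists (a *: p.1 + q.1, a * p.2 + q.2), (a * t + s); split; first exact: lA.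
    rewrite /= scalerDr scalerA scalerDl addrACA; congr pair; ring.
  + move=> _ [p [t [Ap ->]]]; have [K pK] := dA _ Ap; exists (K + `|t| * K0) => x.
    rewrite -[X in `|X|]/(p.1 x + t * g0 x).
    apply: le_trans (ler_normD _ _) _; apply: lerD => //.
    by rewrite normrM ler_wpM2l.
  + move=> _ K [p [t [Ap ->]]] /= pK; have [t0|t0] := eqVneq t 0.
      rewrite t0 mul0r addr0; apply: nA Ap _ => x.
      by have := pK x; rewrite t0 scale0r addr0.
    have := alP _ (`|t|^-1 * K) (graph_scale (- t^-1) bA Ap).
    rewrite (_ : p.2 + t * al = (- t) * ((- t^-1) * p.2 - al)); last first.
      by rewrite mulrBr mulrA mulrNN divff// mul1r mulNr opprK.
    rewrite normrM normrN => H.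
    have t1 : 0 < `|t| by rewrite normr_gt0.
    have ti : 0 < `|t|^-1 by rewrite invr_gt0.
    rewrite -(ler_pM2l ti).
    rewrite mulKf ?gt_eqF// mulrCA; apply: H => x.
    rewrite -[X in X - _]/(- t^-1 * p.1 x).
    rewrite (_ : _ - g0 x = (- t^-1) * (p.1 x + t * g0 x)); last first.
      by rewrite mulrDr (mulNr _ (t * _)) mulKf.
    by rewrite normrM normrN normfV ler_pM2l ?invr_gt0//; exact: pK.
- by move=> p Ap; exists p, 0; split => //; rewrite scale0r mul0r !addr0; case: p Ap.
- by exists al, (0, 0), 1; split => //; rewrite /= scale1r mul1r !add0r.
Qed.

(** Zorn's lemma applied to the graphs that extend A. *)
Theorem hahn_banach_bounded_fun A : bounded_linear_graph A -> A (0, 0) ->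
  exists L : (X -> R) -> R, [/\
    forall (a : R) g h, bounded_fun g -> bounded_fun h ->
      L (a *: g + h) = a * L g + L h,
    forall g (K : R), (forall x, `|g x| <= K) -> `|L g| <= C * K &
    forall p, A p -> L p.1 = p.2].
Proof.
move=> bA A0; pose P B := B = set0 \/ bounded_linear_graph B /\ A `<=` B.
have [F FP totF|M [PM Mmax]] := @Zorn_bigcup _ P.
  have [[B FB [bB AB]]|noB] := pselect (exists2 B, F B &
      bounded_linear_graph B /\ A `<=` B); last first.
    left; rewrite bigcup0// => B FB; case: (FP _ FB) => // H.
    by exfalso; apply: noB; exists B.
  right; split; last by move=> p /AB Bp; exists B.
  have goodF D p : F D -> D p -> bounded_linear_graph D.
    by move=> FD Dp; case: (FP _ FD) => [D0|[]//]; rewrite D0 in Dp.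
  split.
  - move=> a p q [D FD Dp] [D' FD' D'q].
    have [DD'|D'D] := totF _ _ FD FD'.
      have [lD _ _] := goodF _ _ FD' D'q.
      by exists D' => //; apply: lD => //; exact: DD'.
    have [lD _ _] := goodF _ _ FD Dp.
    by exists D => //; apply: lD => //; exact: D'D.
  - by move=> p [D FD Dp]; have [_ dD _] := goodF _ _ FD Dp; exact: dD.
  - by move=> p K [D FD Dp]; have [_ _ nD] := goodF _ _ FD Dp; exact: nD.
have [bM AM] : bounded_linear_graph M /\ A `<=` M.
  case: PM => // M0; exfalso; apply: (Mmax A); last by right; split.
  by rewrite M0; split; [exact: sub0set|move=> /(_ _ A0)].
have M0 := AM _ A0.
have domM g : bounded_fun g -> exists r, M (g, r).
  move=> bg; have [B bB [MB [r Bg]]] := graph_extension bM M0 bg.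
  exists r; apply: contrapT => nMr; apply: (Mmax B).
    by split => // BM; apply: nMr; exact: BM.
  by right; split => //; exact: subset_trans MB.
exists (fun g => xget 0 [set r | M (g, r)]).
have LP g r : M (g, r) -> xget 0 [set r | M (g, r)] = r.
  move=> Mg; apply: (graph_functional bM _ Mg).
  exact: (@xgetPex _ 0 [set r | M (g, r)] (ex_intro _ r Mg)).
split.
- move=> a g h /domM[r Mr] /domM[r' Mr']; rewrite (LP _ _ Mr) (LP _ _ Mr').
  by apply: LP; case: bM => lM _ _; exact: (lM a _ _ Mr Mr').
- move=> g K gK; have [|r Mr] := domM g; first by exists K.
  by rewrite (LP _ _ Mr); case: bM => _ _ nM; exact: (nM _ _ Mr gK).
- by move=> [g r] Ap; apply: LP; exact: AM.
Qed.

End hahn_banach.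

(** * Densities of functionals by Riemann sums *)

Section riemann_sums.
Variables (R : realType) (n : nat).
Local Notation Rn := 'rV[R]_n.
Local Notation RM := (measurableTypeR R).
Local Notation mu := (lebesgue R n).
Implicit Types (g h : Rn -> R).

Definition cube (N : nat) : set (n.-tuple RM) :=
  [set t | forall i, - N%:R <= (tnth t i : R) < N%:R].

Lemma cube_mono N M : (N <= M)%N -> cube N `<=` cube M.
Proof.
move=> NM t tN i; have /andP[t1 t2] := tN i.
have NM' : N%:R <= M%:R :> R by rewrite ler_nat.
by rewrite (lt_le_trans t2 NM') andbT (le_trans _ t1)// lerN2.
Qed.

Lemma measurable_box (a b : 'I_n -> R) :
  measurable [set t : n.-tuple RM | forall i, a i <= (tnth t i : R) < b i].
Proof.
rewrite (_ : [set _ | _] = \bigcap_(i : 'I_n)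
    ((fun t : n.-tuple RM => tnth t i) @^-1` `[a i, b i[%classic)); last first.
  apply/seteqP; split => [t H i _|t H i]; first by rewrite /= in_itv/=; exact: H.
  by have := H i I; rewrite /= in_itv.
apply: fin_bigcap_measurable => // i _.
rewrite -[X in measurable X]setTI; apply: measurable_tnth => //.
Qed.

Lemma measurable_cube N : measurable (cube N).
Proof. exact: measurable_box. Qed.

Lemma cube_cover t : exists N, cube N t.
Proof.
pose K := \sum_i `|tnth t i : R|; exists (Num.trunc K).+1 => i.
have : K < (Num.trunc K).+1%:R by exact: truncnS_gt.
have iK : `|tnth t i : R| <= K by rewrite /K (bigD1 i)//= lerDl sumr_ge0.
move=> /(le_lt_trans iK); rewrite ltr_norml => /andP[h1 h2].
by rewrite h2 ltW.
Qed.

Lemma cube_row N (t : n.-tuple RM) : ~ cube N t -> N%:R <= `|row_of_tuple t|.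
Proof.
move=> Nt; rewrite leNgt; apply/negP => tN; apply: Nt => i.
have := norm_coord (row_of_tuple t) i; rewrite mxE => /le_lt_trans /(_ tN).
by rewrite ltr_norml => /andP[/ltW -> ->].
Qed.

(** On the cube a translate of the kernel is bounded below, and its integral is 1. *)
Lemma cube_finite N : (mu (cube N) < +oo)%E.
Proof.
(* Translated by c, the points of the cube have coordinates in [1, 2 N + 1),
   where ker1 is at least e^-(2 N + 1). *)
pose c := [tuple (N%:R + 1 : RM) | i < n].
pose d : R := (expR (- (2 * N%:R + 1))) ^+ n.
have d0 : 0 < d by rewrite exprn_gt0// expR_gt0.
have mk : measurable_fun setT (fun t => (ker_prod (shift_tuple c t))%:E).
  apply/measurable_EFinP; apply: measurableT_comp; first exact: measurable_ker_prod.
  exact: measurable_shift_tuple.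
have low t : cube N t -> d <= ker_prod (shift_tuple c t).
  move=> Nt; rewrite /d /ker_prod -[X in _ ^+ X]card_ord -prodr_const.
  apply: ler_prod => i _; rewrite expR_ge0/= !tnth_mktuple.
  have /andP[h1 h2] := Nt i; rewrite ker1_pos; last by lra.
  rewrite -[leLHS]mul1r; apply: ler_pM; rewrite ?expR_ge0 ?ler_expR//; lra.
have : (d%:E * mu (cube N) <= 1)%E.
  rewrite -integral_cst; last exact: measurable_cube.
  have E : (\int[mu]_t (ker_prod (shift_tuple c t))%:E = 1)%E.
    rewrite (ge0_integral_shift_tuple c (F := fun t => (ker_prod t)%:E)).
    - exact: integral_ker_prod.
    - by apply/measurable_EFinP; exact: measurable_ker_prod.
    - by move=> t; rewrite lee_fin ker_prod_ge0.
  have k0 t : (0 <= (ker_prod (shift_tuple c t))%:E)%E by rewrite lee_fin ker_prod_ge0.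
  have mN := measurable_cube N.
  rewrite -E; apply: (@le_trans _ _ (\int[mu]_(t in cube N) (ker_prod (shift_tuple c t))%:E)%E);
    last exact: ge0_subset_integral.
  apply: ge0_le_integral => //.
  - by move=> t _; rewrite lee_fin ltW.
  - exact: (measurable_funS measurableT).
rewrite -lee_pdivlMl// => /le_lt_trans; apply.
by rewrite mule1 ltry.
Qed.

Lemma riemann_partition N k : exists (I : finType) (A : I -> set (n.-tuple RM))
    (p : I -> Rn), [/\ forall z, measurable (A z), trivIset setT A,
      \big[setU/set0]_(z <- index_enum I) A z = cube N &
      forall z t, A z t -> `|row_of_tuple t - p z| <= k.+1%:R^-1].
Proof.
pose h : R := k.+1%:R^-1; have h0 : 0 < h by rewrite invr_gt0.
pose I := {ffun 'I_n -> 'I_(2 * N * k.+1)}.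
pose A (z : I) : set (n.-tuple RM) := [set t | forall i,
  (z i)%:R * h - N%:R <= (tnth t i : R) < (z i).+1%:R * h - N%:R].
exists I, A, (fun z : I => \row_i ((z i)%:R * h - N%:R)); split.
- by move=> z; exact: measurable_box.
- move=> z w _ _ [t [tz tw]]; apply/ffunP => i; apply: val_inj.
  have /andP[z1 z2] := tz i; have /andP[w1 w2] := tw i.
  have zw : (z i < (w i).+1)%N by rewrite -(ltr_nat R) -(ltr_pM2r h0); lra.
  have wz : (w i < (z i).+1)%N by rewrite -(ltr_nat R) -(ltr_pM2r h0); lra.
  by apply/eqP; rewrite eqn_leq; apply/andP.
- have hk : k.+1%:R * h = 1 by rewrite /h mulfV ?pnatr_eq0.
  rewrite -bigcup_seq; apply/seteqP; split => [t [z _ tz] i|t tN].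
    have /andP[t1 t2] := tz i.
    have zN : (z i).+1%:R * h <= 2 * N%:R.
      have zk : (z i).+1%:R <= 2 * N%:R * k.+1%:R :> R.
        by rewrite -!natrM ler_nat; exact: ltn_ord.
      apply: le_trans (ler_wpM2r (ltW h0) zk) _.
      by rewrite -(mulrA (2 * _)) hk mulr1.
    have z0 : 0 <= (z i)%:R * h by rewrite mulr_ge0// ltW.
    by apply/andP; split; lra.
  pose u i : R := (tnth t i + N%:R) * k.+1%:R.
  have u0 i : 0 <= u i by rewrite mulr_ge0//; have /andP[? _] := tN i; lra.
  have uP i := truncn_itv (u0 i).
  have lt_u i : (Num.trunc (u i) < 2 * N * k.+1)%N.
    have /andP[u1 _] := uP i; rewrite -(ltr_nat R); apply: le_lt_trans u1 _.
    rewrite !natrM ltr_pM2r ?ltr0n//; have /andP[_ ?] := tN i; lra.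
  exists [ffun i => Ordinal (lt_u i)]; first by rewrite /= mem_index_enum.
  move=> i; rewrite ffunE /=; have /andP[u1 u2] := uP i.
  have uE : u i * h = tnth t i + N%:R by rewrite /u -mulrA hk mulr1.
  have h1 : (Num.trunc (u i))%:R * h <= u i * h by rewrite ler_pM2r.
  have h2 : u i * h < (Num.trunc (u i)).+1%:R * h by rewrite ltr_pM2r.
  by rewrite uE in h1 h2; apply/andP; split; lra.
- move=> z t tz; rewrite [`|_|]mx_normrE; apply/bigmax_leP; split => [|[a i] _ /=].
    exact: ltW.
  rewrite (ord1 a) !mxE; have /andP[t1 t2] := tz i.
  rewrite -natr1 mulrDl mul1r in t2; rewrite -/h ler_norml; lra.
Qed.

Lemma integrable_on_cube N g (K : R) : continuous g -> (forall y, `|g y| <= K) ->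
  mu.-integrable (cube N) (EFin \o (fun t => g (row_of_tuple t))).
Proof.
move=> cg gK; have mN := measurable_cube N.
have iK : mu.-integrable (cube N) (cst K%:E).
  apply/integrableP; split; first exact: measurable_cst.
  rewrite integral_cst//= lte_mul_pinfty//; exact: cube_finite.
apply: le_integrable iK => //.
  apply/measurable_EFinP; apply: (measurable_funS measurableT) => //.
  exact: measurable_row.
by move=> t _ /=; rewrite lee_fin; apply: le_trans (gK _) (ler_norm _).
Qed.

Definition cube_vol N : R := fine (mu (cube N)).

(** The error depends on the function only through its Lipschitz constant, which
    is what allows the functional L below to be exchanged with the sums. *)
Lemma riemann_sum N k : exists (I : finType) (m : I -> R) (p : I -> Rn),
  (forall z, 0 <= m z) /\
  forall g (K L : R), 0 <= L -> (forall y, `|g y| <= K) ->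
   (forall x y, `|g x - g y| <= L * `|x - y|) ->
   `|\int[mu]_(t in cube N) g (row_of_tuple t) - \sum_z m z * g (p z)|
     <= L * k.+1%:R^-1 * cube_vol N.
Proof.
have [I [A [p [mA tA UA pA]]]] := riemann_partition N k.
have AN z : A z `<=` cube N.
  by rewrite -UA -bigcup_seq => t At; exists z; rewrite //= mem_index_enum.
have Afin z : (mu (A z) < +oo)%E.
  apply: le_lt_trans (cube_finite N); apply: le_measure; rewrite ?inE//.
  exact: measurable_cube.
pose m z : R := fine (mu (A z)).
have mE z : mu (A z) = (m z)%:E.
  by rewrite /m fineK// ge0_fin_numE.
exists I, m, p; split=> [z|g K L L0 gK gL]; first exact: fine_ge0.
have cg := lipschitz_fun_continuous gL.
have ig := integrable_on_cube N cg gK.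
have igA z : mu.-integrable (A z) (EFin \o (fun t => g (row_of_tuple t))).
  exact: integrableS (measurable_cube N) (mA z) (AN z) ig.
have ic z (c : R) : mu.-integrable (A z) (EFin \o (fun _ : n.-tuple RM => c)).
  apply/integrableP; split; first exact/measurable_EFinP/measurable_cst.
  rewrite (integral_cst _ (mA z))/= lte_mul_pinfty ?lee_fin//.
have sumE (f : n.-tuple RM -> R) :
    (forall z, mu.-integrable (A z) (EFin \o f)) -> measurable_fun (cube N) f ->
    \int[mu]_(t in cube N) f t = \sum_z \int[mu]_(t in A z) f t.
  move=> If mf; rewrite /Rintegral -UA integral_bigsetU_EFin//.
  - rewrite -[RHS]/(fine (\sum_z _)%:E) -sumEFin; congr fine; apply: eq_bigr => z _.
    by rewrite fineK//; exact: integrable_fin_num.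
  - exact: index_enum_uniq.
  - by apply: sub_trivIset tA; exact: subsetT.
  - by rewrite UA; apply/measurable_EFinP.
have volE : cube_vol N = \sum_z m z.
  have := sumE (fun=> 1) (ic ^~ 1) (measurable_cst _).
  rewrite Rintegral_cst ?mul1r; last exact: measurable_cube.
  by rewrite /cube_vol => ->; apply: eq_bigr => z _; rewrite Rintegral_cst ?mul1r.
have -> : \int[mu]_(t in cube N) g (row_of_tuple t) =
    \sum_z \int[mu]_(t in A z) g (row_of_tuple t).
  by apply: sumE => //; apply/measurable_EFinP; case/integrableP: ig.
rewrite -sumrB volE mulr_sumr; apply: le_trans (ler_norm_sum _ _ _) _.
apply: ler_sum => z _.
have -> : \int[mu]_(t in A z) g (row_of_tuple t) - m z * g (p z) =
    \int[mu]_(t in A z) (g (row_of_tuple t) - g (p z)).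
  by rewrite RintegralB// Rintegral_cst// mulrC.
have iB : mu.-integrable (A z) (EFin \o (fun t => g (row_of_tuple t) - g (p z))).
  exact: (integrableB (mA z) (igA z) (ic z (g (p z)))).
apply: le_trans (le_normr_Rintegral (mA z) iB) _.
rewrite [leRHS](_ : _ = \int[mu]_(t in A z) (L * k.+1%:R^-1)); last first.
  by rewrite Rintegral_cst.
apply: le_Rintegral => //; first exact: integrable_abse iB.
move=> t At; apply: le_trans (gL _ _) _.
by apply: ler_wpM2l => //; exact: pA.
Qed.

Lemma integrable_ker_shift (x : Rn) :
  mu.-integrable setT (EFin \o (fun t => ker (row_of_tuple t - x))) /\
  \int[mu]_t ker (row_of_tuple t - x) = 1.
Proof.
have mk : measurable_fun setT (fun t : n.-tuple RM => (ker (row_of_tuple t - x))%:E).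
  apply/measurable_EFinP; apply: (@measurable_row _ _ (fun y => ker (y - x))).
  under eq_fun do rewrite addrC.
  exact: (@continuous_translate R n (@ker R n) (- x) (@ker_continuous R n)).
have E : (\int[mu]_t (ker (row_of_tuple t - x))%:E = 1)%E.
  rewrite -(ge0_integral_shift_tuple [tuple (x 0 i : RM) | i < n] mk).
    rewrite -[RHS](integral_ker_prod R n); apply: eq_integral => t _.
    by rewrite row_of_shift addrAC subrr add0r ker_row.
  by move=> t; rewrite lee_fin ker_ge0.
split; last by rewrite /Rintegral E.
apply/integrableP; split => //.
under eq_integral => t _ do rewrite /= ger0_norm ?ker_ge0//.
by rewrite E ltry.
Qed.

Lemma ker_integral_le1 (D : set (n.-tuple RM)) (x : Rn) : measurable D ->
  \int[mu]_(t in D) ker (row_of_tuple t - x) <= 1.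
Proof.
move=> mD; have [ik E] := integrable_ker_shift x; rewrite -[leRHS]E.
have ikD := integrableS measurableT mD (@subsetT _ _) ik.
rewrite /Rintegral; apply: fine_le; [exact: integrable_fin_num..|].
apply: ge0_subset_integral => //; first by case/integrableP: ik.
by move=> t _; rewrite lee_fin ker_ge0.
Qed.

(** Off the cube psi is at most e, and the kernel has total mass 1. *)
Lemma conv_truncation N (psi : Rn -> R) (K e : R) x : continuous psi -> 0 <= e ->
  (forall y, `|psi y| <= K) -> (forall y, N%:R <= `|y| -> `|psi y| <= e) ->
  `|conv psi x - \int[mu]_(t in cube N) (psi (row_of_tuple t) * ker (row_of_tuple t - x))|
    <= e.
Proof.
move=> cpsi e0 psiK psie; have [ik E] := integrable_ker_shift x.
have mN := measurable_cube N; have mC := measurableC mN.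
pose F (t : n.-tuple RM) := psi (row_of_tuple t) * ker (row_of_tuple t - x).
have iF : mu.-integrable setT (EFin \o F).
  have := integrableZl measurableT K ik; apply: le_integrable => //.
    apply/measurable_EFinP; apply: measurable_funM; first exact: measurable_row.
    by apply/measurable_EFinP; case/integrableP: ik.
  move=> t _; rewrite /= lee_fin !normrM ler_wpM2r//.
  exact: le_trans (psiK _) (ler_norm _).
have -> : conv psi x = \int[mu]_t F t.
  rewrite (conv_kernel_form x cpsi psiK).
  by apply: eq_Rintegral => t _; rewrite mulrC.
rewrite -[X in \int[mu]_(t in X) _ - _](setvU (cube N)) Rintegral_setU//; first last.
- by apply/disj_setPS => t [] /=.
- by rewrite setvU.
rewrite addrK.
have iFC := integrableS measurableT mC (@subsetT _ _) iF.
have ikC := integrableS measurableT mC (@subsetT _ _) ik.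
apply: le_trans (le_normr_Rintegral mC iFC) _.
apply: (@le_trans _ _ (\int[mu]_(t in ~` cube N) (e * ker (row_of_tuple t - x)))).
  apply: le_Rintegral => //; first exact: integrable_abse iFC.
    exact: (integrableZl mC e ikC).
  move=> t Ct; rewrite normrM (ger0_norm (ker_ge0 _)) ler_wpM2r ?ker_ge0//.
  by apply: psie; exact: cube_row.
by rewrite RintegralZl// -[leRHS]mulr1 ler_wpM2l// ker_integral_le1.
Qed.

Lemma le_of_mesh (a b c : R) : (forall k : nat, a <= b + c * k.+1%:R^-1) -> a <= b.
Proof.
move=> H; apply/ler_addgt0Pr => e e0.
have [c0|c0] := leP c 0.
  apply: le_trans (H 0%N) _; rewrite invr1 mulr1 lerD2l.
  exact: le_trans c0 (ltW e0).
have := H (Num.trunc (c / e)) => /le_trans; apply; rewrite lerD2l.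
rewrite ler_pdivrMr ?ltr0n// mulrC -ler_pdivrMr//.
by rewrite ltW// truncnS_gt.
Qed.

Section representation.
Variables (L : (Rn -> R) -> R) (C : R).
Hypothesis C0 : 0 <= C.
Hypothesis L_lin : forall (a : R) g h, bounded_fun g -> bounded_fun h ->
  L (a *: g + h) = a * L g + L h.
Hypothesis L_bound : forall g (K : R), (forall x, `|g x| <= K) -> `|L g| <= C * K.

Let L_sum (I : Type) (r : seq I) (a : I -> R) (g : I -> Rn -> R) :
  (forall z, bounded_fun (g z)) ->
  L (\sum_(z <- r) a z *: g z) = \sum_(z <- r) a z * L (g z) /\
  bounded_fun (\sum_(z <- r) a z *: g z).
Proof.
move=> gb; have b0 : bounded_fun (0 : Rn -> R) by exists 0 => x; rewrite normr0.
have L0 : L 0 = 0.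
  have := L_bound (g := 0) (K := 0); rewrite mulr0 normr_le0 => H.
  by apply/eqP/H => x; rewrite normr0.
elim: r => [|z r [IH [M bM]]]; first by rewrite !big_nil.
rewrite !big_cons -IH L_lin//; last by exists M.
split=> //; have [K gK] := gb z; exists (`|a z| * K + M) => x.
rewrite -[X in `|X|]/(a z * g z x + (\sum_(j <- r) a j *: g j) x).
apply: le_trans (ler_normD _ _) _; apply: lerD => //.
by rewrite normrM ler_wpM2l.
Qed.

(** Writing conv psi as an integral of psi y times x |-> ker (y - x), one expects
    L (conv psi) to be the integral of psi times this function. *)
Definition density (y : Rn) : R := L (fun x => ker (y - x)).

Let ker_bounded (y : Rn) : bounded_fun (fun x => ker (y - x)).
Proof. by exists 1 => x; rewrite ger0_norm ?ker_ge0 ?ker_le1. Qed.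

Lemma density_bound y : `|density y| <= C.
Proof.
rewrite -[leRHS]mulr1; apply: L_bound => x.
by rewrite ger0_norm ?ker_ge0 ?ker_le1.
Qed.

Lemma density_lipschitz x y : `|density x - density y| <= C * n%:R * `|x - y|.
Proof.
have -> : density x - density y =
    L ((-1) *: (fun z => ker (y - z)) + (fun z => ker (x - z))).
  by rewrite L_lin// mulN1r addrC.
rewrite -mulrA; apply: L_bound => z.
rewrite -[X in `|X|]/(-1 * ker (y - z) + ker (x - z)) mulN1r addrC.
apply: le_trans (ker_lipschitz _ _) _.
by rewrite opprB addrA subrK.
Qed.

(** A Riemann sum of |density| is the value of L at a combination of translated
    kernels with coefficients of modulus at most the weights; such a combination
    is bounded by a Riemann sum of the kernel, hence by nearly 1. *)
Lemma density_integral_cube N : \int[mu]_(t in cube N) `|density (row_of_tuple t)| <= C.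
Proof.
pose D := C * n%:R; have D0 : 0 <= D by rewrite mulr_ge0.
apply: (@le_of_mesh _ _ (D * cube_vol N + C * (n%:R * cube_vol N))) => k.
have [I [m [p [m0 H]]]] := riemann_sum N k.
have := H (fun y => `|density y|) C D D0.
have h1 y : `| `|density y| | <= C by rewrite normr_id; exact: density_bound.
have h2 x y : `| `|density x| - `|density y| | <= D * `|x - y|.
  apply: le_trans (density_lipschitz x y).
  exact: ler_dist_dist.
move=> /(_ h1 h2); rewrite ler_norml => /andP[_]; rewrite lerBlDr.
move=> /le_trans; apply.
(* The signs turn the sum of absolute values into one value of L. *)
pose sg z := Num.sg (density (p z)).
have -> : \sum_z m z * `|density (p z)| =
    L (\sum_z (m z * sg z) *: (fun x => ker (p z - x))).
  rewrite (L_sum _ _ (fun z => ker_bounded (p z))).1; apply: eq_bigr => z _.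
  by rewrite -mulrA -/(density (p z)) /sg -normrEsg.
have : L (\sum_z (m z * sg z) *: (fun x => ker (p z - x))) <=
    C * (1 + n%:R * k.+1%:R^-1 * cube_vol N).
  apply: le_trans (ler_norm _) _; apply: L_bound => x.
  rewrite fct_sumE; apply: le_trans (ler_norm_sum _ _ _) _.
  apply: (@le_trans _ _ (\sum_z m z * ker (p z - x))).
    apply: ler_sum => z _; rewrite -[X in `|X|]/(m z * sg z * ker (p z - x)).
    rewrite !normrM (ger0_norm (m0 z)) (ger0_norm (ker_ge0 _)).
    rewrite ler_wpM2r ?ker_ge0// ler_piMr// /sg normr_sg.
    by case: (_ != 0).
  have := H (fun y => ker (y - x)) 1 n%:R (ler0n _ _).
  have h3 y : `|ker (y - x)| <= 1 by rewrite ger0_norm ?ker_ge0 ?ker_le1.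
  have h4 y z : `|ker (y - x) - ker (z - x)| <= n%:R * `|y - z|.
    apply: le_trans (ker_lipschitz _ _) _.
    by rewrite opprB addrA subrK.
  move=> /(_ h3 h4); rewrite ler_norml => /andP[h5 _].
  have := ker_integral_le1 x (measurable_cube N).
  have lin (a b c : R) : - c <= a - b -> a <= 1 -> b <= 1 + c by lra.
  exact: lin h5.
move=> /(lerD (lexx (D * k.+1%:R^-1 * cube_vol N))) /le_trans; apply.
rewrite le_eqVlt; apply/orP; left; apply/eqP; rewrite /D; ring.
Qed.

Lemma density_continuous : continuous density.
Proof. exact: lipschitz_fun_continuous density_lipschitz. Qed.

Lemma density_integrable :
  mu.-integrable setT (EFin \o (fun t => density (row_of_tuple t))) /\
  (\int[mu]_t `|(density (row_of_tuple t))%:E| <= C%:E)%E.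
Proof.
have md : measurable_fun setT (fun t : n.-tuple RM => `|(density (row_of_tuple t))%:E|%E).
  apply: measurableT_comp => //; apply/measurable_EFinP.
  exact: measurable_row density_continuous.
have mN := measurable_cube.
have cubeU : \bigcup_N cube N = setT.
  by apply/seteqP; split => // t _; have [N tN] := cube_cover t; exists N.
have le : (\int[mu]_t `|(density (row_of_tuple t))%:E| <= C%:E)%E.
  have cv : ((\int[mu]_(t in cube N) `|(density (row_of_tuple t))%:E|) @[N --> \oo] -->
      \int[mu]_t `|(density (row_of_tuple t))%:E|)%E.
    rewrite -cubeU; apply: ge0_nondecreasing_set_cvg_integral => //.
    - by move=> N M NM; rewrite subsetEset; exact: cube_mono.
    - by move=> N; exact: (measurable_funS measurableT).
  apply: (cvge_to_le cv); apply: nearW => N.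
  have ci : continuous (fun y => `|density y|).
    by apply: fun_continuous_comp density_continuous _; exact: norm_continuous.
  have bi y : `| `|density y| | <= C by rewrite normr_id; exact: density_bound.
  have iN := integrable_on_cube N ci bi.
  rewrite -[leLHS]fineK ?lee_fin; first exact: density_integral_cube.
  exact: (integrable_fin_num (mN N) iN).
split=> //; apply/integrableP; split; last by apply: le_lt_trans le (ltry _).
apply/measurable_EFinP; exact: measurable_row density_continuous.
Qed.

(** L maps the Riemann sums of the integral that defines conv psi to those of
    density times psi, uniformly, up to the mesh. *)
Lemma density_pairing_cube N (psi : Rn -> R) (K M e : R) : 0 <= M -> 0 <= e ->
  (forall y, `|psi y| <= K) -> (forall x y, `|psi x - psi y| <= M * `|x - y|) ->
  (forall y, N%:R <= `|y| -> `|psi y| <= e) ->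
  `|\int[mu]_(t in cube N) (density (row_of_tuple t) * psi (row_of_tuple t)) -
    L (conv psi)| <= C * e.
Proof.
move=> M0 e0 psiK psiM psie; have K0 : 0 <= K by exact: le_trans (psiK 0).
have cpsi := lipschitz_fun_continuous psiM.
have prod_lip (u w : Rn -> R) (A B a b : R) : 0 <= A -> 0 <= B ->
    (forall y, `|u y| <= A) -> (forall y, `|w y| <= B) ->
    (forall x y, `|u x - u y| <= a * `|x - y|) ->
    (forall x y, `|w x - w y| <= b * `|x - y|) ->
    forall x y, `|u x * w x - u y * w y| <= (A * b + B * a) * `|x - y|.
  move=> A0 B0 uA wB ua wb x y.
  rewrite (_ : _ - _ = u x * (w x - w y) + w y * (u x - u y)); last by ring.
  apply: le_trans (ler_normD _ _) _; rewrite mulrDl -!mulrA !normrM.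
  by apply: lerD; apply: ler_pM.
pose D1 := C * M + K * (C * n%:R); pose D2 := K * n%:R + 1 * M.
have D10 : 0 <= D1 by rewrite addr_ge0 ?mulr_ge0.
have D20 : 0 <= D2 by rewrite addr_ge0 ?mulr_ge0.
apply: (@le_of_mesh _ _ (D1 * cube_vol N + C * (D2 * cube_vol N))) => k.
have [I [m [p [m0 H]]]] := riemann_sum N k.
have H1 := H (fun y => density y * psi y) (C * K) D1 D10.
have {}H1 := H1 _ (prod_lip _ _ _ _ _ _ C0 K0 density_bound psiK density_lipschitz psiM).
have {}H1 : `|\int[mu]_(t in cube N) (density (row_of_tuple t) * psi (row_of_tuple t))
    - \sum_z m z * (density (p z) * psi (p z))| <= D1 * k.+1%:R^-1 * cube_vol N.
  apply: H1 => y; rewrite normrM; apply: ler_pM => //; exact: density_bound.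
pose S := \sum_z (m z * psi (p z)) *: (fun x => ker (p z - x)).
have [SE [Sb SbE]] := L_sum (index_enum I) (fun z => m z * psi (p z)) (fun z => ker_bounded (p z)).
have SE' : \sum_z m z * (density (p z) * psi (p z)) = L S.
  by rewrite SE; apply: eq_bigr => z _; rewrite [density _ * _]mulrC mulrA.
have bconv : bounded_fun (conv psi) by exists K; exact: conv_bound.
have H2 : `|L S - L (conv psi)| <= C * (e + D2 * k.+1%:R^-1 * cube_vol N).
  have -> : L S - L (conv psi) = L ((-1) *: conv psi + S).
    by rewrite L_lin//; [rewrite mulN1r addrC|exists Sb].
  apply: L_bound => x; rewrite -[X in `|X|]/(-1 * conv psi x + S x).
  pose J := \int[mu]_(t in cube N) (psi (row_of_tuple t) * ker (row_of_tuple t - x)).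
  rewrite (_ : _ + _ = - (conv psi x - J) - (J - S x)); last by ring.
  apply: le_trans (ler_normB _ _) _; rewrite normrN; apply: lerD.
    exact: conv_truncation cpsi e0 psiK psie.
  have := H (fun y => psi y * ker (y - x)) (K * 1) D2 D20.
  have -> : S x = \sum_z m z * (psi (p z) * ker (p z - x)).
    by rewrite /S fct_sumE; apply: eq_bigr => z _; rewrite mulrA.
  apply.
    move=> y; rewrite normrM; apply: ler_pM => //.
    by rewrite ger0_norm ?ker_ge0 ?ker_le1.
  apply: prod_lip => //.
    by move=> y; rewrite ger0_norm ?ker_ge0 ?ker_le1.
  move=> y z; apply: le_trans (ker_lipschitz _ _) _.
  by rewrite opprB addrA subrK.
rewrite SE' in H1.
rewrite (_ : _ - L (conv psi) = (\int[mu]_(t in cube N)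
   (density (row_of_tuple t) * psi (row_of_tuple t)) - L S) + (L S - L (conv psi)));
   last by rewrite addrA subrK.
apply: le_trans (ler_normD _ _) _.
rewrite [leRHS](_ : _ = D1 * k.+1%:R^-1 * cube_vol N +
  C * (e + D2 * k.+1%:R^-1 * cube_vol N)); [exact: lerD|ring].
Qed.

(** Off a large cube psi is small, whereas the density is integrable. *)
Lemma density_pairing (psi : Rn -> R) (K M : R) : 0 <= M ->
  (forall y, `|psi y| <= K) -> (forall x y, `|psi x - psi y| <= M * `|x - y|) ->
  (forall e, 0 < e -> exists r : R, forall y, r < `|y| -> `|psi y| < e) ->
  \int[mu]_t (density (row_of_tuple t) * psi (row_of_tuple t)) = L (conv psi).
Proof.
move=> M0 psiK psiM psi0; have cpsi := lipschitz_fun_continuous psiM.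
have [id_ dC] := density_integrable.
pose F (t : n.-tuple RM) := density (row_of_tuple t) * psi (row_of_tuple t).
have iF : mu.-integrable setT (EFin \o F).
  have := integrableZl measurableT K id_; apply: le_integrable => //.
    apply/measurable_EFinP; apply: measurable_funM; last exact: measurable_row.
    exact: measurable_row density_continuous.
  move=> t _; rewrite /= lee_fin !normrM mulrC ler_wpM2r//.
  exact: le_trans (psiK _) (ler_norm _).
apply/eqP; rewrite -subr_eq0 -normr_le0; apply/ler_addgt0Pr => e' e'0.
rewrite add0r; pose e := e' / (2 * C + 1).
have C1 : 0 < 2 * C + 1 by rewrite ltr_wpDl// mulr_ge0.
have e0 : 0 < e by rewrite divr_gt0.
have [r psir] := psi0 e e0.
pose N := (Num.trunc `|r|).+1.
have rN : r < N%:R by apply: le_lt_trans (ler_norm r) _; exact: truncnS_gt.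
have psiN y : N%:R <= `|y| -> `|psi y| <= e.
  by move=> Ny; apply/ltW/psir; exact: lt_le_trans Ny.
have mN := measurable_cube N; have mC := measurableC mN.
have := density_pairing_cube M0 (ltW e0) psiK psiM psiN.
have -> : \int[mu]_t (density (row_of_tuple t) * psi (row_of_tuple t)) =
    \int[mu]_(t in ~` cube N) F t + \int[mu]_(t in cube N) F t.
  rewrite -Rintegral_setU//; first by rewrite setvU.
    by rewrite setvU.
  by apply/disj_setPS => t [] /=.
rewrite -/F; set J := \int[mu]_(t in cube N) F t => h1.
have iFC := integrableS measurableT mC (@subsetT _ _) iF.
have idC := integrableS measurableT mC (@subsetT _ _) (integrable_abse id_).
have h2 : `|\int[mu]_(t in ~` cube N) F t| <= e * C.
  apply: le_trans (le_normr_Rintegral mC iFC) _.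
  apply: (@le_trans _ _ (\int[mu]_(t in ~` cube N) (e * `|density (row_of_tuple t)|))).
    apply: le_Rintegral => //; first exact: integrable_abse iFC.
      exact: (integrableZl mC e idC).
    move=> t Ct; rewrite normrM mulrC ler_wpM2r//.
    by apply: psiN; exact: cube_row.
  rewrite RintegralZl// ler_wpM2l ?(ltW e0)//.
  rewrite /Rintegral -lee_fin fineK; last exact: (integrable_fin_num mC idC).
  apply: le_trans dC; apply: ge0_subset_integral => //.
  by case/integrableP: (integrable_abse id_).
rewrite -addrA; apply: le_trans (ler_normD _ _) _.
apply: le_trans (lerD h2 h1) _.
have -> : e' = e * (2 * C + 1) by rewrite /e mulfVK// gt_eqF.
have : 0 <= e by exact: ltW.
by lra.
Qed.

End representation.

Local Notation rlap := (one_minus_laplacian (@rpartial R n)).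

(** By conv_lap_bound the value s u depends boundedly on
    conv ((1 - Laplacian)^(2n+m) u), so that s is the restriction of a functional
    on bounded functions, which has a density on averages. *)
Theorem lap_functional_density (P : set (Rn -> R)) (s : (Rn -> R) -> R) m (C : R) :
  0 <= C -> P 0 ->
  (forall (a : R) u w, P u -> P w -> P (a *: u + w)) ->
  (forall u, P u -> bounded_derivs u) ->
  (forall u, P u -> forall e : R, 0 < e -> exists r : R, forall y, r < `|y| ->
     `|iter (2 * n + m)%N rlap u y| < e) ->
  (forall (a : R) u w, P u -> P w -> s (a *: u + w) = a * s u + s w) ->
  (forall u (K : R), P u -> (forall x, `|iter m rlap u x| <= K) -> `|s u| <= C * K) ->
  exists f : Rn -> R, [/\ continuous f,
    mu.-integrable setT (EFin \o (fun t => f (row_of_tuple t))),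
    (\int[mu]_t `|(f (row_of_tuple t))%:E| <= (C * 9 ^+ n)%:E)%E &
    forall u, P u -> s u =
      \int[mu]_t (f (row_of_tuple t) * iter (2 * n + m)%N rlap u (row_of_tuple t))].
Proof.
move=> C0 P0 Plin Pb Pv slin sC; pose T u := conv (iter (2 * n + m)%N rlap u).
(* The graph of T u |-> s u; it is functional because s u is bounded by the
   norm of T u. *)
pose A := [set p | exists2 u, P u & p = (T u, s u)].
have bT u : P u -> bounded_derivs (iter (2 * n + m)%N rlap u).
  by move=> /Pb; exact: bounded_derivs_iter_lap.
have bA : bounded_linear_graph (C * 9 ^+ n) A.
  split.
  - move=> a _ _ [u Pu ->] [w Pw ->]; exists (a *: u + w); first exact: Plin.
    rewrite /= slin// /T iter_lap_lin; try exact/bounded_derivs_smooth/Pb.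
    by rewrite conv_lin_derivs//; exact: bT.
  - move=> _ [u Pu ->]; have bu := bT u Pu.
    have [K _ uK] := bounded_derivsP [::] bu; exists K.
    exact: conv_bound_derivs.
  - move=> _ K [u Pu ->] /= uK; rewrite -mulrA; apply: sC => //.
    apply: conv_lap_bound; first exact/bounded_derivs_iter_lap/Pb.
    by move=> x; rewrite -iterD; exact: uK.
have A0 : A (0, 0) by apply: (graph_zero bA (p := (T 0, s 0))); exists 0.
have [L [Llin Lb LA]] := hahn_banach_bounded_fun bA A0.
have C9 : 0 <= C * 9 ^+ n by rewrite mulr_ge0// exprn_ge0.
have [if_ fC] := density_integrable C9 Llin Lb.
exists (density L); split => //; first exact: density_continuous Llin Lb.
move=> u Pu; have bu := bT u Pu; have [K _ uK] := bounded_derivsP [::] bu.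
have [M M0 uM] := bounded_derivs_lipschitz bu.
rewrite (density_pairing C9 Llin Lb M0 uK uM (Pv u Pu)).
by apply/esym; apply: (LA (T u, s u)); exists u.
Qed.

End riemann_sums.

(** * Complex-valued functions *)

Section complex_norm.
Variable R : realType.
Local Notation C := (R[i]^o).
Implicit Types z w : C.

Lemma norm_normc z : `|z| = (normc z)%:C%C.
Proof. by []. Qed.

Lemma normc_ge0 z : 0 <= normc z.
Proof. by case: z => a b; exact: sqrtr_ge0. Qed.

Lemma normcD_le z w : normc (z + w) <= normc z + normc w.
Proof. exact: le_normcD. Qed.

Lemma normcB_le z w : normc (z - w) <= normc z + normc w.
Proof. by apply: le_trans (normcD_le _ _) _; rewrite normcN. Qed.

Lemma normcBC z w : normc (z - w) = normc (w - z).
Proof. by rewrite -normcN opprB. Qed.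

Lemma normc_Re z : `|complex.Re z| <= normc z.
Proof.
case: z => a b /=; rewrite -sqrtr_sqr ler_sqrt ?lerDl ?sqr_ge0//.
by rewrite addr_ge0 ?sqr_ge0.
Qed.

Lemma normc_Im z : `|complex.Im z| <= normc z.
Proof.
case: z => a b /=; rewrite -sqrtr_sqr ler_sqrt ?lerDr ?sqr_ge0//.
by rewrite addr_ge0 ?sqr_ge0.
Qed.

Lemma normc_ReIm z : normc z <= `|complex.Re z| + `|complex.Im z|.
Proof.
case: z => a b /=; rewrite -[leRHS]ger0_norm ?addr_ge0// -sqrtr_sqr ler_sqrt ?sqr_ge0//.
rewrite sqrrD !real_normK ?num_real// lerD2r lerDl mulrn_wge0//.
Qed.

Lemma normc_real (a : R) : normc (a%:C%C) = `|a|.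
Proof. by rewrite /= expr0n /= addr0 sqrtr_sqr. Qed.

Lemma complex_eq z w : complex.Re z = complex.Re w ->
  complex.Im z = complex.Im w -> z = w.
Proof. by case: z w => [? ?] [? ?] /= -> ->. Qed.

Lemma gt0_real_complex (e : R[i]) : 0 < e -> exists2 d : R, 0 < d & e = d%:C%C.
Proof.
case: e => a b; rewrite ltcE /= => /andP[/eqP b0 a0]; exists a => //.
by rewrite b0.
Qed.

Lemma cvg_normcP (T : Type) (F : set_system T) {FF : Filter F} (f : T -> C) z :
  f @ F --> z <-> forall e : R, 0 < e -> \forall t \near F, normc (z - f t) < e.
Proof.
split=> [/cvgrPdist_lt h e e0|h].
  have /h : 0 < e%:C%C by rewrite ltcR.
  by apply: filterS => t; rewrite norm_normc ltcR.
apply/cvgrPdist_lt => _ /gt0_real_complex[d d0 ->].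
by apply: filterS (h d d0) => t; rewrite norm_normc ltcR.
Qed.

Lemma continuous_ReIm (T : topologicalType) (f : T -> C) :
  continuous f <-> continuous (fun t => complex.Re (f t)) /\
                   continuous (fun t => complex.Im (f t)).
Proof.
split=> [cf|[cr ci] x].
  split=> x; apply/cvgrPdist_lt => e e0.
    apply: filterS ((cvg_normcP f (f x)).1 (cf x) e e0) => t.
    by apply: le_lt_trans; apply: le_trans (normc_Re _); rewrite raddfB.
  apply: filterS ((cvg_normcP f (f x)).1 (cf x) e e0) => t.
  by apply: le_lt_trans; apply: le_trans (normc_Im _); rewrite raddfB.
apply/cvg_normcP => e e0; have e2 : 0 < e / 2 by rewrite divr_gt0.
have /cvgrPdist_lt/(_ _ e2) h1 := cr x; have /cvgrPdist_lt/(_ _ e2) h2 := ci x.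
apply: filterS2 h1 h2 => t t1 t2; apply: le_lt_trans (normc_ReIm _) _.
by rewrite [ltRHS]splitr !raddfB ltrD.
Qed.

End complex_norm.

Section complex_derivatives.
Variables (R : realType) (n : nat).
Local Notation Rn := 'rV[R]_n.
Local Notation C := (R[i]^o).
Implicit Types (f g : Rn -> C) (s t : seq 'I_n).

Definition re f : Rn -> R := fun x => complex.Re (f x).
Definition im f : Rn -> R := fun x => complex.Im (f x).

Local Notation D s f := (iter_deriv (@partial R n) s f).
Local Notation rD s u := (iter_deriv (@rpartial R n) s u).
Local Notation lap := (one_minus_laplacian (@partial R n)).
Local Notation rlap := (one_minus_laplacian (@rpartial R n)).

Local Transparent rpartial unit_vec.

Lemma re_partial i f : re (partial i f) = rpartial i (re f).
Proof. by []. Qed.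

Lemma im_partial i f : im (partial i f) = rpartial i (im f).
Proof. by []. Qed.

Lemma re_iter_partial s f : re (D s f) = rD s (re f).
Proof. by elim: s => // i s IH; rewrite !iter_deriv_cons re_partial IH. Qed.

Lemma im_iter_partial s f : im (D s f) = rD s (im f).
Proof. by elim: s => // i s IH; rewrite !iter_deriv_cons im_partial IH. Qed.

(** All complex notions are reduced to the real and imaginary parts. *)
Lemma smoothE f : smooth f <-> rsmooth (re f) /\ rsmooth (im f).
Proof.
split=> [sf|[sr si] s].
  split; split=> s; have [/continuous_ReIm[cr ci] d] := sf s.
    rewrite -re_iter_partial; split => // i x.
    by have [] := d i x.
  rewrite -im_iter_partial; split => // i x.
  by have [] := d i x.
have [cr dr] := rsmoothP s sr; have [ci di] := rsmoothP s si.
rewrite -re_iter_partial in cr dr; rewrite -im_iter_partial in ci di.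
split; first by apply/continuous_ReIm.
by move=> i x; split; [exact: dr|exact: di].
Qed.

Local Opaque rpartial unit_vec.

Lemma fct_complex_eq f g : re f = re g -> im f = im g -> f = g.
Proof.
move=> rfg ifg; apply/funext => x; apply: complex_eq.
  exact: (congr1 (fun u : Rn -> R => u x) rfg).
exact: (congr1 (fun u : Rn -> R => u x) ifg).
Qed.

Lemma iter_partial_perm f s t : smooth f -> perm_eq s t -> D s f = D t f.
Proof.
move=> /smoothE[sr si] st; apply: fct_complex_eq.
  by rewrite !re_iter_partial; exact: iter_rpartial_perm.
by rewrite !im_iter_partial; exact: iter_rpartial_perm.
Qed.

Lemma iter_partialC f s t : smooth f -> D s (D t f) = D t (D s f).
Proof.
move=> sf; rewrite -!iter_deriv_cat; apply: iter_partial_perm => //.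
by rewrite perm_catC.
Qed.

Lemma multi_derivE f a : multi_deriv (@partial R n) a f = D (mi_seq a) f.
Proof. by []. Qed.

Lemma multi_deriv_of f s : smooth f -> D s f = multi_deriv (@partial R n) (mi_of s) f.
Proof. by move=> sf; rewrite multi_derivE; apply: iter_partial_perm => //; exact: perm_mi_of. Qed.

Lemma smooth_iter f s : smooth f -> smooth (D s f).
Proof. by move=> sf t; rewrite -iter_deriv_cat. Qed.

Lemma smooth_partial f i : smooth f -> smooth (partial i f).
Proof. exact: (@smooth_iter f [:: i]). Qed.

Lemma re_sum (I : Type) (r : seq I) (F : I -> Rn -> C) :
  re (\sum_(k <- r) F k) = \sum_(k <- r) re (F k).
Proof.
apply/funext => x; rewrite /re !fct_sumE; exact: raddf_sum.
Qed.

Lemma im_sum (I : Type) (r : seq I) (F : I -> Rn -> C) :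
  im (\sum_(k <- r) F k) = \sum_(k <- r) im (F k).
Proof.
apply/funext => x; rewrite /im !fct_sumE; exact: raddf_sum.
Qed.

Lemma re_lap f : re (lap f) = rlap (re f).
Proof.
apply/funext => x; rewrite rlapE /one_minus_laplacian.
rewrite -[LHS]/(complex.Re (f x - (\sum_i partial i (partial i f)) x)).
rewrite raddfB; congr (_ - _).
rewrite -[LHS]/(re (\sum_i partial i (partial i f)) x) re_sum fct_sumE.
by apply: eq_bigr => i _; rewrite !re_partial.
Qed.

Lemma im_lap f : im (lap f) = rlap (im f).
Proof.
apply/funext => x; rewrite rlapE /one_minus_laplacian.
rewrite -[LHS]/(complex.Im (f x - (\sum_i partial i (partial i f)) x)).
rewrite raddfB; congr (_ - _).
rewrite -[LHS]/(im (\sum_i partial i (partial i f)) x) im_sum fct_sumE.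
by apply: eq_bigr => i _; rewrite !im_partial.
Qed.

Lemma re_iter_lap m f : re (iter m lap f) = iter m rlap (re f).
Proof. by elim: m => // m IH; rewrite !iterS re_lap IH. Qed.

Lemma im_iter_lap m f : im (iter m lap f) = iter m rlap (im f).
Proof. by elim: m => // m IH; rewrite !iterS im_lap IH. Qed.

Lemma smooth_iter_lap m f : smooth f -> smooth (iter m lap f).
Proof.
move=> /smoothE[sr si]; apply/smoothE; rewrite re_iter_lap im_iter_lap.
by split; exact: rsmooth_iter_lap.
Qed.

Lemma lap_complexE f x : lap f x = f x - \sum_i partial i (partial i f) x.
Proof. by rewrite /one_minus_laplacian !fctE fct_sumE. Qed.

Lemma lap_complex_lin (a : R[i]) f g : smooth f -> smooth g ->
  lap (a *: f + g) = a *: lap f + lap g.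
Proof.
move=> sf sg; apply/funext => x.
have E i : partial i (partial i (a *: f + g)) x =
    (a : C) * partial i (partial i f) x + partial i (partial i g) x.
  have := iter_partial_lin a [:: i; i] sf sg.
  by move=> /(congr1 (fun h : Rn -> C => h x)).
rewrite -[RHS]/((a : C) * lap f x + lap g x) !lap_complexE.
exact: sum_comb.
Qed.

Lemma iter_lap_complex_lin m (a : R[i]) f g : smooth f -> smooth g ->
  iter m lap (a *: f + g) = a *: iter m lap f + iter m lap g.
Proof.
elim: m f g => // m IH f g sf sg; rewrite !iterSr.
rewrite -IH; try exact: (smooth_iter_lap 1).
by rewrite lap_complex_lin.
Qed.

(** Over all words of length at most m, instead of multi-indices: such a bound
    passes to derivatives by mere concatenation. *)
Definition derivs_le m f (M : R) := forall s x, (size s <= m)%N -> normc (D s f x) <= M.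

Lemma sup_norm_le f (M : R) : (sup_norm f <= M%:E)%E <-> forall x, normc (f x) <= M.
Proof.
split=> [h x|h].
  by rewrite -lee_fin; apply: le_trans h; apply: ereal_sup_ubound; exists x.
by apply: ge_ereal_sup => _ [x _ <-]; rewrite lee_fin.
Qed.

Lemma Cm_norm_le m f (M : R) : smooth f ->
  (Cm_norm m f <= M%:E)%E <-> derivs_le m f M.
Proof.
move=> sf; split=> [h s x sm|h].
  rewrite (multi_deriv_of s sf); move: x; apply/sup_norm_le; apply: le_trans h.
  by apply: ereal_sup_ubound; exists (mi_of s) => //=; rewrite mi_order_of.
apply: ge_ereal_sup => _ [a /= am <-]; apply/sup_norm_le => x.
by apply: h; rewrite size_mi_seq.
Qed.

Lemma bessel_norm_le m f (M : R) :
  (bessel_norm m f <= M%:E)%E <-> forall x, normc (iter m lap f x) <= M.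
Proof. exact: sup_norm_le. Qed.

Lemma derivs_le_re m f M s x : derivs_le m f M -> (size s <= m)%N ->
  `|rD s (re f) x| <= M.
Proof.
by move=> h sm; apply: le_trans (h s x sm); rewrite -re_iter_partial; exact: normc_Re.
Qed.

Lemma derivs_le_im m f M s x : derivs_le m f M -> (size s <= m)%N ->
  `|rD s (im f) x| <= M.
Proof.
by move=> h sm; apply: le_trans (h s x sm); rewrite -im_iter_partial; exact: normc_Im.
Qed.

Lemma iter_rlap_bound m u (M : R) : rsmooth u ->
  (forall s x, (size s <= 2 * m)%N -> `|rD s u x| <= M) ->
  forall x, `|iter m rlap u x| <= (1 + n%:R) ^+ m * M.
Proof.
elim: m u M => [|m IH] u M su uM x.
  by rewrite expr0 mul1r; exact: (uM [::]).
rewrite iterSr exprSr -mulrA; apply: IH; first exact: rsmooth_lap.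
move=> s y sm; rewrite iter_rpartial_lap// rlapE.
apply: le_trans (ler_normB _ _) _; rewrite mulrDl mul1r; apply: lerD.
  by apply: uM; rewrite mulnS (leq_trans sm)// leq_addl.
apply: le_trans (ler_norm_sum _ _ _) _.
apply: (@le_trans _ _ (\sum_(i < n) M)).
  apply: ler_sum => i _; apply: (uM [:: i, i & s]).
  by rewrite /= mulnS.
by rewrite sumr_const card_ord mulr_natl.
Qed.

(** Expanding the m-th power of 1 - Laplacian gives at most (1 + n)^m derivatives. *)
Lemma derivs_le_bessel m f (M : R) : smooth f -> derivs_le (2 * m) f M ->
  forall x, normc (iter m lap f x) <= 2 * (1 + n%:R) ^+ m * M.
Proof.
move=> /smoothE[sr si] h x; apply: le_trans (normc_ReIm _) _.
have h1 : `|re (iter m lap f) x| <= (1 + n%:R) ^+ m * M.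
  rewrite re_iter_lap; apply: iter_rlap_bound => // s y; exact: derivs_le_re.
have h2 : `|im (iter m lap f) x| <= (1 + n%:R) ^+ m * M.
  rewrite im_iter_lap; apply: iter_rlap_bound => // s y; exact: derivs_le_im.
by rewrite -mulrA mulrDl mul1r lerD.
Qed.

Definition all_derivs_bounded f := smooth f /\
  forall s, exists M : R, forall x, normc (D s f x) <= M.

Lemma all_derivs_bounded_re f : all_derivs_bounded f -> bounded_derivs (re f).
Proof.
move=> [/smoothE[sr _] bf]; split=> // s; have [M fM] := bf s; exists M => x.
by rewrite -re_iter_partial; apply: le_trans (normc_Re _) (fM x).
Qed.

Lemma all_derivs_bounded_im f : all_derivs_bounded f -> bounded_derivs (im f).
Proof.
move=> [/smoothE[_ si] bf]; split=> // s; have [M fM] := bf s; exists M => x.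
by rewrite -im_iter_partial; apply: le_trans (normc_Im _) (fM x).
Qed.

Lemma bessel_derivs_le m f (M : R) : all_derivs_bounded f ->
  (forall x, normc (iter m lap f x) <= M) -> derivs_le m f (2 * 2 ^+ m * M).
Proof.
move=> bf fM s x sm; have M0 : 0 <= M by apply: le_trans (fM 0); exact: normc_ge0.
have bound u : bounded_derivs u -> (forall x, `|iter m rlap u x| <= M) ->
    `|rD s u x| <= 2 ^+ m * M.
  move=> bu uM; have := iter_deriv_lap_bound bu (iter_lap_mono bu sm uM) x.
  move=> /le_trans; apply; apply: ler_wpM2r => //.
  by apply: ler_weXn2l => //; rewrite ler1n.
apply: le_trans (normc_ReIm _) _; rewrite -mulrA mulrDl mul1r; apply: lerD.
  rewrite -/(re _ x) re_iter_partial; apply: bound; first exact: all_derivs_bounded_re.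
  by move=> y; rewrite -re_iter_lap; apply: le_trans (normc_Re _) (fM y).
rewrite -/(im _ x) im_iter_partial; apply: bound; first exact: all_derivs_bounded_im.
by move=> y; rewrite -im_iter_lap; apply: le_trans (normc_Im _) (fM y).
Qed.

Lemma derivs_le_exists m f : all_derivs_bounded f -> exists2 M, 0 <= M & derivs_le m f M.
Proof.
elim: m f => [|m IH] f [sf bf].
  have [M fM] := bf [::]; exists M; first exact: le_trans (normc_ge0 _) (fM 0).
  by move=> s x; rewrite leqn0 size_eq0 => /eqP ->; exact: fM.
have [M0 M00 fM0] := IH f (conj sf bf).
have H i : exists M, 0 <= M /\ derivs_le m (partial i f) M.
  have [|M ? ?] := IH (partial i f); last by exists M.
  split; first exact: smooth_partial.
  move=> s; have [M fM] := bf (s ++ [:: i]); exists M => x.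
  by rewrite -[partial i f]/(D [:: i] f) -iter_deriv_cat.
have [M MP] := choice H.
have sM0 : 0 <= \sum_i M i by apply: sumr_ge0 => i _; case: (MP i).
exists (M0 + \sum_i M i); first exact: addr_ge0.
move=> s x; case/lastP: s => [|s i] sm.
  by apply: le_trans (fM0 [::] x _) _; rewrite ?lerDl.
rewrite -cats1 iter_deriv_cat; apply: le_trans ((MP i).2 s x _) _.
  by rewrite size_rcons ltnS in sm.
rewrite (bigD1 i)//= addrCA lerDl addr_ge0// sumr_ge0// => j _.
by case: (MP j).
Qed.

Lemma derivs_le_lin m f g (a : R[i]) (M N : R) : smooth f -> smooth g ->
  derivs_le m f M -> derivs_le m g N -> derivs_le m (a *: f + g) (normc a * M + N).
Proof.
move=> sf sg fM gN s x sm; rewrite iter_partial_lin//.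
apply: le_trans (normc_lin _ _ _) _; apply: lerD; last exact: gN.
by apply: ler_wpM2l; [exact: (@normc_ge0 R a)|exact: fM].
Qed.

Lemma derivs_leW m k f (M N : R) : (m <= k)%N -> M <= N ->
  derivs_le k f M -> derivs_le m f N.
Proof. by move=> mk MN h s x sm; apply: le_trans (h s x (leq_trans sm mk)) MN. Qed.

End complex_derivatives.

(** * The spaces of test functions *)

Section test_spaces.
Variables (R : realType) (n : nat).
Local Notation Rn := 'rV[R]_n.
Local Notation C := (R[i]^o).
Local Notation D s f := (iter_deriv (@partial R n) s f).

Lemma DLinf_smooth (phi : DLinf R n) : smooth phi.
Proof. by case: phi => f /= /asboolP[]. Qed.

Lemma DLinf_bounded (phi : DLinf R n) : all_derivs_bounded phi.
Proof.
split; first exact: DLinf_smooth; move=> s; rewrite (multi_deriv_of s (DLinf_smooth phi)).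
by case: phi => f /= /asboolP[_]; apply.
Qed.

Lemma Bdot_smooth (phi : Bdot R n) : smooth phi.
Proof. by case: phi => f /= /asboolP[]. Qed.

Lemma Bdot_vanishes (phi : Bdot R n) s : vanishes_at_infinity (D s phi).
Proof.
rewrite (multi_deriv_of s (Bdot_smooth phi)).
by case: phi => f /= /asboolP[_]; apply.
Qed.

Lemma vanishes_bounded (f : Rn -> C) : continuous f -> vanishes_at_infinity f ->
  bounded_fct f.
Proof.
move=> /continuous_ReIm[cr ci] vf; have [r fr] := vf 1 ltr01.
have bc (u : Rn -> R) : continuous u ->
    exists M : R, forall x : Rn, `|x| <= r -> `|u x| <= M.
  move=> cu; have : compact (u @` [set x : Rn | `|x| <= r]).
    apply: continuous_compact; first exact: continuous_subspaceT.
    exact: compact_ball_closed.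
  move=> /compact_bounded[M [_ MP]]; exists (M + 1) => x xr.
  by apply: MP; [rewrite ltrDl|exists x].
have [M1 h1] := bc _ cr; have [M2 h2] := bc _ ci.
exists (Num.max 1 (M1 + M2)) => x; have [xr|xr] := leP `|x| r.
  by apply: le_trans (normc_ReIm _) _; rewrite le_max lerD ?orbT// ?h1 ?h2.
by apply: ltW; apply: lt_le_trans (fr x xr) _; rewrite le_max lexx.
Qed.

Lemma Bdot_bounded (phi : Bdot R n) : all_derivs_bounded phi.
Proof.
split; first exact: Bdot_smooth; move=> s; apply: vanishes_bounded.
  by have [] := Bdot_smooth phi s.
exact: Bdot_vanishes.
Qed.

Definition bdot_of (f : Rn -> C) (sf : smooth f)
    (vf : forall s, vanishes_at_infinity (D s f)) : Bdot R n :=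
  MkBdot (asboolT (conj sf (fun a => vf (mi_seq a)))).

End test_spaces.

(** * Seminorms and continuous linear forms *)

Section limits_of_smooth_functions.
Variables (R : realType) (n : nat).
Local Notation Rn := 'rV[R]_n.
Local Notation rD s u := (iter_deriv (@rpartial R n) s u).

(** Bounds on all derivatives pass to pointwise limits: by Taylor's formula the
    difference quotients converge at a rate that is uniform along the sequence. *)
Lemma limit_bounded_derivs (u : nat -> Rn -> R) (g : seq 'I_n -> Rn -> R) :
  (forall k, rsmooth (u k)) ->
  (forall s, exists M : R, \forall k \near \oo, forall x, `|rD s (u k) x| <= M) ->
  (forall s x, rD s (u k) x @[k --> \oo] --> g s x) ->
  bounded_derivs (g [::]) /\ forall s, rD s (g [::]) = g s.
Proof.
move=> su bu cv.
have gM s : exists M : R, forall x, `|g s x| <= M.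
  have [M uM] := bu s; exists M => x; apply: (cvgr_to_le (cvg_norm (cv s x))).
  by apply: filterS uM => k; apply.
have dg s i x : is_derive x (unit_vec R i) (g s) (g (i :: s) x).
  have [M uM] := bu [:: i, i & s]; apply: (@is_derive_quadratic _ _ _ _ _ _ M) => h.
  have cv1 : rD s (u k) (x + h *: unit_vec R i) - rD s (u k) x - h * rD (i :: s) (u k) x
      @[k --> \oo] --> g s (x + h *: unit_vec R i) - g s x - h * g (i :: s) x.
    by apply: cvgB; [apply: cvgB; exact: cv|apply: cvgMl_tmp; exact: cv].
  apply: (cvgr_to_le (cvg_norm cv1)); apply: filterS uM => k uM.
  by apply: taylor_bound => //; exact: rsmooth_iter.
have cg s : continuous (g s).
  have H i : exists M : R, 0 <= M /\ \forall k \near \oo, forall x, `|rD (i :: s) (u k) x| <= M.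
    have [M uM] := bu (i :: s); exists `|M|; split => //; apply: filterS uM => k uM x.
    exact: le_trans (uM x) (ler_norm _).
  have [M MP] := choice H.
  have Lip x y : `|g s x - g s y| <= n%:R * (\sum_i M i) * `|x - y|.
    apply: (cvgr_to_le (cvg_norm (cvgB (cv s x) (cv s y)))).
    have : \forall k \near \oo, forall i x, `|rD (i :: s) (u k) x| <= M i.
      by apply: filter_forall => i; exact: (MP i).2.
    apply: filterS => k uM.
    have := lipschitz_of_partials (rsmooth_iter s (su k)) _ y (x - y).
    rewrite subrKC; apply => i z; apply: le_trans (uM i z) _.
    by rewrite (bigD1 i)//= lerDl sumr_ge0// => j _; case: (MP j).
  exact: lipschitz_fun_continuous Lip.
have E s : rD s (g [::]) = g s.
  elim: s => // i s IH; rewrite iter_deriv_cons IH; apply/funext => x.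
  by have [_ <-] := dg s i x.
split=> //; split; last by move=> s; rewrite E.
split=> s; rewrite E; split=> // i x; by case: (dg s i x).
Qed.

End limits_of_smooth_functions.

Section Cm.
Variables (R : realType) (n : nat).
Local Notation Rn := 'rV[R]_n.
Local Notation C := (R[i]^o).
Implicit Types f g : Rn -> C.

(** The seminorm as a real number; it is finite on functions with bounded
    derivatives (cmE). *)
Definition cm m f : R := fine (Cm_norm m f).

Lemma Cm_norm_ge0 m f : (0 <= Cm_norm m f)%E.
Proof.
apply: (@le_trans _ _ (normc (f 0))%:E); first by rewrite lee_fin normc_ge0.
apply: (@le_trans _ _ (sup_norm f)).
  by apply: ereal_sup_ubound; exists 0.
apply: ereal_sup_ubound; exists (mi_of [::]).
  by rewrite /= mi_order_of.
rewrite multi_derivE; have := perm_mi_of ([::] : seq 'I_n).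
by rewrite perm_sym => /perm_nilP ->.
Qed.

Lemma cmE m f : all_derivs_bounded f -> Cm_norm m f = (cm m f)%:E.
Proof.
move=> bf; have [M _ /(Cm_norm_le m M bf.1) fM] := derivs_le_exists m bf.
rewrite /cm fineK// ge0_fin_numE ?Cm_norm_ge0//.
exact: le_lt_trans fM (ltry _).
Qed.

Lemma cm_ge0 m f : 0 <= cm m f.
Proof. by rewrite fine_ge0// Cm_norm_ge0. Qed.

Lemma cm_le m f M : all_derivs_bounded f -> cm m f <= M <-> derivs_le m f M.
Proof. by move=> bf; rewrite -Cm_norm_le ?cmE// ?lee_fin//; case: bf. Qed.

Lemma cm_derivs m f : all_derivs_bounded f -> derivs_le m f (cm m f).
Proof. by move=> bf; apply/cm_le. Qed.

Lemma all_derivs_bounded_lin (a : R[i]) f g : all_derivs_bounded f ->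
  all_derivs_bounded g -> all_derivs_bounded (a *: f + g).
Proof.
move=> [sf bf] [sg bg]; split; first exact: smooth_lin.
move=> s; have [M fM] := bf s; have [N gN] := bg s.
exists (normc (a : C) * M + N) => x; rewrite iter_partial_lin//.
apply: le_trans (normc_lin _ _ _) _; apply: lerD; last exact: gN.
by apply: ler_wpM2l (fM x); exact: (@normc_ge0 R a).
Qed.

Lemma cm_lin m (a : R[i]) f g : all_derivs_bounded f -> all_derivs_bounded g ->
  cm m (a *: f + g) <= normc (a : C) * cm m f + cm m g.
Proof.
move=> bf bg; apply/cm_le; first exact: all_derivs_bounded_lin.
by apply: derivs_le_lin; try exact: cm_derivs; [case: bf|case: bg].
Qed.

Lemma cm_mono m k f : all_derivs_bounded f -> (m <= k)%N -> cm m f <= cm k f.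
Proof.
move=> bf mk; apply/cm_le => //; apply: derivs_leW mk (lexx _) _.
exact: cm_derivs.
Qed.

End Cm.

Section Bdot_topology.
Variables (R : realType) (n : nat).
Local Notation C := (R[i]^o).
Implicit Types (phi psi : Bdot R n) (m : nat).


Lemma bcm_lin m (a : R[i]) phi psi :
  cm m (a *: phi + psi : Bdot R n) <= normc (a : C) * cm m phi + cm m psi.
Proof. by apply: cm_lin; exact: Bdot_bounded. Qed.

Lemma bcmD m phi psi : cm m (phi + psi : Bdot R n) <= cm m phi + cm m psi.
Proof. by have := bcm_lin m 1 phi psi; rewrite scale1r normc1 mul1r. Qed.

Lemma bcmZ m (a : R[i]) phi : cm m (a *: phi : Bdot R n) <= normc (a : C) * cm m phi.
Proof.
have := bcm_lin m a phi 0; rewrite addr0.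
suff -> : cm m (0 : Bdot R n) = 0 by rewrite addr0.
apply/eqP; rewrite eq_le cm_ge0 andbT; apply/cm_le; first exact: Bdot_bounded.
move=> s x _.
by rewrite (_ : Bdot_val 0 = 0)// iter_partial0 normc0.
Qed.

Lemma bcmB m phi psi : cm m (phi - psi : Bdot R n) <= cm m phi + cm m psi.
Proof.
apply: le_trans (bcmD _ _ _) _; rewrite lerD2l -scaleN1r.
by apply: le_trans (bcmZ _ _ _) _; rewrite normcN normc1 mul1r.
Qed.

Lemma finite_set_nat_bound (F : set nat) : finite_set F ->
  exists m, forall i, F i -> (i <= m)%N.
Proof.
move=> /finite_seqP[s ->]; exists (\max_(i <- s) i)%N => i is_.
by rewrite (big_rem i) //= leq_maxl.
Qed.

Lemma open_BdotP (U : set (Bdot R n)) : open U <->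
  forall phi, U phi -> exists m (e : R), 0 < e /\ forall psi, cm m (psi - phi : Bdot R n) < e -> U psi.
Proof.
split=> [oU phi Up|H].
  have [F [finF _ [e e0 eU]]] : exists F : set nat, [/\ finite_set F, F `<=` setT &
     exists2 e : R, 0 < e & forall psi : Bdot R n, (forall i, F i -> (Cm_norm i (Bdot_val (psi - phi)%R) < e%:E)%E) -> U psi].
    exact: oU.
  have [m Fm] := finite_set_nat_bound finF; exists m, e; split=> // psi pe.
  apply: eU => i Fi; rewrite cmE; last exact: Bdot_bounded.
  rewrite lte_fin; apply: le_lt_trans pe; apply: cm_mono (Fm i Fi); exact: Bdot_bounded.
suff : seminorm_topology setT (fun m (f : Bdot R n) => Cm_norm m f) U by [].
move=> phi Up; have [m [e [e0 eU]]] := H phi Up.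
exists [set m]; split => //; exists e => // psi /(_ m erefl).
rewrite cmE; last exact: Bdot_bounded.
by rewrite lte_fin; exact: eU.
Qed.

(** The seminorms increase with m, so that a single one suffices. *)
Lemma nbhs_BdotP phi (U : set (Bdot R n)) : nbhs phi U <->
  exists m (e : R), 0 < e /\ forall psi, cm m (psi - phi : Bdot R n) < e -> U psi.
Proof.
rewrite nbhsE; split=> [[V [oV Vp] VU]|[m [e [e0 eU]]]].
  have [m [e [e0 eV]]] := (open_BdotP V).1 oV phi Vp.
  by exists m, e; split=> // psi /eV /VU.
exists [set psi | cm m (psi - phi : Bdot R n) < e] => //; split.
  apply/open_BdotP => psi /= pe.
  exists m, (e - cm m (psi - phi : Bdot R n)); split; first by rewrite subr_gt0.
  move=> chi; rewrite ltrBrDr; apply: le_lt_trans.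
  by have := bcmD m (chi - psi) (psi - phi); rewrite subrKA.
rewrite /= subrr; apply: le_lt_trans e0; have := bcmZ m 0 phi.
by rewrite scale0r normc0 mul0r.
Qed.

Definition seminorm_bounded m (K : R) (S : Bdot R n -> C) :=
  forall phi, normc (S phi) <= K * cm m phi.

Lemma DL1_linear (S : DL1 R n) : linear (S : Bdot R n -> C).
Proof. by case: S => f /= /asboolP[]. Qed.

Lemma DL1_continuous (S : DL1 R n) : continuous (S : Bdot R n -> C).
Proof. by case: S => f /= /asboolP[]. Qed.

Lemma DL1_lin (S : DL1 R n) (a : R[i]) phi psi :
  S (a *: phi + psi) = (a : C) * S phi + S psi.
Proof. exact: DL1_linear. Qed.

Lemma DL1_0 (S : DL1 R n) : S 0 = 0.
Proof.
have := DL1_lin S (-1) 0 0; rewrite scaler0 addr0 mulN1r => ->.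
exact: addNr.
Qed.

Lemma DL1_Z (S : DL1 R n) (a : R[i]) phi : S (a *: phi) = (a : C) * S phi.
Proof. by rewrite -[_ *: _]addr0 DL1_lin DL1_0 addr0. Qed.

Lemma DL1_D (S : DL1 R n) phi psi : S (phi + psi) = S phi + S psi.
Proof. by rewrite -[phi in LHS]scale1r DL1_lin mul1r. Qed.

Lemma DL1_B (S : DL1 R n) phi psi : S (phi - psi) = S phi - S psi.
Proof. by rewrite DL1_D -scaleN1r DL1_Z mulN1r. Qed.

(** The bound is applied to the multiples of phi that lie in the ball. *)
Lemma ball_seminorm_bounded (S : Bdot R n -> C) m (e K : R) : 0 < e -> 0 <= K ->
  (forall (a : R[i]) phi, S (a *: phi) = (a : C) * S phi) ->
  (forall phi, cm m phi < e -> normc (S phi) <= K) -> seminorm_bounded m (K / e) S.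
Proof.
move=> e0 K0 SZ SK phi.
apply/ler_addgt0Pr => d d0.
pose t := cm m phi + e * d / (K + 1).
have K1 : 0 < K + 1 by rewrite ltr_wpDl.
have t0 : 0 < t by rewrite /t ltr_wpDl ?cm_ge0// divr_gt0 ?mulr_gt0.
have et0 : 0 < e / t by rewrite divr_gt0.
have := SK ((e / t)%:C%C *: phi).
rewrite SZ normcM normc_real (gtr0_norm et0).
have -> : cm m ((e / t)%:C%C *: phi : Bdot R n) < e.
  apply: le_lt_trans (bcmZ _ _ _) _; rewrite normc_real (gtr0_norm et0).
  rewrite -mulrA gtr_pMr// mulrC ltr_pdivrMr// mul1r /t ltrDl.
  by rewrite divr_gt0 ?mulr_gt0.
move=> /(_ isT); rewrite -ler_pdivlMl// invf_div => /le_trans; apply.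
rewrite (_ : t / e * K = K / e * cm m phi + d * (K / (K + 1))); last first.
  by rewrite /t; field; rewrite !gt_eqF.
by rewrite lerD2l ler_piMr ?ltW// ltr_pdivrMr// mul1r ltrDl.
Qed.

Lemma DL1_seminorm_bounded (S : DL1 R n) : exists m (K : R), 0 <= K /\ seminorm_bounded m K S.
Proof.
have := @DL1_continuous S 0.
move=> /cvg_normcP/(_ 1 ltr01)/nbhs_BdotP[m [e [e0 eS]]].
exists m, (1 / e); split; first by rewrite divr_ge0 ?ltW.
apply: ball_seminorm_bounded => // [a phi|phi pe]; first exact: DL1_Z.
have := eS phi; rewrite subr0 DL1_0 sub0r normcN => H; exact: ltW (H pe).
Qed.

Lemma seminorm_bounded_continuous (S : Bdot R n -> C) m (K : R) :
  (forall (a : R[i]) phi psi, S (a *: phi + psi) = (a : C) * S phi + S psi) ->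
  seminorm_bounded m K S -> S \in @DL1_pred R n.
Proof.
move=> lS SK; apply/asboolP; split; first exact: lS.
move=> phi; apply/(@cvg_normcP _ _ (nbhs phi) _) => e e0; apply/nbhs_BdotP.
exists m, (e / (`|K| + 1)); have K1 : 0 < `|K| + 1 by rewrite ltr_wpDl.
split; first exact: divr_gt0.
move=> psi; rewrite ltr_pdivlMr// => pe; rewrite normcBC.
have -> : S psi - S phi = S (psi - phi).
  by rewrite (_ : psi - phi = (-1) *: phi + psi) ?lS ?mulN1r 1?addrC// scaleN1r addrC.
apply: le_lt_trans (SK _) _; apply: le_lt_trans pe; rewrite mulrC.
apply: ler_wpM2l; first exact: cm_ge0.
by apply: le_trans (ler_norm _) _; rewrite lerDl.
Qed.

End Bdot_topology.

(** * Uniform boundedness *)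

Section uniform_boundedness.
Variables (R : realType) (n : nat).
Local Notation Rn := 'rV[R]_n.
Local Notation C := (R[i]^o).
Local Notation D s f := (iter_deriv (@partial R n) s f).
Implicit Types (phi psi : Bdot R n) (m : nat).

(** Telescoping in any group with a seminorm, with steps bounded by a sequence
    that at least halves each time. *)
Lemma geometric_telescope (T : zmodType) (p : T -> R) (x : nat -> T) (e : nat -> R) (k d : nat) :
  (forall a b, p (a + b) <= p a + p b) -> p 0 = 0 -> (forall j, 0 <= e j) ->
  (forall j, e j.+1 <= e j / 2) ->
  (forall j, (k <= j)%N -> p (x j.+1 - x j) <= e j) ->
  p (x (k + d)%N - x k) <= 2 * e k.
Proof.
move=> pD p0 e0 eh; elim: d k => [|d IH] k pe.
  by rewrite addn0 subrr p0 mulr_ge0.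
rewrite addnS -addSn -(subrKA (x k.+1)); apply: le_trans (pD _ _) _.
have h1 : p (x (k.+1 + d)%N - x k.+1) <= 2 * e k.+1.
  by apply: IH => j kj; apply: pe; exact: ltnW.
have := eh k; have := pe k (leqnn k); move: h1; lra.
Qed.

Lemma halving_cvg0 (e : nat -> R) : (forall j, 0 <= e j) ->
  (forall j, e j.+1 <= e j / 2) -> e j @[j --> \oo] --> (0 : R).
Proof.
move=> e0 eh; have H j : e j <= e 0%N * 2^-1 ^+ j.
  elim: j => [|j IH]; first by rewrite expr0 mulr1.
  by apply: le_trans (eh j) _; rewrite exprSr mulrA ler_wpM2r.
apply: (@squeeze_cvgr _ _ _ _ (cst 0) (fun j => e 0%N * 2^-1 ^+ j)).
- by apply: nearW => j; rewrite /cst/= e0 H.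
- exact: cvg_cst.
- by apply: cvg_geometric; rewrite ger0_norm ?invr_ge0 ?invf_lt1 ?ltr1n.
Qed.

(** Completeness in the form used below: a sequence whose steps decrease
    geometrically, in seminorms of growing order, has a limit at the expected
    distance in all of them. *)
Lemma Bdot_complete (x : nat -> Bdot R n) (e : nat -> R) (m : nat -> nat) :
  (forall j, 0 <= e j) -> (forall j, e j.+1 <= e j / 2) ->
  (forall j, (m j < m j.+1)%N) ->
  (forall j, cm (m j) (x j.+1 - x j : Bdot R n) <= e j) ->
  exists phi : Bdot R n, forall k, cm (m k) (phi - x k : Bdot R n) <= 4 * e k.
Proof.
move=> e0 eh mm xe; have ecv := halving_cvg0 e0 eh.
have mmono : {homo m : k j / (k <= j)%N}.
  by apply: homo_leq => // [k j l|j]; [exact: leq_trans|exact: ltnW].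
have mk k : (k <= m k)%N.
  by elim: k => // k IH; exact: leq_ltn_trans IH (mm k).
(* The estimate shared by the real and imaginary parts. *)
have tel k d s y : (size s <= m k)%N ->
    normc (D s (x (k + d)%N) y - D s (x k) y) <= 2 * e k.
  move=> sk.
  apply: (geometric_telescope (p := @normc R) (x := fun j => (D s (x j) y : C))) => //.
  - exact: normcD_le.
  - exact: normc0.
  move=> j kj; apply: le_trans (xe j).
  have := @cm_derivs _ _ (m j) _ (Bdot_bounded (x j.+1 - x j)) s y.
  rewrite (_ : Bdot_val (x j.+1 - x j) = (-1) *: Bdot_val (x j) + Bdot_val (x j.+1)).
    rewrite iter_partial_lin; try exact: Bdot_smooth.
    rewrite -[(_ *: _ + _) y]/(-1 * D s (x j) y + D s (x j.+1) y) mulN1r addrC.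
    by apply; apply: leq_trans sk _; exact: mmono.
  by rewrite -[LHS]/(Bdot_val (x j.+1) - Bdot_val (x j)) addrC scaleN1r.
have part (pr : (Rn -> C) -> Rn -> R) :
    (forall s f, pr (D s f) = iter_deriv (@rpartial R n) s (pr f)) ->
    (forall f, smooth f -> rsmooth (pr f)) ->
    (forall f y, `|pr f y| <= normc (f y)) ->
    (forall f g y, `|pr f y - pr g y| <= normc (f y - g y)) ->
    exists2 u, rsmooth u & forall k s y, (size s <= m k)%N ->
      `|iter_deriv (@rpartial R n) s u y - iter_deriv (@rpartial R n) s (pr (x k)) y| <= 2 * e k.
  move=> prD prS prL prN.
  pose v s y k := iter_deriv (@rpartial R n) s (pr (x k)) y.
  have vtel k d s y : (size s <= m k)%N -> `|v s y (k + d)%N - v s y k| <= 2 * e k.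
    move=> sk; rewrite /v -!prD; apply: le_trans (prN _ _ _) _; exact: tel.
  have cv s y : cvg (v s y k @[k --> \oo]).
    apply/cauchy_cvgP/cauchy_exP => d d0.
    have d2 : 0 < d / 2 by rewrite divr_gt0.
    have /cvgrPdist_lt/(_ _ d2) [N _ HN] := ecv.
    pose K := maxn N (size s).
    exists (v s y K); exists K => // j /= Kj.
    rewrite -ball_normE /ball_ /= -(subnKC Kj) distrC.
    apply: le_lt_trans (vtel _ _ _ _ _) _; first exact: leq_trans (leq_maxr N _) (mk K).
    have := HN K (leq_maxl _ _); rewrite sub0r normrN ger0_norm//; lra.
  pose g s y := lim (v s y k @[k --> \oo]).
  have near_le k s y : (size s <= m k)%N -> `|g s y - v s y k| <= 2 * e k.
    move=> sk; apply: (cvgr_to_le (cvg_norm (cvgB (cv s y) (cvg_cst (v s y k))))).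
    exists k => // j /= kj; rewrite -(subnKC kj); exact: vtel.
  have [|s|s y|bg E] := @limit_bounded_derivs _ _ (fun k => pr (x k)) g.
  - by move=> k; apply: prS; exact: Bdot_smooth.
  - have [M HM] := (Bdot_bounded (x (size s))).2 s.
    have uN y : `|v s y (size s)| <= M.
      by rewrite /v -prD; exact: le_trans (prL _ _) (HM y).
    exists (M + 2 * e (size s)); exists (size s) => // k /= sk y.
    rewrite -/(v s y k) -(subnKC sk) -[v _ _ _](subrK (v s y (size s))).
    rewrite addrC; apply: le_trans (ler_normD _ _) _; apply: lerD => //.
    exact: vtel.
  - exact: cv.
  exists (g [::]); first by case: bg.
  by move=> k s y sk; rewrite E; exact: near_le.
have re_s (f : Rn -> C) : smooth f -> rsmooth (re f) by move=> /smoothE[].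
have im_s (f : Rn -> C) : smooth f -> rsmooth (im f) by move=> /smoothE[].
have re_b (f g : Rn -> C) y : complex.Re (f y - g y) = re f y - re g y.
  by rewrite raddfB.
have im_b (f g : Rn -> C) y : complex.Im (f y - g y) = im f y - im g y.
  by rewrite raddfB.
have re_n (f g : Rn -> C) y : `|re f y - re g y| <= normc (f y - g y).
  by rewrite -re_b; exact: normc_Re.
have im_n (f g : Rn -> C) y : `|im f y - im g y| <= normc (f y - g y).
  by rewrite -im_b; exact: normc_Im.
have [u su ue] := part (@re R n) (@re_iter_partial R n) re_s
  (fun f y => normc_Re (f y)) re_n.
have [w sw we] := part (@im R n) (@im_iter_partial R n) im_s
  (fun f y => normc_Im (f y)) im_n.
pose f y : C := (u y +i* w y)%C.
have sf : smooth f by apply/smoothE.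
have near_f k s y : (size s <= m k)%N -> normc (D s f y - D s (x k) y) <= 4 * e k.
  move=> sk; apply: le_trans (normc_ReIm _) _; rewrite re_b im_b.
  rewrite !re_iter_partial !im_iter_partial.
  by have := ue k s y sk; have := we k s y sk; rewrite -[re f]/u -[im f]/w; lra.
have vf s : vanishes_at_infinity (D s f).
  move=> d d0; have d8 : 0 < d / 8 by rewrite divr_gt0.
  have /cvgrPdist_lt/(_ _ d8) [N _ HN] := ecv.
  pose K := maxn N (size s).
  have [r xr] := Bdot_vanishes (x K) s (divr_gt0 d0 (ltr0n _ 2)).
  exists r => y /xr xy; rewrite -[D s f y](subrK (D s (x K) y)).
  apply: le_lt_trans (normcD_le _ _) _; rewrite [ltRHS]splitr; apply: ler_ltD => //.
  apply: le_trans (near_f K s y _) _; first exact: leq_trans (leq_maxr N _) (mk K).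
  have := HN K (leq_maxl _ _); rewrite sub0r normrN ger0_norm//; lra.
exists (bdot_of sf vf) => k; apply/cm_le; first exact: Bdot_bounded.
move=> s y sk; apply: le_trans (near_f k s y sk).
rewrite (_ : Bdot_val (bdot_of sf vf - x k) = (-1) *: Bdot_val (x k) + f).
  rewrite iter_partial_lin//; last exact: Bdot_smooth.
  by rewrite -[(_ *: _ + _) y]/(-1 * D s (x k) y + D s f y) mulN1r addrC.
by rewrite -[LHS]/(f - Bdot_val (x k)) addrC scaleN1r.
Qed.

Variable B : set (DL1 R n).
Hypothesis B_pointwise : forall phi, exists M : R, forall S, B S -> normc (S phi) <= M.

(** S psi is half the difference of the values at phi + psi and phi - psi. *)
Lemma larger_value (S : DL1 R n) phi psi :
  exists2 chi, chi = phi + psi \/ chi = phi - psi & normc (S psi) <= normc (S chi).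
Proof.
have [h|h] := leP (normc (S psi)) (normc (S (phi + psi))).
  by exists (phi + psi) => //; left.
exists (phi - psi); first by right.
rewrite leNgt; apply/negP => h'.
have : normc (S psi + S psi) <= normc (S (phi + psi)) + normc (S (phi - psi)).
  apply: le_trans (normcB_le _ _); rewrite DL1_D DL1_B.
  by rewrite (_ : S phi + S psi - (S phi - S psi) = S psi + S psi)//; ring.
rewrite -mulr2n normcMn; move: h h'; lra.
Qed.

(** Otherwise one builds a test function as the limit of a fast converging
    sequence at which members of B take arbitrarily large values, choosing at each
    step the sign given by larger_value. *)
Theorem uniform_boundedness : exists m (K : R), 0 <= K /\ forall S, B S -> seminorm_bounded m K S.
Proof.
apply: contrapT => nb.
have large m (e K : R) : 0 < e -> 0 <= K ->
    exists S : DL1 R n, B S /\ exists2 phi : Bdot R n, cm m phi <= e & K < normc (S phi).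
  move=> e0 K0; apply: contrapT => H; apply: nb; exists m, (K / e).
  split; first by rewrite divr_ge0// ltW.
  move=> S BS; apply: ball_seminorm_bounded => // [a phi|phi pe]; first exact: DL1_Z.
  rewrite leNgt; apply/negP => KS; apply: H; exists S; split=> //.
  by exists phi => //; exact: ltW.
(* A state (k, x, e, m): the current point x, and the ball of radius e in
   the seminorm of order m in which the next step is taken. The new radius
   is so small that all later steps together change S x by at most 1. *)
pose st : Type := (nat * Bdot R n * R * nat)%type.
pose ok (p q : st) := let: (k, x, e, m) := p in let: (k', x', e', m') := q in
  0 < e -> [/\ k' = k.+1, 0 < e', e' <= e / 2, (m < m')%N & cm m (x' - x) <= e /\
     exists S : DL1 R n, B S /\ k%:R + 1 < normc (S x') /\
       exists2 K : R, seminorm_bounded m' K S & 4 * K * e' <= 1].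
have step p : exists q, ok p q.
  case: p => [[[k x] e] m]; have [e0|e0] := boolP (0 < e); last first.
    by exists (k, x, e, m) => /=; rewrite (negbTE e0).
  have k0 : 0 <= k%:R + 1 :> R by rewrite addr_ge0.
  have [S [BS [psi pe Sp]]] := large m e (k%:R + 1) e0 k0.
  have [chi chiE Sc] := larger_value S x psi.
  have [mS [K [K0 SK]]] := DL1_seminorm_bounded S.
  (* The factor 4 is that of Bdot_complete. *)
  pose e' := Num.min (e / 2) (4 * K + 1)^-1.
  exists (k.+1, chi, e', (maxn mS m).+1) => /= _.
  have K1 : 0 < 4 * K + 1 by rewrite ltr_wpDl// mulr_ge0.
  split=> //; first by rewrite lt_min divr_gt0// invr_gt0.
  - by rewrite ge_min lexx.
  - by rewrite ltnS leq_maxr.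
  split.
    case: chiE => ->; first by rewrite addrAC subrr add0r.
    rewrite addrAC subrr add0r -scaleN1r; apply: le_trans (bcmZ _ _ _) _.
    by rewrite normcN normc1 mul1r.
  exists S; split=> //; split; first exact: lt_le_trans Sc.
  exists K.
    move=> phi; apply: le_trans (SK phi) _; apply: ler_wpM2l => //.
    by apply: cm_mono; [exact: Bdot_bounded|rewrite leqW// leq_maxl].
  have e'K : e' <= (4 * K + 1)^-1 by rewrite ge_min lexx orbT.
  apply: le_trans (ler_wpM2l _ e'K) _; first exact: mulr_ge0.
  by rewrite ler_pdivrMr// mul1r lerDl.
have [nx nxP] := choice step.
pose s j := iter j nx (0%N, 0, 1, 0%N).
pose x j := (s j).1.1.2; pose e j := (s j).1.2; pose m j := (s j).2.
have sE j : s j = ((s j).1.1.1, x j, e j, m j) by rewrite /x /e /m; case: (s j) => [[[]]].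
have okj j : ok (s j) (s j.+1) by rewrite /s iterS; exact: nxP.
have inv j : (s j).1.1.1 = j /\ 0 < e j.
  elim: j => [|j [IH1 IH2]]; first by split => //; exact: ltr01.
  have := okj j; rewrite (sE j) (sE j.+1) IH1 /= => /(_ IH2)[-> ? _ _ _].
  by split.
have {}okj j : [/\ e j.+1 <= e j / 2, (m j < m j.+1)%N & cm (m j) (x j.+1 - x j : Bdot R n) <= e j /\
     exists S : DL1 R n, B S /\ j%:R + 1 < normc (S (x j.+1)) /\
       exists2 K : R, seminorm_bounded (m j.+1) K S & 4 * K * e j.+1 <= 1].
  have [h1 h2] := inv j.
  have := okj j; rewrite (sE j) (sE j.+1) h1 /= => /(_ h2)[_ _ ? ? ?].
  by split.
have e0 j : 0 <= e j by apply/ltW; case: (inv j).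
have [phi xphi] : exists phi : Bdot R n, forall k, cm (m k) (phi - x k : Bdot R n) <= 4 * e k.
  apply: Bdot_complete => // j; by case: (okj j) => // _ _ [].
have [M BM] := B_pointwise phi.
pose j := (Num.trunc `|M|).+1.
have [_ _ [_ [S [BS [Sj [K SK Ke]]]]]] := okj j.
have Mj : M < j%:R by apply: le_lt_trans (ler_norm M) _; exact: truncnS_gt.
have h1 : normc (S (phi - x j.+1)) <= 1.
  have K0 : 0 <= K \/ K < 0 by case: (leP 0 K); [left|right].
  apply: le_trans (SK _) _; case: K0 => K0; last first.
    by apply: (@le_trans _ _ 0) => //; rewrite nmulr_rle0 ?cm_ge0.
  apply: le_trans Ke; rewrite (mulrC 4) -mulrA; exact: ler_wpM2l.
have h2 := BM S BS.
have : normc (S (x j.+1)) <= normc (S phi) + normc (S (phi - x j.+1)).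
  by apply: le_trans (normcB_le _ _); rewrite DL1_B opprB addrC subrK.
move: Sj h1 h2 Mj; lra.
Qed.

End uniform_boundedness.

(** * Bounded and relatively compact sets *)

Section complex_topology.
Variable R : realType.
Local Notation C := (R[i]^o).

Lemma entourage_normc (E : set (C * C)) : entourage E <->
  exists2 e : R, 0 < e & forall z w : C, normc (z - w) < e -> E (z, w).
Proof.
rewrite -entourage_from_ballE; split=> [[d /= /gt0_real_complex[e e0 ->] eE]|[e e0 eE]].
  by exists e => // z w zw; apply: eE => /=; rewrite -ball_normE /ball_ /= norm_normc ltcR.
exists (e%:C)%C; first by rewrite /= ltcR.
by move=> [z w] /=; rewrite -ball_normE /ball_ /= norm_normc ltcR; exact: eE.
Qed.

(** The image of a product of segments. *)
Lemma compact_square (r : R) :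
  compact [set z : C | `|complex.Re z| <= r /\ `|complex.Im z| <= r].
Proof.
pose f (p : R * R) : C := (p.1 +i* p.2)%C.
have cf : continuous f.
  by apply/continuous_ReIm; split => p; [exact: cvg_fst|exact: cvg_snd].
have cS : compact (`[- r, r]%classic `*` `[- r, r]%classic : set (R * R)).
  by apply: compact_setX; exact: segment_compact.
rewrite (_ : [set _ | _] = f @` (`[- r, r]%classic `*` `[- r, r]%classic)).
  by apply: continuous_compact cS; exact: continuous_subspaceT.
apply/seteqP; split=> [[a b] /= [h1 h2]|_ [[a b] /= [h1 h2] <-]].
  by exists (a, b) => //=; rewrite !in_itv/= -!ler_norml.
by move: h1 h2; rewrite !in_itv/= -!ler_norml.
Qed.

Lemma continuous_normc : continuous (@normc R : C -> R).
Proof.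
move=> z; apply/(@cvgrPdist_lt _ _ _ (nbhs (z : C)) _) => e e0.
have /cvg_normcP/(_ e e0) := @cvg_id _ (nbhs (z : C)).
apply: filterS => w; apply: le_lt_trans.
have h1 := normcD_le (z - w) w; have h2 := normcD_le (w - z) z.
rewrite subrK in h1; rewrite subrK normcBC in h2.
by rewrite ler_norml; apply/andP; split; move: h1 h2; lra.
Qed.

Lemma compact_disc (r : R) : compact [set z : C | normc z <= r].
Proof.
apply: (subclosed_compact _ (@compact_square r)).
  rewrite (_ : [set _ | _] = (@normc R) @^-1` [set x | x <= r])//.
  by apply: closed_comp => // z _; exact: continuous_normc.
move=> z /= zr; split; first exact: le_trans (normc_Re z) zr.
exact: le_trans (normc_Im z) zr.
Qed.

End complex_topology.

Section bounded_sets.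
Variables (R : realType) (n : nat).
Local Notation C := (R[i]^o).
Implicit Types (phi psi : Bdot R n) (m : nat) (A : set (Bdot R n)) (B : set (DL1 R n)).

(** A common description of beta and kappa, for arbitrary families of sets. *)
Definition family_emb (fam : set (set (Bdot R n))) (S : DL1 R n) :
  {family fam, Bdot R n -> C} := DL1_val S.

Definition uniformly_bounded_on B A := exists M : R,
  forall S phi, B S -> A phi -> normc (S phi) <= M.

(** The scaled copies k^-1 B, |k| large, of a set that is bounded on the members
    of the family converge to 0 uniformly on each of them. *)
Lemma bounded_of_family fam B : (forall A, fam A -> uniformly_bounded_on B A) ->
  forall U : set (initial_topology (family_emb fam)),
    nbhs (0 : initial_topology (family_emb fam)) U ->
    exists2 r : R[i], 0 < r & forall k : R[i], r <= `|k| ->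
      B `<=` [set (k *: (u : DL1 R n)) | u in U].
Proof.
move=> fB U; rewrite nbhsE => -[_ [[V oV <-] V0] VU].
pose T (r : R) : set (DL1 R n) := [set S | exists (k : R[i]) S',
  [/\ r <= normc (k : C), B S' & S = k^-1 *: S']].
pose F := filter_from [set r : R | 0 < r] T.
have FF : Filter F.
  apply: filter_from_filter; first by exists 1 => /=.
  move=> r q r0 q0; exists (Num.max r q); first by rewrite /= lt_max r0.
  move=> S [k [S' [+ BS ->]]]; rewrite ge_max => /andP[rk qk].
  by split; exists k, S'.
have : ((fun S => DL1_val S : {family fam, Bdot R n -> C}) @ F) --> (family_emb fam 0).
  apply/fam_cvgP => A fA; have [M BM] := fB A fA.
  move=> P /uniform_nbhs[E [/entourage_normc[e e0 eE] EP]].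
  exists ((`|M| + 1) / e) => /=.
    by rewrite divr_gt0// ltr_wpDl.
  move=> _ [k [S [rk BS ->]]]; apply: EP => phi Aphi; apply: eE.
  rewrite -[X in normc X]/(0 - (k^-1 : C) * S phi) sub0r normcN normcM normcV.
  have k0 : 0 < normc (k : C).
    by apply: lt_le_trans rk; rewrite divr_gt0// ltr_wpDl.
  rewrite mulrC ltr_pdivrMr//; apply: le_lt_trans (BM S phi BS Aphi) _.
  apply: (@lt_le_trans _ _ (`|M| + 1)); first by rewrite ltr_pwDr// ler_norm.
  by rewrite -ler_pdivrMl// mulrC.
move=> /(_ V); case; first by apply: open_nbhs_nbhs; split.
move=> r /= r0 TV; exists (r%:C)%C; first by rewrite ltcR.
move=> k; rewrite norm_normc lecR => rk S BS.
have k0 : k != 0.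
  by apply: contraTneq (lt_le_trans r0 rk) => ->; rewrite normc0 ltxx.
exists (k^-1 *: S); last by rewrite scalerA mulfV// scale1r.
by apply: VU; apply: TV; exists k, S.
Qed.

Lemma family_of_bounded fam B :
  (forall U : set (initial_topology (family_emb fam)),
    nbhs (0 : initial_topology (family_emb fam)) U ->
    exists2 r : R[i], 0 < r & forall k : R[i], r <= `|k| ->
      B `<=` [set (k *: (u : DL1 R n)) | u in U]) ->
  forall A, fam A -> uniformly_bounded_on B A.
Proof.
move=> bB A fA.
have E1 : entourage [set zw : C * C | normc (zw.1 - zw.2) < 1].
  by apply/entourage_normc; exists 1.
have := @initial_continuous _ _ (family_emb fam) (0 : DL1 R n) _
  (fam_nbhs (family_emb fam 0) E1 fA).
move=> /bB[r r0 rB]; have r1 : r <= `|r| by rewrite gtr0_norm.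
exists (normc (r : C)) => S phi BS Aphi; have [u Uu <-] := rB r r1 S BS.
rewrite -[X in normc X]/((r : C) * u phi) normcM.
have : normc (0 - (DL1_val u phi : C)) < 1 := Uu phi Aphi.
rewrite sub0r normcN => /ltW u1.
by rewrite ler_piMr// normc_ge0.
Qed.

Lemma beta_boundedP B : @tvs_bounded R[i] (DL1 R n) B <->
  forall A, @tvs_bounded _ (Bdot R n) A -> uniformly_bounded_on B A.
Proof.
split; first exact: (@family_of_bounded (@tvs_bounded _ (Bdot R n)) B).
exact: (@bounded_of_family (@tvs_bounded _ (Bdot R n)) B).
Qed.

Lemma kappa_boundedP B : @tvs_bounded R[i] (DL1c R n) B <->
  forall A, @kappa_family R n A -> uniformly_bounded_on B A.
Proof.
split; first exact: (@family_of_bounded (@kappa_family R n) B).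
exact: (@bounded_of_family (@kappa_family R n) B).
Qed.

Lemma tvs_bounded_point phi : @tvs_bounded _ (Bdot R n) [set phi].
Proof.
move=> U /nbhs_BdotP[m [e [e0 eU]]].
pose r := (cm m phi + 1) / e; have r0 : 0 < r by rewrite divr_gt0// ltr_wpDl// cm_ge0.
exists (r%:C)%C; first by rewrite ltcR.
move=> k; rewrite norm_normc lecR => rk _ ->.
have k0 : 0 < normc (k : C) by exact: lt_le_trans rk.
have kn0 : k != 0 by apply: contraTneq k0 => ->; rewrite normc0 ltxx.
exists (k^-1 *: phi); last by rewrite scalerA mulfV// scale1r.
apply: eU; rewrite subr0; apply: le_lt_trans (bcmZ _ _ _) _.
rewrite normcV mulrC ltr_pdivrMr//; apply: (@lt_le_trans _ _ (e * r)).
  by rewrite /r mulrC divfK ?gt_eqF// ltrDl.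
by rewrite ler_wpM2l// ltW.
Qed.

Lemma tvs_bounded_cm A m : @tvs_bounded _ (Bdot R n) A ->
  exists M : R, forall phi, A phi -> cm m phi <= M.
Proof.
move=> bA; have /bA[r r0 rA] : nbhs (0 : Bdot R n) [set phi : Bdot R n | cm m phi < 1].
  by apply/nbhs_BdotP; exists m, 1; split=> // psi; rewrite subr0.
have r1 : r <= `|r| by rewrite gtr0_norm.
exists (normc (r : C)) => phi Aphi; have [u Uu <-] := rA r r1 phi Aphi.
apply: le_trans (bcmZ _ _ _) _; rewrite ler_piMr ?normc_ge0//; exact: ltW.
Qed.

Lemma continuous_cm m : continuous (fun phi : Bdot R n => cm m phi).
Proof.
move=> phi; apply/(@cvgrPdist_lt _ _ _ (nbhs phi)) => e e0.
apply/nbhs_BdotP; exists m, e; split=> // psi; apply: le_lt_trans.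
have h1 := bcmD m (psi - phi) phi; have h2 := bcmB m psi (psi - phi).
rewrite subrK in h1; rewrite opprB addrC subrK in h2.
by rewrite ler_norml; apply/andP; split; move: h1 h2; lra.
Qed.

Lemma compact_cm A m : compact A -> exists M : R, forall phi, A phi -> cm m phi <= M.
Proof.
move=> cA; have : compact ((fun phi : Bdot R n => cm m phi) @` A).
  by apply: continuous_compact cA; apply: continuous_subspaceT; exact: continuous_cm.
move=> /compact_bounded[M [_ MP]]; exists (M + 1) => phi Aphi.
apply: le_trans (ler_norm _) _; apply: MP; first by rewrite ltrDl.
by exists phi.
Qed.

(** The discs spanned by single test functions belong to the family of kappa, which
    is therefore finer than pointwise convergence. *)
Lemma kappa_family_disc phi :
  @kappa_family R n [set psi | exists2 k : R[i], normc (k : C) <= 1 & psi = k *: phi].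
Proof.
split; last first.
  have cl : continuous (fun k : C => (k : R[i]) *: phi).
    move=> k U /nbhs_BdotP[m [e [e0 eU]]].
    have d0 : 0 < e / (cm m phi + 1) by rewrite divr_gt0// ltr_wpDl// cm_ge0.
    have /cvg_normcP/(_ _ d0) := @cvg_id _ (nbhs k).
    apply: filterS => w; rewrite normcBC => wk; apply: eU.
    rewrite -scalerBl; apply: le_lt_trans (bcmZ _ _ _) _.
    apply: (@le_lt_trans _ _ (normc (w - k) * (cm m phi + 1))).
      by rewrite ler_wpM2l ?normc_ge0// lerDl.
    by rewrite -ltr_pdivlMr// ltr_wpDl// cm_ge0.
  rewrite (_ : [set _ | _] = (fun k : C => (k : R[i]) *: phi) @` [set k | normc k <= 1]).
    apply: continuous_compact (@compact_disc R 1).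
    exact: continuous_subspaceT.
  by apply/seteqP; split=> [_ [k k1 ->]|_ [k k1 <-]]; exists k.
split=> [x y t|k _ k1 [l l1 ->]].
  rewrite !inE => -[k k1 ->] [l l1 ->].
  exists (t%:num * k + unstable.onem t%:num * l); last first.
    by rewrite scalerDl -!scalerA.
  have [a a0 at_] : exists2 a : R, 0 <= a & a <= 1 /\ t%:num = (a%:C)%C.
    have := [elaborate ge0 t]; have := [elaborate le1 t].
    case: (t%:num) => a b; rewrite !lecE/= => /andP[/eqP b0 a1] /andP[_ a0].
    by exists a => //; rewrite -b0.
  case: at_ => a1 ->; apply: le_trans (normc_lin _ _ _) _; rewrite normc_real.
  have -> : unstable.onem (a%:C)%C = ((1 - a)%:C)%C.
    by rewrite /unstable.onem rmorphB rmorph1.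
  rewrite normcM normc_real !ger0_norm ?subr_ge0//.
  apply: (@le_trans _ _ (a * 1 + (1 - a) * 1)); last by rewrite !mulr1 addrC subrK.
  by apply: lerD; rewrite ler_wpM2l ?subr_ge0.
exists (k * l); last by rewrite scalerA.
rewrite normcM mulr_ile1 ?normc_ge0//; move: k1; by rewrite norm_normc -(lecR _ 1).
Qed.

Lemma continuous_eval phi : continuous (fun S : DL1c R n => (DL1_val S phi : C)).
Proof.
move=> S; apply/(@cvg_normcP _ _ (nbhs S) _) => e e0.
have Ee : entourage [set zw : C * C | normc (zw.1 - zw.2) < e].
  by apply/entourage_normc; exists e.
have H := @initial_continuous _ _ (@kappa_emb R n) S _
  (fam_nbhs (kappa_emb S) Ee (kappa_family_disc phi)).
apply: (@filterS _ (nbhs S) _ _ _ _ H) => T /(_ phi); apply.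
by exists 1; rewrite ?normc1 ?scale1r.
Qed.

(** The equicontinuous sets are the subsets of these. *)
Definition polar_set m (K : R) : set (DL1 R n) := [set S | seminorm_bounded m K S].

(** An ultrafilter of forms bounded at phi converges at phi, by compactness of
    discs. *)
Lemma ultra_near (F : set_system (DL1c R n)) {UF : UltraFilter F} phi (M : R) :
  (\forall S \near F, normc (DL1_val S phi) <= M) ->
  exists z : C, forall e : R, 0 < e -> \forall S \near F, normc (z - DL1_val S phi) < e.
Proof.
move=> FM; pose ev (S : DL1c R n) : C := DL1_val S phi.
have : (ev @ F) [set z : C | normc z <= M] by exact: FM.
move=> /(@compact_disc R M _ _)[z [_ zc]]; exists z => e e0.
have [//|nF] := in_ultra_setVsetC [set S | normc (z - DL1_val S phi) < e] UF.
have nz : nbhs z [set w : C | normc (z - w) < e].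
  by have /cvg_normcP/(_ e e0) := @cvg_id _ (nbhs z).
by have [w [? ?]] := zc (~` [set w : C | normc (z - w) < e]) _ nF nz.
Qed.

Lemma closed_polar m (K : R) : closed (polar_set m K : set (DL1c R n)).
Proof.
rewrite (_ : polar_set m K = \bigcap_phi [set S : DL1c R n | normc (DL1_val S phi) <= K * cm m phi]).
  apply: closed_bigI => phi _.
  rewrite (_ : [set _ | _] = (fun S : DL1c R n => normc (DL1_val S phi)) @^-1`
    [set x | x <= K * cm m phi])//.
  apply: closed_comp => // S _.
  apply: (@continuous_comp _ _ _ (fun S : DL1c R n => (DL1_val S phi : C)) (@normc R)).
    exact: continuous_eval.
  exact: continuous_normc.
by apply/seteqP; split=> [S SK phi _|S SK phi]; exact: SK.
Qed.

(** An ultrafilter on the polar converges pointwise, to an element of the polar,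
    and by equicontinuity uniformly on compact sets. *)
Lemma compact_polar m (K : R) : 0 <= K -> compact (polar_set m K : set (DL1c R n)).
Proof.
move=> K0; rewrite compact_ultra => F UF FP.
have FF : ProperFilter F by exact: ultra_proper.
have H phi : exists z : C, forall e : R, 0 < e -> \forall S \near F, normc (z - DL1_val S phi) < e.
  apply: (@ultra_near F UF phi (K * cm m phi)).
  by apply: filterS FP => S; apply.
have [L LP] := choice H.
have Llin (a : R[i]) phi psi : L (a *: phi + psi) = (a : C) * L phi + L psi.
  apply/eqP; rewrite -subr_eq0; apply/eqP; apply: eq0_normc; apply/eqP.
  rewrite eq_le normc_ge0 andbT; apply/ler_addgt0Pr => e e0; rewrite add0r.
  pose d := e / (normc (a : C) + 2).
  have a2 : 0 < normc (a : C) + 2 by rewrite ltr_wpDl// (@normc_ge0 R a).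
  have d0 : 0 < d by rewrite divr_gt0.
  have near3 : \forall S \near F, normc (L (a *: phi + psi) - DL1_val S (a *: phi + psi)) < d /\
      (normc (L phi - DL1_val S phi) < d /\ normc (L psi - DL1_val S psi) < d).
    by apply: filterI; [exact: LP|apply: filterI; exact: LP].
  have [S [S1 [S2 S3]]] := filter_ex near3.
  rewrite DL1_lin in S1.
  rewrite (_ : L (a *: phi + psi) - _ = (L (a *: phi + psi) - ((a : C) * S phi + S psi)) -
    ((a : C) * (L phi - S phi) + (L psi - S psi))); last by ring.
  apply: le_trans (normcB_le _ _) _.
  have h := normc_lin (a : C) (L phi - S phi) (L psi - S psi).
  have h2 : normc (a : C) * normc (L phi - S phi) <= normc (a : C) * d.
    by rewrite ler_wpM2l ?(@normc_ge0 R a)// ltW.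
  have -> : e = d * (normc (a : C) + 2) by rewrite /d divfK// gt_eqF.
  move: S1 S3 h h2; rewrite mulrDr (mulrC d); lra.
have LK : seminorm_bounded m K L.
  move=> phi; apply/ler_addgt0Pr => e e0.
  have [S [S1 SK]] := filter_ex (filterI (LP phi e e0) FP).
  rewrite -[L phi](subrK (S phi)); apply: le_trans (normcD_le _ _) _.
  by rewrite addrC lerD// ltW.
pose T : DL1 R n := MkDL1 (seminorm_bounded_continuous Llin LK).
exists T; split; first exact: LK.
move=> U; rewrite nbhsE => -[_ [[V oV <-] VT] VU].
have : ((@kappa_emb R n) @ F) --> (kappa_emb (T : DL1c R n)).
  apply/fam_cvgP => A fA P /uniform_nbhs[E [/entourage_normc[e e0 eE] EP]].
  have cA : compact A by case: fA.
  have ncA := (compact_near_coveringP A).1 cA.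
  have : \forall S \near F, A `<=` (fun phi => normc (L phi - DL1_val S phi) < e).
    apply: ncA => phi _; have e2 : 0 < e / 2 by rewrite divr_gt0.
    have K1 : 0 < K + 1 by rewrite ltr_wpDl.
    pose d := e / 4 / (K + 1); have d0 : 0 < d by rewrite !divr_gt0.
    exists ([set psi : Bdot R n | cm m (psi - phi : Bdot R n) < d],
            [set S | polar_set m K S /\ normc (L phi - DL1_val S phi) < e / 2]).
      split => /=; first by apply/nbhs_BdotP; exists m, d.
      exact: filterI FP (LP phi _ e2).
    move=> [psi S] [/= pd [SK Sphi]].
    have TE f : L f = T f by [].
    rewrite (_ : L psi - S psi = (L phi - S phi) + (T (psi - phi) - S (psi - phi))); last first.
      by rewrite !DL1_B !TE; ring.
    apply: le_lt_trans (normcD_le _ _) _; rewrite [ltRHS]splitr; apply: ltr_leD => //.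
    apply: le_trans (normcB_le _ _) _.
    have h : K * cm m (psi - phi : Bdot R n) <= e / 4.
      apply: (@le_trans _ _ ((K + 1) * d)); last by rewrite /d mulrC divfK// gt_eqF.
      by apply: ler_pM => //; [exact: cm_ge0|rewrite lerDl|exact: ltW].
    have h1 := LK (psi - phi); have h2 := SK (psi - phi).
    by move: h h1 h2; rewrite TE; lra.
  by apply: filterS => S AS; apply: EP => phi Aphi; apply: eE; exact: AS.
move=> /(_ V) FV; have {}FV : F (@kappa_emb R n @^-1` V).
  by apply: FV; apply: open_nbhs_nbhs; split.
exact: filterS FV.
Qed.

Lemma pointwise_bounded_equicontinuous B :
  (forall phi, uniformly_bounded_on B [set phi]) ->
  exists m (K : R), 0 <= K /\ B `<=` polar_set m K.
Proof.
move=> Bb; apply: uniform_boundedness => phi; have [M BM] := Bb phi; exists M => S BS.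
exact: BM.
Qed.

Lemma beta_bounded_equicontinuous B : @tvs_bounded R[i] (DL1 R n) B <->
  exists m (K : R), 0 <= K /\ B `<=` polar_set m K.
Proof.
split=> [/beta_boundedP bB|[m [K [K0 BK]]]].
  by apply: pointwise_bounded_equicontinuous => phi; apply/bB/tvs_bounded_point.
apply/beta_boundedP => A /(tvs_bounded_cm m)[M AM]; exists (K * M) => S phi BS Aphi.
by apply: le_trans (BK S BS phi) _; rewrite ler_wpM2l// AM.
Qed.

Lemma kappa_bounded_equicontinuous B : @tvs_bounded R[i] (DL1c R n) B <->
  exists m (K : R), 0 <= K /\ B `<=` polar_set m K.
Proof.
split=> [/kappa_boundedP bB|[m [K [K0 BK]]]].
  apply: pointwise_bounded_equicontinuous => phi.
  have [M BM] := bB _ (kappa_family_disc phi); exists M => S _ BS ->.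
  by apply: BM => //; exists 1; rewrite ?normc1 ?scale1r.
apply/kappa_boundedP => A [_ /(compact_cm m)[M AM]]; exists (K * M) => S phi BS Aphi.
by apply: le_trans (BK S BS phi) _; rewrite ler_wpM2l// AM.
Qed.

Lemma precompact_equicontinuous B : @precompact (DL1c R n) B <->
  exists m (K : R), 0 <= K /\ B `<=` polar_set m K.
Proof.
rewrite precompactE; split=> [cB|[m [K [K0 BK]]]].
  apply: pointwise_bounded_equicontinuous => phi.
  have : compact ((fun S : DL1c R n => normc (DL1_val S phi)) @` closure (B : set (DL1c R n))).
    apply: continuous_compact cB; apply: continuous_subspaceT => S.
    apply: (@continuous_comp _ _ _ (fun S : DL1c R n => (DL1_val S phi : C)) (@normc R)).
      exact: continuous_eval.
    exact: continuous_normc.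
  move=> /compact_bounded[M [_ MP]]; exists (M + 1) => S _ BS ->.
  apply: le_trans (ler_norm _) _; apply: MP; first by rewrite ltrDl.
  by exists S => //; exact: subset_closure.
apply: (@subclosed_compact _ _ (polar_set m K : set (DL1c R n))).
- exact: closed_closure.
- exact: compact_polar.
move=> S BS; apply: (@closed_polar m K).
exact: (@closure_subset (DL1c R n) B (polar_set m K) BK) BS.
Qed.

End bounded_sets.

(** * Bounded sets as images of the unit ball of L^1 *)

Section real_integrals.
Variables (R : realType) (n : nat).
Local Notation RM := (measurableTypeR R).
Local Notation mu := (lebesgue R n).
Implicit Types u w g : n.-tuple RM -> R.

Definition rintegrable u := mu.-integrable setT (EFin \o u).

Lemma rintegrableD u w : rintegrable u -> rintegrable w -> rintegrable (fun t => u t + w t).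
Proof. by move=> iu iw; exact: (integrableD measurableT iu iw). Qed.

Lemma rintegrableZ (a : R) u : rintegrable u -> rintegrable (fun t => a * u t).
Proof. by move=> iu; exact: (integrableZl measurableT a iu). Qed.

Lemma rintegrableB u w : rintegrable u -> rintegrable w -> rintegrable (fun t => u t - w t).
Proof. by move=> iu iw; exact: (integrableB measurableT iu iw). Qed.

Lemma rintegrable_measurable u : rintegrable u -> measurable_fun setT u.
Proof. by move=> /integrableP[/measurable_EFinP]. Qed.

Lemma rintegrable_norm u : rintegrable u -> rintegrable (fun t => `|u t|).
Proof. by move=> iu; exact: (integrable_abse iu). Qed.

Lemma rintegrable_le u w : measurable_fun setT u -> rintegrable w ->
  (forall t, `|u t| <= w t) -> rintegrable u.
Proof.
move=> mu_ iw uw; apply: (le_integrable measurableT _ _ iw).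
  exact/measurable_EFinP.
by move=> t _; rewrite /= lee_fin; apply: le_trans (uw t) (ler_norm _).
Qed.

Lemma rintegrableM u g (M : R) : rintegrable u -> measurable_fun setT g ->
  (forall t, `|g t| <= M) -> rintegrable (fun t => u t * g t).
Proof.
move=> iu mg gM.
apply: (rintegrable_le _ (rintegrableZ M (rintegrable_norm iu))).
  by apply: measurable_funM => //; exact: rintegrable_measurable.
by move=> t; rewrite normrM mulrC ler_wpM2r.
Qed.

Lemma rintegral_le u w : rintegrable u -> rintegrable w ->
  (forall t, `|u t| <= w t) -> `|\int[mu]_t u t| <= \int[mu]_t w t.
Proof.
move=> iu iw uw; apply: le_trans (le_normr_Rintegral measurableT iu) _.
by apply: le_Rintegral => //; exact: rintegrable_norm.
Qed.

Lemma rintegralD u w : rintegrable u -> rintegrable w ->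
  \int[mu]_t (u t + w t) = \int[mu]_t u t + \int[mu]_t w t.
Proof. exact: RintegralD. Qed.

Lemma rintegralB u w : rintegrable u -> rintegrable w ->
  \int[mu]_t (u t - w t) = \int[mu]_t u t - \int[mu]_t w t.
Proof. exact: RintegralB. Qed.

Lemma rintegralZ (a : R) u : rintegrable u ->
  \int[mu]_t (a * u t) = a * \int[mu]_t u t.
Proof. exact: RintegralZl. Qed.

End real_integrals.

Section complex_integrals.
Variables (R : realType) (n : nat).
Local Notation Rn := 'rV[R]_n.
Local Notation C := (R[i]^o).
Local Notation mu := (lebesgue R n).
Local Notation row t := (row_of_tuple t).
Implicit Types f g : Rn -> C.

Lemma L1E f : L1 f <-> rintegrable (fun t => re f (row t)) /\ rintegrable (fun t => im f (row t)).
Proof. by []. Qed.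

Lemma re_lin (a : C) f g x : re (fun x => a * f x + g x) x =
  complex.Re a * re f x - complex.Im a * im f x + re g x.
Proof. by rewrite /re /im; case: a (f x) (g x) => [? ?] [? ?] [? ?]. Qed.

Lemma im_lin (a : C) f g x : im (fun x => a * f x + g x) x =
  complex.Re a * im f x + complex.Im a * re f x + im g x.
Proof. by rewrite /re /im; case: a (f x) (g x) => [? ?] [? ?] [? ?]. Qed.

Lemma reM f g x : re (fun x => f x * g x) x = re f x * re g x - im f x * im g x.
Proof. by rewrite /re /im; case: (f x) (g x) => [? ?] [? ?]. Qed.

Lemma imM f g x : im (fun x => f x * g x) x = re f x * im g x + im f x * re g x.
Proof. by rewrite /re /im; case: (f x) (g x) => [? ?] [? ?]. Qed.

Lemma L1_lin (a : C) f g : L1 f -> L1 g -> L1 (fun x => a * f x + g x).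
Proof.
move=> /L1E[fr fi] /L1E[gr gi]; apply/L1E; split.
  under eq_fun do rewrite re_lin.
  by apply: rintegrableD => //; apply: rintegrableB; exact: rintegrableZ.
under eq_fun do rewrite im_lin.
by apply: rintegrableD => //; apply: rintegrableD; exact: rintegrableZ.
Qed.

Lemma L1Z (a : C) f : L1 f -> L1 (fun x => a * f x).
Proof.
move=> Lf; have := L1_lin (a - 1) Lf Lf.
by under eq_fun do rewrite mulrBl mul1r subrK.
Qed.

Lemma integral_Rn_lin (a : C) f g : L1 f -> L1 g ->
  integral_Rn (fun x => a * f x + g x) = a * integral_Rn f + integral_Rn g.
Proof.
move=> /L1E[fr fi] /L1E[gr gi]; apply: complex_eq.
  rewrite -[LHS]/(\int[mu]_t re (fun x => a * f x + g x) (row t)).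
  under eq_Rintegral do rewrite re_lin.
  rewrite rintegralD//; last by apply: rintegrableB; exact: rintegrableZ.
  rewrite rintegralB; try exact: rintegrableZ.
  by rewrite !rintegralZ//; case: a.
rewrite -[LHS]/(\int[mu]_t im (fun x => a * f x + g x) (row t)).
under eq_Rintegral do rewrite im_lin.
rewrite rintegralD//; last by apply: rintegrableD; exact: rintegrableZ.
rewrite rintegralD; try exact: rintegrableZ.
by rewrite !rintegralZ//; case: a.
Qed.

Lemma integral_RnZ (a : C) f : L1 f ->
  integral_Rn (fun x => a * f x) = a * integral_Rn f.
Proof.
move=> Lf; have := integral_Rn_lin (a - 1) Lf Lf.
under eq_fun do rewrite mulrBl mul1r subrK.
by rewrite mulrBl mul1r subrK.
Qed.

Lemma L1_mul f g : L1 f -> continuous g -> bounded_fct g -> L1 (fun x => f x * g x).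
Proof.
move=> /L1E[fr fi] /continuous_ReIm[/measurable_row gr /measurable_row gi] [M gM].
have gMr x : `|re g x| <= M by apply: le_trans (normc_Re _) (gM x).
have gMi x : `|im g x| <= M by apply: le_trans (normc_Im _) (gM x).
apply/L1E; split.
  under eq_fun do rewrite reM.
  by apply: rintegrableB; apply: rintegrableM (fun t => _) => //.
under eq_fun do rewrite imM.
by apply: rintegrableD; apply: rintegrableM (fun t => _) => //.
Qed.

Lemma rintegrable_normc f : L1 f -> rintegrable (fun t => normc (f (row t))).
Proof.
move=> /L1E[fr fi].
apply: (rintegrable_le _ (rintegrableD (rintegrable_norm fr) (rintegrable_norm fi))).
  have -> : (fun t => normc (f (row t))) =
      (fun t => Num.sqrt (re f (row t) ^+ 2 + im f (row t) ^+ 2)).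
    by apply/funext => t; rewrite /re /im; case: (f _).
  apply: (measurableT_comp (f := @Num.sqrt R)).
    exact: (continuous_measurable_fun (@sqrt_continuous R)).
  by apply: measurable_funD; apply: measurable_funX; exact: rintegrable_measurable.
by move=> t; rewrite ger0_norm ?normc_ge0//; exact: normc_ReIm.
Qed.

Lemma L1normE f : L1 f -> L1norm f = (\int[mu]_t normc (f (row t)))%:E.
Proof.
by move=> /rintegrable_normc Lf; rewrite /Rintegral fineK//; exact: integrable_fin_num Lf.
Qed.

(** The factor 2 comes from treating the real and imaginary parts separately. *)
Lemma integral_Rn_bound f g (M N : R) : L1 f -> (L1norm f <= N%:E)%E -> continuous g ->
  (forall x, normc (g x) <= M) -> normc (integral_Rn (fun x => f x * g x)) <= 2 * M * N.
Proof.
move=> Lf fN cg gM; have M0 : 0 <= M by apply: le_trans (normc_ge0 _) (gM 0).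
have /L1E[pr pi_] : L1 (fun x => f x * g x) by apply: L1_mul => //; exists M.
have iN := rintegrable_normc Lf.
have le u : rintegrable u -> (forall t, `|u t| <= normc (f (row t) * g (row t))) ->
    `|\int[mu]_t u t| <= M * N.
  move=> iu uM; apply: (@le_trans _ _ (\int[mu]_t (M * normc (f (row t))))).
    apply: rintegral_le (rintegrableZ _ _) _ => // t; apply: le_trans (uM t) _.
    by rewrite normcM mulrC ler_wpM2r ?normc_ge0.
  rewrite rintegralZ// ler_wpM2l// -lee_fin -L1normE//.
apply: le_trans (normc_ReIm _) _; rewrite -mulrA mulrDl mul1r; apply: lerD.
  by apply: le pr _ => t; exact: normc_Re.
by apply: le pi_ _ => t; exact: normc_Im.
Qed.

Local Notation lap := (one_minus_laplacian (@partial R n)).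
Local Notation dlap := (one_minus_laplacian (@dist_deriv R n)).

(** Forms are functions of arbitrary functions; linearity can be expected only on
    functions with bounded derivatives. *)
Definition form_linear (T : Defs.form R n) := forall (a : R[i]) f g, all_derivs_bounded f ->
  all_derivs_bounded g -> T (a *: f + g) = (a : C) * T f + T g.

Lemma all_derivs_bounded_continuous f : all_derivs_bounded f -> continuous f /\ bounded_fct f.
Proof. by move=> [sf bf]; split; [case: (sf [::])|exact: (bf [::])]. Qed.

Lemma all_derivs_bounded_iter f s : all_derivs_bounded f ->
  all_derivs_bounded (iter_deriv (@partial R n) s f).
Proof.
move=> [sf bf]; split; first exact: smooth_iter.
by move=> t; have [M fM] := bf (t ++ s); exists M; rewrite -iter_deriv_cat.
Qed.

Lemma all_derivs_bounded_lap m f : all_derivs_bounded f -> all_derivs_bounded (iter m lap f).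
Proof.
move=> bf; split; first by apply: smooth_iter_lap; case: bf.
move=> s; have br := bounded_derivs_iter_lap m (all_derivs_bounded_re bf).
have bi := bounded_derivs_iter_lap m (all_derivs_bounded_im bf).
have [M _ uM] := bounded_derivsP s br; have [N _ wN] := bounded_derivsP s bi.
exists (M + N) => x; apply: le_trans (normc_ReIm _) _.
rewrite -/(re _ x) -/(im _ x) re_iter_partial im_iter_partial re_iter_lap im_iter_lap.
exact: lerD.
Qed.

Lemma dist_of_fct_linear f : L1 f -> form_linear (dist_of_fct f).
Proof.
move=> Lf a g h /all_derivs_bounded_continuous[cg bg] /all_derivs_bounded_continuous[ch bh].
rewrite /dist_of_fct -integral_Rn_lin; try exact: L1_mul.
congr integral_Rn; apply/funext => x.
by rewrite -[(a *: g + h) x]/((a : C) * g x + h x); ring.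
Qed.

Lemma form_linear0 T : form_linear T -> T 0 = 0.
Proof.
move=> lT; have b0 : all_derivs_bounded (0 : Rn -> C).
  split; first exact: smooth0.
  by move=> s; exists 0 => x; rewrite iter_partial0 normc0.
by have := lT (-1) 0 0 b0 b0; rewrite scaler0 addr0 mulN1r addNr.
Qed.

(** The two signs of a second derivative cancel. *)
Lemma dist_lapE T f : form_linear T -> all_derivs_bounded f -> dlap T f = T (lap f).
Proof.
move=> lT bf; rewrite /one_minus_laplacian.
have sumE (r : seq 'I_n) : all_derivs_bounded (\sum_(i <- r) partial i (partial i f)) /\
    T (\sum_(i <- r) partial i (partial i f)) = \sum_(i <- r) T (partial i (partial i f)).
  elim: r => [|i r [bs IH]].
    rewrite !big_nil form_linear0//; split=> //; split; first exact: smooth0.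
    by move=> s; exists 0 => x; rewrite iter_partial0 normc0.
  have bi := all_derivs_bounded_iter [:: i; i] bf.
  rewrite !big_cons -[partial i (partial i f)]scale1r; split.
    exact: (all_derivs_bounded_lin 1 bi bs).
  by rewrite (lT 1 _ _ bi bs) mul1r scale1r IH.
have [bs E] := sumE (index_enum 'I_n).
have -> : f - \sum_i partial i (partial i f) = (-1) *: (\sum_i partial i (partial i f)) + f.
  by rewrite scaleN1r addrC.
rewrite (lT (-1) _ _ bs bf) E mulN1r [RHS]addrC.
rewrite -[LHS]/(T f - (\sum_i dist_deriv i (dist_deriv i T)) f) fct_sumE.
by congr (_ - _); apply: eq_bigr => i _; rewrite /dist_deriv opprK.
Qed.

Lemma iter_dist_lapE m T f : form_linear T -> all_derivs_bounded f ->
  iter m dlap T f = T (iter m lap f).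
Proof.
move=> lT; elim: m f => // m IH f bf; rewrite iterS dist_lapE//.
  by rewrite IH; [rewrite -iterSr|exact: (@all_derivs_bounded_lap 1)].
move=> a g h bg bh; rewrite !IH//; last exact: all_derivs_bounded_lin.
rewrite iter_lap_complex_lin; [|by case: bg|by case: bh].
by apply: lT; exact: all_derivs_bounded_lap.
Qed.

End complex_integrals.

Section bounded_sets_by_densities.
Variables (R : realType) (n : nat).
Local Notation Rn := 'rV[R]_n.
Local Notation C := (R[i]^o).
Local Notation mu := (lebesgue R n).
Local Notation row t := (row_of_tuple t).
Local Notation lap := (one_minus_laplacian (@partial R n)).
Local Notation rlap := (one_minus_laplacian (@rpartial R n)).
Local Notation rD s u := (iter_deriv (@rpartial R n) s u).

Lemma bessel_B11_equicontinuous m (S : DL1 R n) : bessel_B11 m S ->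
  polar_set (2 * m) (4 * (1 + n%:R) ^+ m) S.
Proof.
move=> [f [Lf f1] fS] phi; have bphi := Bdot_bounded phi.
have lT := dist_of_fct_linear Lf.
rewrite fS iter_dist_lapE// /dist_of_fct.
have [cl _] := all_derivs_bounded_continuous (all_derivs_bounded_lap m bphi).
have hb := derivs_le_bessel (Bdot_smooth phi) (@cm_derivs _ _ (2 * m) _ bphi).
apply: le_trans (integral_Rn_bound Lf f1 cl hb) _.
by rewrite mulr1 !mulrA -natrM.
Qed.

Definition real_test (u : Rn -> R) := rsmooth u /\
  forall s (e : R), 0 < e -> exists r : R, forall x, r < `|x| -> `|rD s u x| < e.

Lemma re_of_real (u : Rn -> R) : re (fun x => (u x)%:C%C) = u.
Proof. by []. Qed.

Lemma im_of_real (u : Rn -> R) : im (fun x => (u x)%:C%C) = 0.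
Proof. by []. Qed.

Lemma smooth_of_real (u : Rn -> R) : rsmooth u -> smooth (fun x => (u x)%:C%C).
Proof. by move=> su; apply/smoothE; split=> //; exact: rsmooth0. Qed.

Lemma iter_partial_of_real (u : Rn -> R) s :
  iter_deriv (@partial R n) s (fun x => (u x)%:C%C) = (fun x => (rD s u x)%:C%C).
Proof.
apply: fct_complex_eq; first by rewrite re_iter_partial.
by rewrite im_iter_partial im_of_real iter_rpartial0.
Qed.

Lemma real_test_vanishes (u : Rn -> R) : real_test u -> forall s,
  vanishes_at_infinity (iter_deriv (@partial R n) s (fun x => (u x)%:C%C)).
Proof.
move=> [su vu] s e e0; have [r ur] := vu s e e0; exists r => x /ur.
by rewrite iter_partial_of_real normc_real.
Qed.

(** A total function, as required for the real functional to which
    lap_functional_density is applied. *)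
Definition bdot_real (u : Rn -> R) : Bdot R n :=
  if pselect (real_test u) is left h
  then bdot_of (smooth_of_real h.1) (real_test_vanishes h) else 0.

Lemma bdot_realE u : real_test u -> Bdot_val (bdot_real u) = (fun x => (u x)%:C%C).
Proof. by rewrite /bdot_real; case: pselect. Qed.

Lemma real_test0 : real_test 0.
Proof.
split; first exact: rsmooth0.
by move=> s e e0; exists 0 => x _; rewrite iter_rpartial0 normr0.
Qed.

Lemma real_test_lin (a : R) u w : real_test u -> real_test w -> real_test (a *: u + w).
Proof.
move=> [su vu] [sw vw]; split; first exact: rsmooth_lin.
move=> s e e0; have e2 : 0 < e / 2 by rewrite divr_gt0.
have a1 : 0 < `|a| + 1 by rewrite ltr_wpDl.
have [r ur] := vu s (e / 2 / (`|a| + 1)) (divr_gt0 e2 a1).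
have [q wq] := vw s _ e2.
exists (Num.max r q) => x; rewrite gt_max => /andP[/ur xr /wq xq].
rewrite iter_rpartial_lin//; apply: le_lt_trans (ler_normD _ _) _.
rewrite [ltRHS]splitr; apply: ler_ltD => //.
rewrite [X in `|X|]/(a * _) normrM.
apply: (@le_trans _ _ ((`|a| + 1) * (e / 2 / (`|a| + 1)))).
  by apply: ler_pM => //; [rewrite lerDl|exact: ltW].
by rewrite mulrC divfK// gt_eqF.
Qed.

Lemma real_test_bounded u : real_test u -> bounded_derivs u.
Proof.
move=> tu; have := all_derivs_bounded_re (Bdot_bounded (bdot_real u)).
by rewrite bdot_realE.
Qed.

Lemma bdot_real_lin (a : R) u w : real_test u -> real_test w ->
  bdot_real (a *: u + w) = (a%:C%C : R[i]) *: bdot_real u + bdot_real w.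
Proof.
move=> tu tw; apply: val_inj; rewrite /= bdot_realE; last exact: real_test_lin.
rewrite -[RHS]/((a%:C%C : R[i]) *: Bdot_val (bdot_real u) + Bdot_val (bdot_real w)).
rewrite !bdot_realE//; apply/funext => x.
rewrite -[RHS]/((a%:C * (u x)%:C + (w x)%:C)%C).
by rewrite -rmorphM -rmorphD.
Qed.

Lemma real_test_re (phi : Bdot R n) : real_test (re phi).
Proof.
split; first by have /smoothE[] := Bdot_smooth phi.
move=> s e e0; have [r pr] := Bdot_vanishes phi s e0; exists r => x /pr.
by apply: le_lt_trans; rewrite -re_iter_partial; exact: normc_Re.
Qed.

Lemma real_test_im (phi : Bdot R n) : real_test (im phi).
Proof.
split; first by have /smoothE[] := Bdot_smooth phi.
move=> s e e0; have [r pr] := Bdot_vanishes phi s e0; exists r => x /pr.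
by apply: le_lt_trans; rewrite -im_iter_partial; exact: normc_Im.
Qed.

Lemma bdot_re_im (phi : Bdot R n) :
  phi = ('i%C : R[i]) *: bdot_real (im phi) + bdot_real (re phi).
Proof.
apply: val_inj; rewrite /=.
rewrite -[RHS]/(('i%C : R[i]) *: Bdot_val (bdot_real (im phi)) + Bdot_val (bdot_real (re phi))).
rewrite !bdot_realE; [|exact: real_test_re|exact: real_test_im].
apply/funext => x; rewrite -[RHS]/(('i * (im phi x)%:C + (re phi x)%:C)%C).
rewrite /im /re; case: (Bdot_val phi x) => a b; apply: complex_eq => /=; ring.
Qed.

Lemma real_test_iter_lap m u : real_test u -> forall e : R, 0 < e ->
  exists r : R, forall y, r < `|y| -> `|iter m rlap u y| < e.
Proof.
have lapT w : real_test w -> real_test (rlap w).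
  move=> tw; rewrite /one_minus_laplacian addrC -scaleN1r.
  apply: real_test_lin => //; elim: (index_enum _) => [|i r IH].
    by rewrite big_nil; exact: real_test0.
  rewrite big_cons -[rpartial i _]scale1r; apply: real_test_lin => //.
  have [sw vw] := tw; split; first by do 2 apply: rsmooth_partial.
  move=> s e e0; have [q wq] := vw (s ++ [:: i; i]) e e0; exists q => x /wq.
  by rewrite iter_deriv_cat.
move=> tu; have [_ v] : real_test (iter m rlap u).
  by elim: m => // m IH; rewrite iterS; exact: lapT.
exact: (v [::]).
Qed.

(** The real and imaginary parts of S, restricted to real test functions, have
    densities f1 and f2; then f1 + i f2 is a density for S. *)
Lemma equicontinuous_density m (K : R) (S : DL1 R n) : 0 <= K -> polar_set m K S ->
  exists2 f : Rn -> C, L1 f /\ (L1norm f <= (2 * (K * (2 * 2 ^+ m) * 9 ^+ n))%:E)%E &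
  forall phi : Bdot R n,
    S phi = integral_Rn (fun x => f x * iter (2 * n + m)%N lap phi x).
Proof.
move=> K0 SK; pose K' := K * (2 * 2 ^+ m).
have K'0 : 0 <= K' by rewrite !mulr_ge0// exprn_ge0.
have SK' u (M : R) : real_test u -> (forall x, `|iter m rlap u x| <= M) ->
    normc (S (bdot_real u)) <= K' * M.
  move=> tu uM; apply: le_trans (SK _) _; rewrite -mulrA ler_wpM2l//.
  have bb := Bdot_bounded (bdot_real u); apply/cm_le => //.
  apply: bessel_derivs_le => // x; rewrite bdot_realE//.
  apply: le_trans (normc_ReIm _) _.
  rewrite -/(re _ x) -/(im _ x) re_iter_lap im_iter_lap re_of_real im_of_real.
  have -> : iter m rlap (0 : Rn -> R) = 0.
    have := iter_lap_lin m (-1) (@rsmooth0 R n) (@rsmooth0 R n).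
    by rewrite scaler0 addr0 scaleN1r addNr.
  by rewrite normr0 addr0.
have Slin (a : R) u w : real_test u -> real_test w ->
    S (bdot_real (a *: u + w)) = a%:C%C * S (bdot_real u) + S (bdot_real w).
  by move=> tu tw; rewrite bdot_real_lin// DL1_lin.
have ReS (a : R) (z w : C) : complex.Re (a%:C%C * z + w) = a * complex.Re z + complex.Re w.
  by case: z w => [? ?] [? ?] /=; rewrite mul0r subr0.
have ImS (a : R) (z w : C) : complex.Im (a%:C%C * z + w) = a * complex.Im z + complex.Im w.
  by case: z w => [? ?] [? ?] /=; rewrite mul0r addr0.
have [f1 [c1 i1 n1 E1]] := lap_functional_density (P := real_test)
  (s := fun u => complex.Re (S (bdot_real u))) K'0 real_test0 real_test_lin
  real_test_bounded (@real_test_iter_lap (2 * n + m))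
  (fun a u w tu tw => etrans (congr1 (@complex.Re R) (Slin a u w tu tw)) (ReS _ _ _))
  (fun u M tu uM => le_trans (normc_Re _) (SK' u M tu uM)).
have [f2 [c2 i2 n2 E2]] := lap_functional_density (P := real_test)
  (s := fun u => complex.Im (S (bdot_real u))) K'0 real_test0 real_test_lin
  real_test_bounded (@real_test_iter_lap (2 * n + m))
  (fun a u w tu tw => etrans (congr1 (@complex.Im R) (Slin a u w tu tw)) (ImS _ _ _))
  (fun u M tu uM => le_trans (normc_Im _) (SK' u M tu uM)).
pose f x : C := (f1 x +i* f2 x)%C.
have Lf : L1 f by [].
exists f.
  split=> //; rewrite L1normE// lee_fin mulrDl mul1r.
  apply: (@le_trans _ _ (\int[mu]_t (`|f1 (row t)| + `|f2 (row t)|))).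
    apply: le_trans (ler_norm _) _; apply: rintegral_le.
    - exact: rintegrable_normc.
    - by apply: rintegrableD; exact: rintegrable_norm.
    - by move=> t; rewrite ger0_norm ?normc_ge0//; exact: normc_ReIm (f _).
  rewrite rintegralD; try exact: rintegrable_norm.
  have fin u : rintegrable u -> (\int[mu]_t `|(u t)%:E| <= (K' * 9 ^+ n)%:E)%E ->
      \int[mu]_t `|u t| <= K' * 9 ^+ n.
    move=> iu un; rewrite -lee_fin /Rintegral fineK//.
    exact: integrable_fin_num (rintegrable_norm iu).
  by apply: lerD; exact: fin.
move=> phi; rewrite [in LHS](bdot_re_im phi) DL1_lin.
set g := iter _ lap phi.
have [cg bg] := all_derivs_bounded_continuous (all_derivs_bounded_lap (2 * n + m) (Bdot_bounded phi)).
have /continuous_ReIm[/measurable_row mgr /measurable_row mgi] := cg.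
have [M gM] := bg.
have ip (u : Rn -> R) (pr : C -> R) : rintegrable (fun t => u (row t)) ->
    measurable_fun setT (fun t : n.-tuple (measurableTypeR R) => pr (g (row t))) ->
    (forall z, `|pr z| <= normc z) -> rintegrable (fun t => u (row t) * pr (g (row t))).
  by move=> iu mp prn; apply: rintegrableM iu mp (fun t => le_trans (prn _) (gM _)).
have i1r := ip _ _ i1 mgr (@normc_Re R); have i1i := ip _ _ i1 mgi (@normc_Im R).
have i2r := ip _ _ i2 mgr (@normc_Re R); have i2i := ip _ _ i2 mgi (@normc_Im R).
have gre : re g = iter (2 * n + m) rlap (re phi) by rewrite re_iter_lap.
have gim : im g = iter (2 * n + m) rlap (im phi) by rewrite im_iter_lap.
have := E1 _ (real_test_re phi); have := E1 _ (real_test_im phi).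
have := E2 _ (real_test_re phi); have := E2 _ (real_test_im phi).
rewrite -gre -gim => e1 e2 e3 e4; apply: complex_eq.
  rewrite -[RHS]/(\int[mu]_t re (fun x => f x * g x) (row t)).
  under [RHS]eq_Rintegral do rewrite reM.
  rewrite rintegralB// -[X in _ = X - _]e4 -[X in _ = _ - X]e1.
  by case: (S _) (S _) => [? ?] [? ?] /=; ring.
rewrite -[RHS]/(\int[mu]_t im (fun x => f x * g x) (row t)).
under [RHS]eq_Rintegral do rewrite imM.
rewrite rintegralD// -[X in _ = X + _]e3 -[X in _ = _ + X]e2.
by case: (S _) (S _) => [? ?] [? ?] /=; ring.
Qed.

(** From left to right the constants m and c depend only on the equicontinuity of
    B, so they serve all its elements. *)
Lemma bounded_bessel (B : set (DL1 R n)) : @tvs_bounded R[i] (DL1 R n) B <->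
  exists (m : nat) (c : R), 0 < c /\ B `<=` [set (c%:C)%C *: S | S in @bessel_B11 R n m].
Proof.
rewrite beta_bounded_equicontinuous; split=> [[m [K [K0 BK]]]|[m [c [c0 Bc]]]]; last first.
  exists (2 * m)%N, (c * (4 * (1 + n%:R) ^+ m)); split.
    by rewrite mulr_ge0 ?ltW// mulr_ge0// exprn_ge0.
  move=> _ /Bc[S /bessel_B11_equicontinuous SK <-] phi.
  rewrite -[X in normc X]/((c%:C%C : C) * S phi) normcM normc_real (gtr0_norm c0) -mulrA.
  by apply: ler_wpM2l; [exact: ltW|exact: SK].
exists (2 * n + m)%N; pose c := 2 * (K * (2 * 2 ^+ m) * 9 ^+ n) + 1.
have c0 : 0 < c by rewrite ltr_wpDl// !mulr_ge0// exprn_ge0.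
exists c; split=> // S BS; have [f [Lf fc] fS] := equicontinuous_density K0 (BK S BS).
have cC : (c%:C)%C != 0 :> C by apply/eqP => -[]; apply/eqP; rewrite gt_eqF.
(* S is c times the image of f / c, and f / c lies in the unit ball. *)
pose k : C := (c^-1)%:C%C.
have kE : k = (c%:C)%C^-1 by rewrite /k fmorphV.
exists (k *: S); last by rewrite scalerA kE mulfV// scale1r.
exists (fun x => k * f x).
  have LZ := L1Z k Lf; split=> //.
  rewrite L1normE//; rewrite L1normE// in fc.
  have -> : \int[mu]_t normc (k * f (row t)) = c^-1 * \int[mu]_t normc (f (row t)).
    rewrite -rintegralZ; last exact: rintegrable_normc.
    apply: eq_Rintegral => t _; rewrite normcM normc_real gtr0_norm// invr_gt0//.
  rewrite lee_fin ler_pdivrMl// mulr1; rewrite lee_fin in fc.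
  by apply: le_trans fc _; rewrite /c lerDl.
move=> phi; rewrite iter_dist_lapE; last exact: Bdot_bounded.
  rewrite -[LHS]/(k * S phi) fS /dist_of_fct.
  have Lm : L1 (fun x => f x * iter (2 * n + m) lap phi x).
    have [? ?] := all_derivs_bounded_continuous (all_derivs_bounded_lap (2 * n + m) (Bdot_bounded phi)).
    exact: L1_mul.
  by rewrite -integral_RnZ//; congr integral_Rn; apply/funext => x; rewrite mulrA.
exact/dist_of_fct_linear/L1Z.
Qed.

End bounded_sets_by_densities.

(** * Truncation of test functions *)

Section leibniz.
Local Transparent rpartial unit_vec.
Variables (R : realType) (n : nat).
Local Notation Rn := 'rV[R]_n.
Local Notation rD s u := (iter_deriv (@rpartial R n) s u).
Implicit Types (u w : Rn -> R) (s : seq 'I_n).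

Lemma is_derive_of_line u x v (d : R) :
  is_derive (0 : R) (1 : R) (fun s : R => u (x + s *: v)) d -> is_derive x v u d.
Proof.
have E : (fun h => h^-1 *: (((fun s : R => u (x + s *: v)) \o shift 0) (h *: 1) -
      u (x + 0 *: v))) =
    (fun h => h^-1 *: ((u \o shift x) (h *: v) - u x)).
  apply/funext => h /=; congr (_ *: (u _ - u _)).
    by rewrite [h *: 1]mulr1 addr0 addrC.
  by rewrite scale0r addr0.
by case=> du <-; split; rewrite /derivable /derive -E.
Qed.

Lemma rpartial_is_derive u i (d : Rn -> R) :
  (forall x, is_derive x (unit_vec R i) u (d x)) -> rpartial i u = d.
Proof. by move=> du; apply/funext => x; case: (du x). Qed.

Lemma is_derive_rpartial u i x : derivable u x (unit_vec R i) ->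
  is_derive x (unit_vec R i) u (rpartial i u x).
Proof. by move=> du; split. Qed.

Local Opaque rpartial unit_vec.

Lemma is_derive_mul u w i x : derivable u x (unit_vec R i) -> derivable w x (unit_vec R i) ->
  is_derive x (unit_vec R i) (fun y => u y * w y) (rpartial i u x * w x + u x * rpartial i w x).
Proof.
move=> /is_derive_rpartial du /is_derive_rpartial dw.
have -> : rpartial i u x * w x + u x * rpartial i w x =
    u x *: rpartial i w x + w x *: rpartial i u x.
  by rewrite addrC [w x *: _]mulrC.
exact: is_deriveM.
Qed.

(** The ways to distribute the letters of s over two words, in order. *)
Fixpoint splits s : seq (seq 'I_n * seq 'I_n) :=
  if s is i :: s' then [seq (i :: p.1, p.2) | p <- splits s'] ++
                       [seq (p.1, i :: p.2) | p <- splits s']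
  else [:: ([::], [::])].

Lemma size_splits s : size (splits s) = (2 ^ size s)%N.
Proof. by elim: s => // i s IH; rewrite /= size_cat !size_map IH addnn -mul2n expnS. Qed.

Lemma splits_sizes s p : p \in splits s -> (size p.1 <= size s)%N && (size p.2 <= size s)%N.
Proof.
elim: s p => [|i s IH] p /=; first by rewrite inE => /eqP ->.
rewrite mem_cat => /orP[] /mapP[q /IH /andP[q1 q2] ->] /=.
  by rewrite !ltnS q1 leqW.
by rewrite !ltnS q2 leqW.
Qed.

Definition leibniz_sum s u w x : R := \sum_(p <- splits s) rD p.1 u x * rD p.2 w x.

(** Differentiating once more either lengthens the first or the second word. *)
Lemma leibniz_sum_derive s u w i x : rsmooth u -> rsmooth w ->
  is_derive x (unit_vec R i) (leibniz_sum s u w) (leibniz_sum (i :: s) u w x).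
Proof.
move=> su sw; rewrite {2}/leibniz_sum /= big_cat /= !big_map -big_split /=.
have := fun p : seq 'I_n * seq 'I_n => is_derive_mul
  (@rsmooth_derivable _ _ _ i x (rsmooth_iter p.1 su))
  (@rsmooth_derivable _ _ _ i x (rsmooth_iter p.2 sw)).
rewrite /leibniz_sum => H; elim: (splits s) => [|p r IH].
  rewrite big_nil (_ : (fun _ => _) = cst 0); first exact: is_derive_cst.
  by apply/funext => y; rewrite big_nil.
rewrite big_cons (_ : (fun _ => _) = (fun y => rD p.1 u y * rD p.2 w y) +
   (fun y => \sum_(p <- r) rD p.1 u y * rD p.2 w y)).
  exact: is_deriveD (H p) IH.
by apply/funext => y; rewrite big_cons.
Qed.

Lemma continuous_leibniz_sum s u w : rsmooth u -> rsmooth w -> continuous (leibniz_sum s u w).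
Proof.
move=> su sw; apply: fun_continuous_sum => p; apply: fun_continuousM.
  by have [] := rsmoothP p.1 su.
by have [] := rsmoothP p.2 sw.
Qed.

Lemma leibniz s u w : rsmooth u -> rsmooth w ->
  rD s (fun y => u y * w y) = leibniz_sum s u w.
Proof.
move=> su sw; elim: s => [|i s IH].
  by apply/funext => x; rewrite /leibniz_sum big_seq1.
rewrite iter_deriv_cons IH; apply: rpartial_is_derive => x.
exact: leibniz_sum_derive.
Qed.

Lemma rsmoothM u w : rsmooth u -> rsmooth w -> rsmooth (fun y => u y * w y).
Proof.
move=> su sw; split=> s; rewrite leibniz//; split; first exact: continuous_leibniz_sum.
by move=> i x; case: (leibniz_sum_derive s i x su sw).
Qed.

Lemma is_derive_dilation u i (e : R) x : rsmooth u ->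
  is_derive x (unit_vec R i) (fun y => u (e *: y)) (e * rpartial i u (e *: x)).
Proof.
move=> su; apply: is_derive_of_line.
have d1 : is_derive (0 : R) (1 : R) (fun s : R => e * s) e.
  have := is_deriveZ e (is_derive_id (0 : R) (1 : R)).
  by rewrite [_ *: 1]mulr1.
have d2 := rsmooth_is_derive i (e *: x) (e * 0) su.
have := is_derive1_comp d2 d1; rewrite mulr0 scale0r addr0 mulrC.
set F := _ \o _; rewrite (_ : F = (fun s : R => u (e *: (x + s *: unit_vec R i))))//.
by apply/funext => s; rewrite /F /= scalerDr scalerA.
Qed.

(** The powers of e make the derivatives of order at least 1 of the dilated bump
    tend to 0 with e. *)
Lemma iter_rpartial_dilation u (e : R) s : rsmooth u ->
  rD s (fun y => u (e *: y)) = (fun y => e ^+ size s * rD s u (e *: y)).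
Proof.
move=> su; elim: s => [|i s IH]; first by apply/funext => x; rewrite mul1r.
rewrite iter_deriv_cons IH; apply: rpartial_is_derive => x.
rewrite [size _]/= exprSr -mulrA.
exact: is_deriveZ (is_derive_dilation i e x (rsmooth_iter s su)).
Qed.

Lemma continuous_scale (e : R) : continuous (fun y : Rn => e *: y).
Proof. exact: scaler_continuous. Qed.

Lemma rsmooth_dilation u (e : R) : rsmooth u -> rsmooth (fun y => u (e *: y)).
Proof.
move=> su; split=> s; rewrite iter_rpartial_dilation//; split.
  apply: fun_continuousM; first exact: fun_continuous_cst.
  move=> x; apply: (@continuous_comp _ _ _ (fun y : Rn => e *: y) (rD s u)).
    exact: continuous_scale.
  by have [c _] := rsmoothP s su; exact: c.
move=> i x.
by case: (is_deriveZ (e ^+ size s) (is_derive_dilation i e x (rsmooth_iter s su))).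
Qed.

End leibniz.

Section bump.
Variables (R : realType) (n : nat).
Local Notation Rn := 'rV[R]_n.
Local Notation rD s u := (iter_deriv (@rpartial R n) s u).
Local Opaque rpartial unit_vec.

(** Smooth, equal to 1 at 0, vanishing at infinity with all derivatives. *)
Definition bump (x : Rn) : R := (1 + sqnorm x)^-1.

(** The algebra without unit generated by q x = 1 / (1 + |x|^2) and the functions
    x_j q; it is stable under partial derivatives, as
    d_i q = -2 (x_i q) q, and its members vanish at infinity. *)
Inductive bump_algebra : (Rn -> R) -> Prop :=
| BumpQ : bump_algebra bump
| BumpP j : bump_algebra (fun x => x 0 j * bump x)
| BumpD u w : bump_algebra u -> bump_algebra w -> bump_algebra (fun x => u x + w x)
| BumpZ a u : bump_algebra u -> bump_algebra (fun x => a * u x)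
| BumpM u w : bump_algebra u -> bump_algebra w -> bump_algebra (fun x => u x * w x).

Lemma bump_den (x : Rn) : 0 < 1 + sqnorm x.
Proof. by rewrite ltr_wpDr// sqnorm_ge0. Qed.

Lemma is_derive_bump i x : is_derive x (unit_vec R i) bump (-2 * (x 0 i * bump x * bump x)).
Proof.
apply: is_derive_of_line.
pose g (t : R) : R := 1 + sqnorm x + (2 * x 0 i * t + t ^+ 2).
have dg : is_derive (0 : R) (1 : R) g (2 * x 0 i).
  have d1 : is_derive (0 : R) (1 : R) (fun t : R => 2 * x 0 i * t) (2 * x 0 i).
    by have := is_deriveZ (2 * x 0 i) (is_derive_id (0 : R) (1 : R)); rewrite [_ *: 1]mulr1.
  have d2 : is_derive (0 : R) (1 : R) (fun t : R => t ^+ 2) 0.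
    have := is_deriveX 2 (is_derive_id (0 : R) (1 : R)).
    by rewrite expr1 mulr0 scale0r.
  have := is_deriveD (is_derive_cst (1 + sqnorm x) (0 : R) (1 : R)) (is_deriveD d1 d2).
  by rewrite add0r addr0.
have g0 : g 0 = 1 + sqnorm x by rewrite /g mulr0 expr0n /= !addr0.
have gn : g 0 != 0 by rewrite g0 gt_eqF// bump_den.
have := is_deriveV gn dg.
rewrite (_ : (fun y => (g y)^-1) = (fun t => bump (x + t *: unit_vec R i))); last first.
  by apply/funext => t; rewrite /bump sqnorm_line addrA.
rewrite g0 (_ : - _ *: _ = -2 * (x 0 i * bump x * bump x))//.
by rewrite /bump -[LHS]/(- (1 + sqnorm x) ^- 2 * (2 * x 0 i)) -exprVn expr2; ring.
Qed.

Lemma is_derive_coord i j (x : Rn) : is_derive x (unit_vec R i) (fun y : Rn => y 0 j) (j == i)%:R.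
Proof.
apply: is_derive_of_line.
have -> : (fun s : R => (x + s *: unit_vec R i) 0 j) = (fun s => x 0 j + (j == i)%:R * s).
  by apply/funext => s; rewrite coord_line mulrC.
have := is_deriveD (is_derive_cst (x 0 j) (0 : R) (1 : R))
  (is_deriveZ (j == i)%:R (is_derive_id (0 : R) (1 : R))).
by rewrite add0r [_ *: 1]mulr1.
Qed.

Lemma bump_algebra_derive u : bump_algebra u -> forall i,
  exists2 d, bump_algebra d & forall x, is_derive x (unit_vec R i) u (d x).
Proof.
elim=> {u} [|j|u w _ IHu _ IHw|a u _ IHu|u w bu IHu bw IHw] i.
- exists (fun x : Rn => -2 * (x 0 i * bump x * bump x)); last exact: is_derive_bump.
  by apply: BumpZ; apply: BumpM BumpQ; exact: BumpP.
- exists (fun x : Rn => (j == i)%:R * bump x + -2 * ((x 0 i * bump x) * (x 0 j * bump x))).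
    by apply: BumpD; [apply: BumpZ; exact: BumpQ|apply/BumpZ/BumpM; exact: BumpP].
  move=> x; have := is_deriveM (is_derive_coord i j x) (is_derive_bump i x).
  rewrite (_ : _ *: _ + _ *: _ = (j == i)%:R * bump x + -2 * ((x 0 i * bump x) * (x 0 j * bump x)))//.
  rewrite -[LHS]/(x 0 j * (-2 * (x 0 i * bump x * bump x)) + bump x * (j == i)%:R); ring.
- have [du bdu Hu] := IHu i; have [dw bdw Hw] := IHw i.
  exists (fun x => du x + dw x); first exact: BumpD.
  by move=> x; exact: is_deriveD (Hu x) (Hw x).
- have [du bdu Hu] := IHu i; exists (fun x => a * du x); first exact: BumpZ.
  by move=> x; have := is_deriveZ a (Hu x).
- have [du bdu Hu] := IHu i; have [dw bdw Hw] := IHw i.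
  exists (fun x => u x * dw x + w x * du x); first by apply: BumpD; exact: BumpM.
  by move=> x; exact: is_deriveM (Hu x) (Hw x).
Qed.

Definition vanishing (u : Rn -> R) := continuous u /\
  forall e : R, 0 < e -> exists r : R, forall x, r < `|x| -> `|u x| < e.

Lemma vanishing_bounded u : vanishing u -> exists2 M : R, 0 <= M & forall x, `|u x| <= M.
Proof.
move=> [cu vu]; have [|e e0|M uM] := @vanishes_bounded R n (fun x => (u x)%:C%C).
- by apply/continuous_ReIm; split=> //; exact: cst_continuous.
- by have [r ur] := vu e e0; exists r => x /ur; rewrite normc_real.
have uM' x : `|u x| <= M by rewrite -normc_real.
by exists M => //; exact: le_trans (uM' 0).
Qed.

Lemma vanishingD u w : vanishing u -> vanishing w -> vanishing (fun x => u x + w x).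
Proof.
move=> [cu vu] [cw vw]; split; first exact: fun_continuousD.
move=> e e0; have e2 : 0 < e / 2 by rewrite divr_gt0.
have [r ur] := vu _ e2; have [q wq] := vw _ e2.
exists (Num.max r q) => x; rewrite gt_max => /andP[/ur xr /wq xq].
by apply: le_lt_trans (ler_normD _ _) _; rewrite [ltRHS]splitr ltrD.
Qed.

Lemma vanishingM u w (M : R) : vanishing u -> continuous w -> (forall x, `|w x| <= M) ->
  vanishing (fun x => u x * w x).
Proof.
move=> [cu vu] cw wM; split; first exact: fun_continuousM.
move=> e e0; have M1 : 0 < M + 1 by rewrite ltr_wpDl// (le_trans _ (wM 0)).
have [r ur] := vu _ (divr_gt0 e0 M1); exists r => x /ur; rewrite ltr_pdivlMr// normrM.
by apply: le_lt_trans; rewrite ler_wpM2l// (le_trans (wM x))// lerDl.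
Qed.

Lemma continuous_bump : continuous bump.
Proof.
have c : continuous (fun y : Rn => 1 + sqnorm y).
  by apply: fun_continuousD; [exact: fun_continuous_cst|exact: sqnorm_continuous].
move=> x; have nz : 1 + sqnorm x != 0 by rewrite gt_eqF// bump_den.
exact: cvgV nz (c x).
Qed.

(** Applied with b the value of the bump at a point of norm a. *)
Lemma bump_decay (a b e : R) : 0 < b -> b * a ^+ 2 <= 1 -> 0 < e -> 1 + e^-1 < a ->
  b < e /\ b * a < e.
Proof.
move=> b0 ba e0 ea; have e1 : 0 < e^-1 by rewrite invr_gt0.
have a1 : 1 < a by lra.
have ae : 1 < e * a by rewrite -ltr_pdivrMl// mulr1; lra.
have h : b * a < e.
  rewrite -(ltr_pM2r (lt_trans ltr01 a1)); apply: le_lt_trans ae.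
  by rewrite -mulrA -expr2.
by split=> //; apply: lt_trans h; rewrite ltr_pMr.
Qed.

Lemma bump_algebra_vanishing u : bump_algebra u -> vanishing u.
Proof.
have bd (x : Rn) : bump x * `|x| ^+ 2 <= 1.
  rewrite /bump mulrC ler_pdivrMr ?bump_den// mul1r.
  by apply: le_trans (norm_le_sqnorm x) _; rewrite lerDr.
have b0 (x : Rn) : 0 < bump x by rewrite invr_gt0 bump_den.
elim=> {u} [|j|u w _ [cu vu] _ [cw vw]|a u _ [cu vu]|u w _ [cu vu] _ [cw vw]].
- split; first exact: continuous_bump.
  move=> e e0; exists (1 + e^-1) => x xr; rewrite gtr0_norm//.
  by case: (bump_decay (b0 x) (bd x) e0 xr).
- split; first by apply: fun_continuousM; [exact: continuous_coord|exact: continuous_bump].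
  move=> e e0; exists (1 + e^-1) => x xr; rewrite normrM (gtr0_norm (b0 x)).
  apply: le_lt_trans (bump_decay (b0 x) (bd x) e0 xr).2.
  by rewrite mulrC; apply: ler_wpM2l; [exact: ltW|exact: norm_coord].
- exact: vanishingD.
- split; first by apply: fun_continuousM => //; exact: fun_continuous_cst.
  move=> e e0; have a1 : 0 < `|a| + 1 by rewrite ltr_wpDl.
  have [r ur] := vu _ (divr_gt0 e0 a1); exists r => x /ur; rewrite ltr_pdivlMr// (mulrC a) normrM.
  by apply: le_lt_trans; rewrite ler_wpM2l// lerDl.
- have [M _ wM] := vanishing_bounded (conj cw vw).
  exact: vanishingM wM.
Qed.

Lemma bump_algebra_iter u s : bump_algebra u -> bump_algebra (rD s u).
Proof.
move=> bu; elim: s => // i s IH; rewrite iter_deriv_cons.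
by have [d bd /rpartial_is_derive ->] := bump_algebra_derive IH i.
Qed.

Lemma real_test_bump : real_test bump.
Proof.
have b s : bump_algebra (rD s bump) by apply: bump_algebra_iter; exact: BumpQ.
split; last by move=> s; case: (bump_algebra_vanishing (b s)).
split=> s; split; first by case: (bump_algebra_vanishing (b s)).
by move=> i x; have [d _ dP] := bump_algebra_derive (b s) i; case: (dP x).
Qed.

End bump.

Section cutoff.
Variables (R : realType) (n : nat).
Local Notation Rn := 'rV[R]_n.
Local Notation C := (R[i]^o).
Local Notation rD s u := (iter_deriv (@rpartial R n) s u).
Local Notation D s f := (iter_deriv (@partial R n) s f).
Implicit Types (phi : DLinf R n).

Definition scale_at k : R := k.+1%:R^-1.

Definition cutoff k (x : Rn) : R := bump (scale_at k *: x).

Lemma scale_at_gt0 k : 0 < scale_at k.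
Proof. by rewrite invr_gt0. Qed.

Lemma scale_at_le1 k : scale_at k <= 1.
Proof. by rewrite invf_le1// ler1n. Qed.

Lemma cvg_scale_at : scale_at k @[k --> \oo] --> (0 : R).
Proof. exact: cvg_harmonic. Qed.

Lemma rsmooth_bump : rsmooth (@bump R n).
Proof. by case: (@real_test_bump R n). Qed.

Lemma rsmooth_cutoff k : rsmooth (cutoff k).
Proof. exact: rsmooth_dilation rsmooth_bump. Qed.

Lemma iter_cutoff k s x : rD s (cutoff k) x = scale_at k ^+ size s * rD s (@bump R n) (scale_at k *: x).
Proof. by rewrite (iter_rpartial_dilation (scale_at k) s rsmooth_bump). Qed.

(** The bound does not depend on the scale, as dilations by a factor at most 1 do
    not increase the norms of derivatives. *)
Lemma cutoff_bound m : exists2 M : R, 0 <= M & forall k s x, (size s <= m)%N -> `|rD s (cutoff k) x| <= M.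
Proof.
have [M M0 bM] := derivs_le_exists m (Bdot_bounded (bdot_real (@bump R n))).
exists M => // k s x sm; rewrite iter_cutoff normrM.
have e1 : `|scale_at k ^+ size s| <= 1.
  rewrite normrX ger0_norm ?(ltW (scale_at_gt0 _))//.
  by rewrite exprn_ile1// ?scale_at_le1// ltW// scale_at_gt0.
apply: (@le_trans _ _ (1 * M)); last by rewrite mul1r.
apply: ler_pM => //; have := bM s (scale_at k *: x) sm.
rewrite bdot_realE; last exact: real_test_bump.
by rewrite iter_partial_of_real normc_real.
Qed.

Lemma cutoff_vanishing k s : vanishing (rD s (cutoff k)).
Proof.
split; first by have [] := rsmoothP s (rsmooth_cutoff k).
move=> e e0; have [_ /(_ s e e0)[r br]] := @real_test_bump R n.
exists (r / scale_at k) => x; rewrite ltr_pdivrMr ?scale_at_gt0// => xr.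
rewrite iter_cutoff normrM.
have e1 : `|scale_at k ^+ size s| <= 1.
  rewrite normrX ger0_norm ?(ltW (scale_at_gt0 _))//.
  by rewrite exprn_ile1// ?scale_at_le1// ltW// scale_at_gt0.
apply: (@le_lt_trans _ _ (1 * `|rD s (@bump R n) (scale_at k *: x)|)).
  by rewrite ler_wpM2r.
by rewrite mul1r; apply: br; rewrite normrZ gtr0_norm ?scale_at_gt0// mulrC.
Qed.

Lemma cvg_cutoff s x : rD s (cutoff k) x @[k --> \oo] --> rD s (cst 1 : Rn -> R) x.
Proof.
have cv0 := cvg_scale_at.
rewrite iter_rpartial_cst; case: s => [|i s] /=.
  have -> : (1 : R) = @bump R n 0.
    rewrite /bump /sqnorm big1 ?addr0 ?invr1// => j _; by rewrite mxE expr0n.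
  have c0 : scale_at k *: x @[k --> \oo] --> (0 : Rn).
    rewrite -[X in _ --> X](scale0r x); exact: cvgZr_tmp.
  exact: (@cvg_comp _ _ _ (fun k => scale_at k *: x) (@bump R n) _ _ _ c0 (@continuous_bump R n 0)).
have [M M0 bM] := cutoff_bound (size s).+1.
have [N N0 bN] := derivs_le_exists (size s).+1 (Bdot_bounded (bdot_real (@bump R n))).
apply/cvgrPdist_le => e e0.
have N1 : 0 < N + 1 by rewrite ltr_wpDl.
have /cvgrPdist_le/(_ _ (divr_gt0 e0 N1)) := cv0.
apply: filterS => k; rewrite sub0r normrN (gtr0_norm (scale_at_gt0 k)) => ke.
rewrite sub0r normrN -iter_deriv_cons iter_cutoff normrM.
have := bN (i :: s) (scale_at k *: x) (leqnn _).
rewrite bdot_realE; last exact: real_test_bump.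
rewrite iter_partial_of_real normc_real => bNx.
apply: (@le_trans _ _ (e / (N + 1) * N)).
  apply: ler_pM => //; rewrite exprS normrM normrX gtr0_norm ?scale_at_gt0//.
  apply: le_trans ke; rewrite ler_piMr ?(ltW (scale_at_gt0 _))//.
  by rewrite exprn_ile1// ?scale_at_le1// ltW// scale_at_gt0.
by rewrite -mulrA ler_piMr ?ltW// mulrC ltr_pdivrMr// mul1r ltrDl.
Qed.

Lemma leibniz_bound s (u w : Rn -> R) x (A U : R) : rsmooth u -> rsmooth w ->
  (forall t, (size t <= size s)%N -> `|rD t u x| <= A) ->
  (forall t, (size t <= size s)%N -> `|rD t w x| <= U) ->
  `|rD s (fun y => u y * w y) x| <= 2 ^+ size s * (A * U).
Proof.
move=> su sw uA wU; rewrite leibniz// /leibniz_sum.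
apply: le_trans (ler_norm_sum _ _ _) _.
apply: (@le_trans _ _ (\sum_(p <- splits s) A * U)).
  rewrite big_seq [leRHS]big_seq; apply: ler_sum => p /splits_sizes /andP[p1 p2].
  by rewrite normrM; apply: ler_pM => //; [exact: uA|exact: wU].
have -> : \sum_(p <- splits s) A * U = (2 ^ size s)%:R * (A * U).
  by rewrite big_const_seq count_predT iter_addr_0 size_splits mulr_natl.
by rewrite natrX.
Qed.

Lemma vanishing_cutoffM k s (w : Rn -> R) : bounded_derivs w ->
  vanishing (rD s (fun y => cutoff k y * w y)).
Proof.
move=> bw; rewrite leibniz; [|exact: rsmooth_cutoff|exact: bounded_derivs_smooth].
rewrite /leibniz_sum; elim: (splits s) => [|p r IH].
  under eq_fun do rewrite big_nil.
  split; first exact: fun_continuous_cst.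
  by move=> e e0; exists 0 => x _; rewrite normr0.
under eq_fun do rewrite big_cons.
apply: vanishingD => //; have [M _ wM] := bounded_derivsP p.2 bw.
apply: vanishingM wM; first exact: cutoff_vanishing.
by have [] := rsmoothP p.2 (bounded_derivs_smooth bw).
Qed.

Lemma cvg_big_seq (T I : Type) (F : set_system T) {FF : Filter F} (r : seq I)
    (f : T -> I -> R) (l : I -> R) :
  (forall p, f t p @[t --> F] --> l p) ->
  \sum_(p <- r) f t p @[t --> F] --> \sum_(p <- r) l p.
Proof.
move=> H; elim: r => [|p r IH].
  rewrite (_ : (fun t => _) = cst 0); first by rewrite big_nil; exact: cvg_cst.
  by apply/funext => t; rewrite big_nil.
rewrite (_ : (fun t => _) = (fun t => f t p + \sum_(q <- r) f t q)).
  by rewrite big_cons; apply: cvgD.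
by apply/funext => t; rewrite big_cons.
Qed.

(** The Leibniz formula for the product with the constant 1 identifies the limit. *)
Lemma cvg_cutoffM s (w : Rn -> R) x : rsmooth w ->
  rD s (fun y => cutoff k y * w y) x @[k --> \oo] --> rD s w x.
Proof.
move=> sw; have -> : rD s w x = rD s (fun y => (cst 1 : Rn -> R) y * w y) x.
  by congr (iter_deriv _ s _ x); apply/funext => y; rewrite mul1r.
rewrite leibniz//; last exact: rsmooth_cst.
under eq_fun do rewrite (leibniz _ (rsmooth_cutoff _) sw).
apply: (cvg_big_seq (f := fun k p => rD p.1 (cutoff k) x * rD p.2 w x)
  (l := fun p => rD p.1 (cst 1 : Rn -> R) x * rD p.2 w x)) => p.
by apply: cvgMr_tmp; exact: cvg_cutoff.
Qed.

Definition cutoff_fct k phi : Rn -> C := fun x => (cutoff k x)%:C%C * phi x.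

Lemma re_cutoff k phi : re (cutoff_fct k phi) = (fun x => cutoff k x * re phi x).
Proof. by apply/funext => x; rewrite reM /re /im /= mul0r subr0. Qed.

Lemma im_cutoff k phi : im (cutoff_fct k phi) = (fun x => cutoff k x * im phi x).
Proof. by apply/funext => x; rewrite imM /re /im /= mul0r addr0. Qed.

Lemma smooth_cutoff k phi : smooth (cutoff_fct k phi).
Proof.
have /smoothE[sr si] := DLinf_smooth phi.
by apply/smoothE; rewrite re_cutoff im_cutoff; split; apply: rsmoothM => //; exact: rsmooth_cutoff.
Qed.

Lemma vanishes_cutoff k phi s : vanishes_at_infinity (D s (cutoff_fct k phi)).
Proof.
move=> e e0; have e2 : 0 < e / 2 by rewrite divr_gt0.
have [_ /(_ _ e2)[r h1]] := vanishing_cutoffM k s (all_derivs_bounded_re (DLinf_bounded phi)).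
have [_ /(_ _ e2)[q h2]] := vanishing_cutoffM k s (all_derivs_bounded_im (DLinf_bounded phi)).
exists (Num.max r q) => x; rewrite gt_max => /andP[/h1 xr /h2 xq].
apply: le_lt_trans (normc_ReIm _) _; rewrite -/(re _ x) -/(im _ x) re_iter_partial im_iter_partial.
by rewrite re_cutoff im_cutoff [ltRHS]splitr ltrD.
Qed.

Definition cut k phi : Bdot R n := bdot_of (smooth_cutoff k phi) (vanishes_cutoff k phi).

Lemma cut_bound m : exists2 A : R, 0 <= A &
  forall k phi, cm m (cut k phi) <= A * cm m phi.
Proof.
have [M M0 cM] := cutoff_bound m; exists (2 * 2 ^+ m * M).
  by rewrite !mulr_ge0// exprn_ge0.
move=> k phi; have bphi := DLinf_bounded phi; apply/cm_le; first exact: Bdot_bounded.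
move=> s x sm; have [sc bc] := bphi; have /smoothE[sr si] := sc.
have K0 := cm_ge0 m phi.
have part (u : Rn -> R) : rsmooth u ->
    (forall t, (size t <= m)%N -> `|rD t u x| <= cm m phi) ->
    `|rD s (fun y => cutoff k y * u y) x| <= 2 ^+ m * (M * cm m phi).
  move=> su um; apply: (@le_trans _ _ (2 ^+ size s * (M * cm m phi))).
    apply: leibniz_bound => //; first exact: rsmooth_cutoff.
      by move=> t ts; apply: cM; exact: leq_trans ts sm.
    by move=> t ts; apply: um; exact: leq_trans ts sm.
  by rewrite ler_wpM2r ?mulr_ge0// ler_weXn2l// ler1n.
apply: le_trans (normc_ReIm _) _; rewrite -/(re _ x) -/(im _ x) re_iter_partial im_iter_partial.
rewrite re_cutoff im_cutoff -!mulrA mulrDl mul1r; apply: lerD; apply: part => // t tm.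
  exact: (derivs_le_re x (cm_derivs bphi) tm).
exact: (derivs_le_im x (cm_derivs bphi) tm).
Qed.

Lemma cvg_cut_re s phi x : re (D s (cut k phi)) x @[k --> \oo] --> re (D s phi) x.
Proof.
rewrite re_iter_partial; under eq_fun do rewrite re_iter_partial re_cutoff.
by apply: cvg_cutoffM; have /smoothE[] := DLinf_smooth phi.
Qed.

Lemma cvg_cut_im s phi x : im (D s (cut k phi)) x @[k --> \oo] --> im (D s phi) x.
Proof.
rewrite im_iter_partial; under eq_fun do rewrite im_iter_partial im_cutoff.
by apply: cvg_cutoffM; have /smoothE[] := DLinf_smooth phi.
Qed.

Lemma cvg_complex (T : Type) (F : set_system T) {FF : Filter F} (f : T -> C) (z : C) :
  complex.Re (f t) @[t --> F] --> complex.Re z -> complex.Im (f t) @[t --> F] --> complex.Im z ->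
  f @ F --> z.
Proof.
move=> cr ci; apply/cvg_normcP => e e0; have e2 : 0 < e / 2 by rewrite divr_gt0.
have /cvgrPdist_lt/(_ _ e2) h1 := cr; have /cvgrPdist_lt/(_ _ e2) h2 := ci.
apply: filterS2 h1 h2 => t t1 t2; apply: le_lt_trans (normc_ReIm _) _.
by rewrite [ltRHS]splitr !raddfB ltrD.
Qed.

Lemma cvg_cut s phi x : D s (cut k phi) x @[k --> \oo] --> (D s phi x : C).
Proof. by apply: cvg_complex; [exact: cvg_cut_re|exact: cvg_cut_im]. Qed.

End cutoff.

(** * The extended pairing *)

Section pairing_facts.
Variables (R : realType) (n : nat).
Local Notation Rn := 'rV[R]_n.
Local Notation C := (R[i]^o).
Local Notation mu := (lebesgue R n).
Local Notation row t := (row_of_tuple t).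
Local Notation D s f := (iter_deriv (@partial R n) s f).
Local Notation lap := (one_minus_laplacian (@partial R n)).
Implicit Types (phi : DLinf R n) (S : DL1 R n).

Lemma cvg_rintegral (u : n.-tuple (measurableTypeR R) -> R)
    (g : nat -> n.-tuple (measurableTypeR R) -> R) (h : n.-tuple (measurableTypeR R) -> R) (M : R) :
  rintegrable u -> (forall k, measurable_fun setT (g k)) -> (forall k t, `|g k t| <= M) ->
  (forall t, g k t @[k --> \oo] --> h t) ->
  \int[mu]_t (u t * g k t) @[k --> \oo] --> \int[mu]_t (u t * h t).
Proof.
move=> iu mg gM gh.
have ik k : rintegrable (fun t => u t * g k t) by exact: rintegrableM (mg k) (gM k).
have id_ : rintegrable (fun t => M * `|u t|) by apply: rintegrableZ; exact: rintegrable_norm.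
have mh : measurable_fun setT h.
  by apply: (measurable_fun_cvg (h := g)) => // t _; exact: gh.
have hM t : `|h t| <= M.
  by apply: (cvgr_to_le (cvg_norm (gh t))); apply: nearW => k; exact: gM.
have ih : rintegrable (fun t => u t * h t) by exact: rintegrableM mh hM.
have cv t : (u t * g k t)%:E @[k --> \oo] --> (u t * h t)%:E.
  by apply: cvg_EFin; [apply: nearW|apply: cvgMl_tmp; exact: gh].
have dom k t : (`|(u t * g k t)%:E| <= (M * `|u t|)%:E)%E.
  by rewrite lee_fin normrM mulrC ler_wpM2r.
have := @dominated_cvg _ _ _ mu setT measurableT
  (fun k t => (u t * g k t)%:E) (fun t => (u t * h t)%:E) (fun t => (M * `|u t|)%:E)
  (fun k => measurable_int mu (ik k)) (fun t _ => cv t) (fun t _ => isT) id_ (fun k t _ => dom k t).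
move=> H; apply: (fine_cvg (f := fun k => (\int[mu]_t (u t * g k t)%:E)%E)).
rewrite fineK; last exact: integrable_fin_num ih.
exact: H.
Qed.

Lemma cvg_integral_Rn (f : Rn -> C) (g : nat -> Rn -> C) (h : Rn -> C) (M : R) :
  L1 f -> (forall k, continuous (g k)) -> continuous h -> (forall k x, normc (g k x) <= M) ->
  (forall x, re (g k) x @[k --> \oo] --> re h x) ->
  (forall x, im (g k) x @[k --> \oo] --> im h x) ->
  integral_Rn (fun x => f x * g k x) @[k --> \oo] --> (integral_Rn (fun x => f x * h x) : C).
Proof.
move=> Lf cg ch gM gr gi; have /L1E[fr fi] := Lf.
have mr k : measurable_fun setT (fun t => re (g k) (row t)).
  by have /continuous_ReIm[/measurable_row] := cg k.
have mi k : measurable_fun setT (fun t => im (g k) (row t)).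
  by have /continuous_ReIm[_ /measurable_row] := cg k.
have Mr k t : `|re (g k) (row t)| <= M by apply: le_trans (normc_Re _) (gM k _).
have Mi k t : `|im (g k) (row t)| <= M by apply: le_trans (normc_Im _) (gM k _).
have bh x : normc (h x) <= M + M.
  apply: le_trans (normc_ReIm _) _; apply: lerD.
    apply: (cvgr_to_le (cvg_norm (gr x))); apply: nearW => k.
    by apply: le_trans (normc_Re _) (gM k _).
  apply: (cvgr_to_le (cvg_norm (gi x))); apply: nearW => k.
  by apply: le_trans (normc_Im _) (gM k _).
have mhr : measurable_fun setT (fun t => re h (row t)).
  by have /continuous_ReIm[/measurable_row] := ch.
have mhi : measurable_fun setT (fun t => im h (row t)).
  by have /continuous_ReIm[_ /measurable_row] := ch.
have Mhr t : `|re h (row t)| <= M + M by apply: le_trans (normc_Re _) (bh _).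
have Mhi t : `|im h (row t)| <= M + M by apply: le_trans (normc_Im _) (bh _).
have crr := cvg_rintegral fr mr Mr (fun t => gr (row t)).
have cri := cvg_rintegral fr mi Mi (fun t => gi (row t)).
have cir := cvg_rintegral fi mr Mr (fun t => gr (row t)).
have cii := cvg_rintegral fi mi Mi (fun t => gi (row t)).
have ReE (g0 : Rn -> C) (N : R) : measurable_fun setT (fun t => re g0 (row t)) ->
    measurable_fun setT (fun t => im g0 (row t)) ->
    (forall t, `|re g0 (row t)| <= N) -> (forall t, `|im g0 (row t)| <= N) ->
    complex.Re (integral_Rn (fun x => f x * g0 x)) =
      \int[mu]_t (re f (row t) * re g0 (row t)) - \int[mu]_t (im f (row t) * im g0 (row t)) /\
    complex.Im (integral_Rn (fun x => f x * g0 x)) =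
      \int[mu]_t (re f (row t) * im g0 (row t)) + \int[mu]_t (im f (row t) * re g0 (row t)).
  move=> m1 m2 b1 b2; split.
    rewrite -[LHS]/(\int[mu]_t re (fun x => f x * g0 x) (row t)).
    under eq_Rintegral do rewrite reM.
    by rewrite rintegralB//; [exact: rintegrableM m1 b1|exact: rintegrableM m2 b2].
  rewrite -[LHS]/(\int[mu]_t im (fun x => f x * g0 x) (row t)).
  under eq_Rintegral do rewrite imM.
  by rewrite rintegralD//; [exact: rintegrableM m2 b2|exact: rintegrableM m1 b1].
apply: cvg_complex.
  rewrite (ReE h _ mhr mhi Mhr Mhi).1.
  under eq_fun do rewrite (ReE _ _ (mr _) (mi _) (Mr _) (Mi _)).1.
  exact: cvgB.
rewrite (ReE h _ mhr mhi Mhr Mhi).2.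
under eq_fun do rewrite (ReE _ _ (mr _) (mi _) (Mr _) (Mi _)).2.
exact: cvgD.
Qed.

(** The derivatives are transposed in reverse order, which is immaterial on smooth
    functions. *)
Lemma iter_dist_deriv s (T : Defs.form R n) (f : Rn -> C) : smooth f ->
  iter_deriv (@dist_deriv R n) s T f = (-1) ^+ size s * T (D s f).
Proof.
move=> sf; rewrite (iter_partial_perm sf (_ : perm_eq s (rev s))); last first.
  by rewrite perm_sym perm_rev.
elim: s f sf => [|i s IH] f sf; first by rewrite expr0 mul1r.
rewrite iter_deriv_cons /dist_deriv IH; last exact: smooth_partial.
by rewrite rev_cons -cats1 iter_deriv_cat exprS mulN1r mulNr.
Qed.

Lemma multi_dist_deriv a (T : Defs.form R n) (f : Rn -> C) : smooth f ->
  multi_deriv (@dist_deriv R n) a T f = (-1) ^+ mi_order a * T (multi_deriv (@partial R n) a f).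
Proof. by move=> sf; rewrite -(size_mi_seq a); exact: (iter_dist_deriv (mi_seq a)). Qed.

Lemma represents_sum (r : seq (multi_index n)) (f : multi_index n -> Rn -> C) S (psi : Bdot R n) :
  represents (\sum_(a <- r) multi_deriv (@dist_deriv R n) a (dist_of_fct (f a))) S ->
  S psi = \sum_(a <- r) (-1) ^+ mi_order a *
            integral_Rn (fun x => f a x * multi_deriv (@partial R n) a psi x).
Proof.
move=> ->; rewrite fct_sumE; apply: eq_bigr => a _.
by rewrite multi_dist_deriv//; exact: Bdot_smooth.
Qed.

Lemma cvg_big_seq_complex (T : Type) (I : eqType) (F : set_system T) {FF : Filter F} (r : seq I)
    (f : T -> I -> C) (l : I -> C) :
  (forall p, p \in r -> f t p @[t --> F] --> l p) ->
  \sum_(p <- r) f t p @[t --> F] --> \sum_(p <- r) l p.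
Proof.
elim: r => [|p r IH] H.
  rewrite (_ : (fun t => _) = cst 0); first by rewrite big_nil; exact: cvg_cst.
  by apply/funext => t; rewrite big_nil.
rewrite (_ : (fun t => _) = (fun t => f t p + \sum_(q <- r) f t q)).
  rewrite big_cons; apply: (@cvgD _ C); first by apply: H; rewrite mem_head.
  by apply: IH => q qr; apply: H; rewrite in_cons qr orbT.
by apply/funext => t; rewrite big_cons.
Qed.

(** Any representation of S computes, by dominated convergence, the limit of S
    along the truncations of phi; so the pairing does not depend on the
    representation. *)
Lemma pairing_graph_limit phi S (z : C) : pairing_graph phi S z ->
  S (cut k phi) @[k --> \oo] --> z.
Proof.
move=> [r [f [Lf fS ->]]].
under eq_fun do rewrite (represents_sum _ fS).
apply: cvg_big_seq_complex => a ar; have [A A0 cA] := @cut_bound R n (mi_order a).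
apply: (@cvgZl_tmp _ C _ _ _ ((-1) ^+ mi_order a : C)).
have bphi := DLinf_bounded phi; have sphi := DLinf_smooth phi.
apply: (@cvg_integral_Rn _ _ _ (A * cm (mi_order a) phi)).
- exact: Lf.
- by move=> k; have [] := Bdot_smooth (cut k phi) (mi_seq a).
- by have [] := sphi (mi_seq a).
- move=> k x; apply: le_trans (cA k phi).
  by apply: (cm_derivs (Bdot_bounded (cut k phi))); rewrite size_mi_seq.
- by move=> x; exact: cvg_cut_re.
- by move=> x; exact: cvg_cut_im.
Qed.

Lemma cvg_normc_le (u : nat -> C) (z : C) (M : R) : u @ \oo --> z ->
  (forall k, normc (u k) <= M) -> normc z <= M.
Proof.
move=> /cvg_normcP uz uM; apply/ler_addgt0Pr => e e0.
have [k ke] := filter_ex (uz e e0).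
rewrite -[z](subrK (u k)); apply: le_trans (normcD_le _ _) _.
by rewrite addrC lerD// ltW.
Qed.

Lemma pairing_graph_bound m (K : R) : 0 <= K -> exists2 A : R, 0 <= A & forall phi S z,
  polar_set m K S -> pairing_graph phi S z -> normc z <= A * cm m phi.
Proof.
move=> K0; have [A A0 cA] := @cut_bound R n m; exists (K * A); first exact: mulr_ge0.
move=> phi S z SK /pairing_graph_limit /cvg_normc_le; apply => k.
by apply: le_trans (SK _) _; rewrite -mulrA ler_wpM2l.
Qed.

(** The words with coefficients that expand the m-th power of 1 - Laplacian. *)
Fixpoint lap_words m : seq (C * seq 'I_n) :=
  if m is m'.+1 then
    flatten [seq p :: [seq (- p.1, p.2 ++ [:: i; i]) | i <- enum 'I_n] | p <- lap_words m']
  else [:: (1, [::])].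

Lemma iter_partial_lap s (f : Rn -> C) x : smooth f ->
  D s (lap f) x = D s f x - \sum_i D (s ++ [:: i; i]) f x.
Proof.
move=> sf; have [sr si] := (smoothE f).1 sf.
have -> : D s (lap f) = lap (D s f).
  apply: fct_complex_eq.
    apply: etrans (re_iter_partial s (lap f)) _; apply/esym.
    apply: etrans (re_lap (D s f)) _; rewrite (re_iter_partial s f).
    apply: etrans (esym (iter_rpartial_lap s sr)) _.
    by congr (iter_deriv _ s _); exact/esym/re_lap.
  apply: etrans (im_iter_partial s (lap f)) _; apply/esym.
  apply: etrans (im_lap (D s f)) _; rewrite (im_iter_partial s f).
  apply: etrans (esym (iter_rpartial_lap s si)) _.
  by congr (iter_deriv _ s _); exact/esym/im_lap.
rewrite lap_complexE; congr (_ - _); apply: eq_bigr => i _.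
by rewrite iter_deriv_cat (iter_partialC s [:: i; i] sf).
Qed.

Lemma iter_lap_words m (f : Rn -> C) x : smooth f ->
  iter m lap f x = \sum_(p <- lap_words m) p.1 * D p.2 f x.
Proof.
elim: m f => [|m IH] f sf; first by rewrite /= big_seq1 mul1r.
rewrite iterSr IH; last exact: (smooth_iter_lap 1).
rewrite /= big_flatten /= big_map; apply: eq_bigr => p _.
rewrite iter_partial_lap// big_cons big_map /= mulrBr big_enum mulr_sumr /= -sumrN.
by congr (_ + _); apply: eq_bigr => i _; rewrite mulNr.
Qed.

Definition lap_indices m := undup [seq mi_of p.2 | p <- lap_words m].

Definition lap_coef m (a : multi_index n) : C := \sum_(p <- lap_words m | mi_of p.2 == a) p.1.

(** Words with the same multi-index are collected, since a representation has one
    density for each multi-index. *)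
Lemma iter_lap_multi m (f : Rn -> C) x : smooth f ->
  iter m lap f x = \sum_(a <- lap_indices m) lap_coef m a * multi_deriv (@partial R n) a f x.
Proof.
move=> sf; rewrite iter_lap_words//.
under [RHS]eq_bigr => a _ do rewrite /lap_coef mulr_suml.
rewrite (exchange_big_dep xpredT)//= big_seq [RHS]big_seq; apply: eq_bigr => p pm.
have ip : mi_of p.2 \in lap_indices m by rewrite mem_undup; apply/mapP; exists p.
rewrite -big_filter (@eq_filter _ _ (pred1 (mi_of p.2))) => [|a /=]; last by rewrite eq_sym.
by rewrite filter_pred1_uniq ?undup_uniq// big_seq1 -multi_deriv_of.
Qed.

(** The operator in S = (1 - Laplacian)^M f is expanded into derivatives. *)
Lemma pairing_graph_exists phi S : exists z, pairing_graph phi S z.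
Proof.
have [m [K [K0 SK]]] := DL1_seminorm_bounded S.
have [f [Lf _] fS] := equicontinuous_density K0 SK.
pose M := (2 * n + m)%N.
pose g a : Rn -> C := fun x => ((-1) ^+ mi_order a * lap_coef M a) * f x.
have Lg a : L1 (g a) by exact: L1Z.
eexists; exists (lap_indices M), g; split=> [a _|psi|]; [exact: Lg| |reflexivity].
rewrite fct_sumE fS -/M.
have spsi := Bdot_smooth psi; have bpsi := Bdot_bounded psi.
have Lm a : L1 (fun x => f x * multi_deriv (@partial R n) a psi x).
  have [c b] := all_derivs_bounded_continuous (all_derivs_bounded_iter (mi_seq a) bpsi).
  exact: L1_mul.
have E (r : seq (multi_index n)) :
    L1 (fun x => \sum_(a <- r) lap_coef M a * (f x * multi_deriv (@partial R n) a psi x)) /\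
    integral_Rn (fun x => \sum_(a <- r) lap_coef M a * (f x * multi_deriv (@partial R n) a psi x)) =
    \sum_(a <- r) lap_coef M a * integral_Rn (fun x => f x * multi_deriv (@partial R n) a psi x).
  elim: r => [|a r [IH1 IH2]].
    under eq_fun do rewrite big_nil; rewrite big_nil.
    have L0 : L1 (fun x => 0 * f x) by exact: L1Z.
    have := integral_RnZ 0 Lf; rewrite mul0r; move: L0.
    by under eq_fun do rewrite mul0r.
  under eq_fun do rewrite big_cons; rewrite big_cons -IH2.
  by split; [exact: L1_lin|exact: integral_Rn_lin].
have [_ E'] := E (lap_indices M).
have -> : (fun x => f x * iter M lap psi x) =
    (fun x => \sum_(a <- lap_indices M) lap_coef M a * (f x * multi_deriv (@partial R n) a psi x)).
  apply/funext => x; rewrite iter_lap_multi// mulr_sumr; apply: eq_bigr => a _.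
  by rewrite mulrCA.
rewrite E'; apply: eq_bigr => a _; rewrite multi_dist_deriv// /dist_of_fct.
under [in RHS]eq_fun do rewrite -mulrA.
rewrite integral_RnZ// !mulrA -signr_odd -expr2.
by rewrite sqrr_sign mul1r.
Qed.

Lemma pairingP phi S : pairing_graph phi S (pairing phi S).
Proof. by rewrite /pairing; apply: xgetPex; exact: pairing_graph_exists. Qed.

Lemma pairing_limit phi S : S (cut k phi) @[k --> \oo] --> (pairing phi S : C).
Proof. by apply: pairing_graph_limit; exact: pairingP. Qed.

Lemma pairing_bound m (K : R) : 0 <= K -> exists2 A : R, 0 <= A & forall phi S,
  polar_set m K S -> normc (pairing phi S) <= A * cm m phi.
Proof.
move=> K0; have [A A0 h] := pairing_graph_bound m K0; exists A => // phi S SK.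
by apply: h SK _; exact: pairingP.
Qed.

Definition delta_fct s (y : Rn) : Bdot R n -> C := fun psi => D s psi y.

Lemma delta_fct_lin s y (a : R[i]) (f g : Bdot R n) :
  delta_fct s y (a *: f + g) = (a : C) * delta_fct s y f + delta_fct s y g.
Proof. by rewrite /delta_fct iter_partial_lin//; exact: Bdot_smooth. Qed.

Lemma delta_fct_bound s y : seminorm_bounded (size s) 1 (delta_fct s y).
Proof. by move=> psi; rewrite mul1r; apply: (cm_derivs (Bdot_bounded psi)). Qed.

(** The derivatives of the Dirac measures, up to sign. *)
Definition delta s y : DL1 R n :=
  MkDL1 (seminorm_bounded_continuous (@delta_fct_lin s y) (@delta_fct_bound s y)).

Lemma pairing_delta phi s y : pairing phi (delta s y) = D s phi y.
Proof.
have h1 := @pairing_limit phi (delta s y); have h2 := @cvg_cut _ _ s phi y.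
apply/eqP; rewrite -subr_eq0; apply/eqP; apply: eq0_normc; apply/eqP.
rewrite eq_le normc_ge0 andbT; apply/ler_addgt0Pr => e e0; rewrite add0r.
have e2 : 0 < e / 2 by rewrite divr_gt0.
have /cvg_normcP/(_ _ e2) n1 := h1; have /cvg_normcP/(_ _ e2) n2 := h2.
have [k [k1 k2]] := filter_ex (filterI n1 n2).
rewrite -(subrKA (D s (cut k phi) y)); apply: le_trans (normcD_le _ _) _.
by rewrite [leRHS]splitr lerD// ltW// normcBC.
Qed.

End pairing_facts.

(** * Comparison of the topologies *)

(** It is enough to dominate each seminorm of one family by a single seminorm of
    the other. *)
Lemma seminorm_topology_sub (R : realType) (E : zmodType) (I J : choiceType)
    (D : set I) (p : I -> E -> \bar R) (D' : set J) (q : J -> E -> \bar R) :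
  (forall i, D i -> forall e : R, 0 < e -> exists j, D' j /\
     exists2 d : R, 0 < d & forall y, (q j y < d%:E)%E -> (p i y < e%:E)%E) ->
  seminorm_topology D p `<=` seminorm_topology D' q.
Proof.
move=> H U oU x Ux; have [F [/finite_seqP[s ->] FD [e e0 eU]]] := oU x Ux.
have [G [finG GD [d d0 Gd]]] : exists G, [/\ finite_set G, G `<=` D' &
    exists2 d : R, 0 < d & forall y, (forall j, G j -> (q j y < d%:E)%E) ->
      forall i, i \in s -> (p i y < e%:E)%E].
  have {FD} FD i : i \in s -> D i by move=> /FD.
  elim: s {eU} FD => [|i s IH] FD.
    by exists set0; split=> //; exists 1.
  have [|G [finG GD [d d0 Gd]]] := IH; first by move=> k ks; apply: FD; rewrite in_cons ks orbT.
  have [j [Dj [c c0 jc]]] := H i (FD i (mem_head _ _)) e e0.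
  exists (j |` G); split; [by rewrite finite_setU|by rewrite subUset; split=> // _ ->|].
  exists (Num.min c d); first by rewrite lt_min c0.
  move=> y Gy k; rewrite in_cons => /orP[/eqP ->|ks].
    apply: jc; apply: lt_le_trans (Gy j (or_introl erefl)) _.
    by rewrite lee_fin ge_min lexx.
  apply: Gd ks => l Gl; apply: lt_le_trans (Gy l (or_intror Gl)) _.
  by rewrite lee_fin ge_min lexx orbT.
exists G; split=> //; exists d => // y Gy; apply: eU => i si.
exact: Gd Gy i si.
Qed.

Section seminorms.
Variables (R : realType) (n : nat).
Local Notation C := (R[i]^o).

Lemma seminorm_scale (A a c e : R) : 0 <= A -> 0 < e -> c <= A * a -> a < e / (A + 1) -> c < e.
Proof.
move=> A0 e0 ca; have A1 : 0 < A + 1 by rewrite ltr_wpDl.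
rewrite ltr_pdivlMr// => ae; apply: le_lt_trans ca _.
have [a0|a0] := leP 0 a; first by apply: le_lt_trans ae; rewrite mulrC ler_wpM2l// lerDl.
by apply: le_lt_trans e0; rewrite mulr_ge0_le0// ltW.
Qed.

Lemma bessel_dominated m (f : 'rV[R]_n -> C) (e : R) : all_derivs_bounded f -> 0 < e ->
  (Cm_norm (2 * m) f < (e / (2 * (1 + n%:R) ^+ m + 1))%:E)%E -> (bessel_norm m f < e%:E)%E.
Proof.
move=> bf e0; have A0 : 0 <= 2 * (1 + n%:R) ^+ m :> R by rewrite mulr_ge0// exprn_ge0.
rewrite cmE// lte_fin => fe.
apply: (@le_lt_trans _ _ (2 * (1 + n%:R) ^+ m * cm (2 * m) f)%:E).
  by apply/bessel_norm_le; apply: derivs_le_bessel; [case: bf|exact: cm_derivs].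
by rewrite lte_fin; exact: seminorm_scale fe.
Qed.

Lemma Cm_dominated m (f : 'rV[R]_n -> C) (e : R) : all_derivs_bounded f -> 0 < e ->
  (bessel_norm m f < (e / (2 * 2 ^+ m + 1))%:E)%E -> (Cm_norm m f < e%:E)%E.
Proof.
move=> bf e0; have A0 : 0 <= 2 * 2 ^+ m :> R by rewrite mulr_ge0// exprn_ge0.
move=> fe; have A1 : 0 < 2 * 2 ^+ m + 1 :> R by rewrite ltr_wpDl.
have := ltW fe; move=> /bessel_norm_le /(bessel_derivs_le bf) /(cm_le _ _ bf).
rewrite cmE// lte_fin => /le_lt_trans; apply.
by rewrite mulrC -mulrA gtr_pMr// mulrC ltr_pdivrMr// mul1r ltrDl.
Qed.

Lemma bessel_topology (E : zmodType) (v : E -> 'rV[R]_n -> C) :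
  (forall x, all_derivs_bounded (v x)) ->
  seminorm_topology setT (fun m x => Cm_norm m (v x)) =
  seminorm_topology setT (fun m x => bessel_norm m (v x)).
Proof.
move=> bv; apply/seteqP; split; apply: seminorm_topology_sub => m _ e e0.
  exists m; split=> //; exists (e / (2 * 2 ^+ m + 1)).
    by rewrite divr_gt0// ltr_wpDl// mulr_ge0// exprn_ge0.
  by move=> x; exact: Cm_dominated.
exists (2 * m)%N; split=> //; exists (e / (2 * (1 + n%:R) ^+ m + 1)).
  by rewrite divr_gt0// ltr_wpDl// mulr_ge0// exprn_ge0.
by move=> x; exact: bessel_dominated.
Qed.

Lemma sup_pairing_bound (B : set (DL1 R n)) : @tvs_bounded R[i] (DL1 R n) B ->
  exists m (A : R), 0 <= A /\
    forall phi : DLinf R n, (sup_pairing B phi <= (A * cm m phi)%:E)%E.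
Proof.
move=> /beta_bounded_equicontinuous[m [K [K0 BK]]].
have [A A0 h] := @pairing_bound R n m K K0; exists m, A; split=> // phi.
by apply: ge_ereal_sup => _ [S BS <-]; rewrite lee_fin; apply: h; exact: BK.
Qed.

Lemma sup_eval_bound (B : set (DL1 R n)) : @tvs_bounded R[i] (DL1 R n) B ->
  exists m (A : R), 0 <= A /\
    forall phi : Bdot R n, (sup_eval B phi <= (A * cm m phi)%:E)%E.
Proof.
move=> /beta_bounded_equicontinuous[m [K [K0 BK]]]; exists m, K; split=> // phi.
by apply: ge_ereal_sup => _ [S BS <-]; rewrite lee_fin; exact: BK.
Qed.

(** The suprema over this set are the seminorms of order m. *)
Definition deltas m : set (DL1 R n) := [set S | exists s y, (size s <= m)%N /\ S = delta s y].

Lemma deltas_bounded m : @tvs_bounded R[i] (DL1 R n) (deltas m).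
Proof.
apply/beta_bounded_equicontinuous; exists m, 1; split=> // _ [s [y [sm ->]]] phi.
apply: le_trans (delta_fct_bound s y phi) _; rewrite !mul1r; apply: cm_mono sm.
exact: Bdot_bounded.
Qed.

(** Stated for any space of functions with bounded derivatives, so as to cover both
    spaces; the set deltas m gives the estimate from below. *)
Lemma bounded_sets_topology (E : zmodType) (v : E -> 'rV[R]_n -> C)
    (p : set (DL1 R n) -> E -> \bar R) :
  (forall x, all_derivs_bounded (v x)) ->
  (forall B, @tvs_bounded R[i] (DL1 R n) B -> exists m (A : R), 0 <= A /\
     forall x, (p B x <= (A * cm m (v x))%:E)%E) ->
  (forall m x s y, (size s <= m)%N ->
     ((normc (iter_deriv (@partial R n) s (v x) y))%:E <= p (deltas m) x)%E) ->
  seminorm_topology [set B | @tvs_bounded R[i] (DL1 R n) B] p =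
  seminorm_topology setT (fun m x => Cm_norm m (v x)).
Proof.
move=> bv pB pd; apply/seteqP; split; [apply: seminorm_topology_sub => B bB e e0|
  apply: seminorm_topology_sub => m _ e e0].
  have [m [A [A0 BA]]] := pB B bB.
  exists m; split=> //; exists (e / (A + 1)); first by rewrite divr_gt0// ltr_wpDl.
  move=> x; rewrite cmE// lte_fin => xe; apply: le_lt_trans (BA x) _.
  by rewrite lte_fin; exact: seminorm_scale xe.
exists (deltas m); split; first exact: deltas_bounded.
exists (e / 2) => [|x /ltW xe]; first by rewrite divr_gt0.
rewrite cmE// lte_fin; apply: (@le_lt_trans _ _ (e / 2)); last by move: e0; lra.
by apply/cm_le => // s y sm; rewrite -lee_fin; exact: le_trans (pd m x s y sm) xe.
Qed.

End seminorms.

Theorem proposition4p12 (R : realType) (n : nat) (n_gt0 : (0 < n)%N) :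
  (forall B : set (DL1 R n),
     (@tvs_bounded R[i] (DL1 R n) B <-> @tvs_bounded R[i] (DL1c R n) B) /\
     (@tvs_bounded R[i] (DL1c R n) B <-> @precompact (DL1c R n) B)) /\
  (forall B : set (DL1 R n),
     @tvs_bounded R[i] (DL1 R n) B <->
     exists (m : nat) (c : R), 0 < c /\
       B `<=` [set (c%:C)%C *: S | S in @bessel_B11 R n m]) /\
  ((forall B : set (DL1 R n), @tvs_bounded R[i] (DL1 R n) B ->
      forall phi : DLinf R n, (sup_pairing B phi < +oo)%E) /\
   seminorm_topology [set B | @tvs_bounded R[i] (DL1 R n) B]
     (fun B (phi : DLinf R n) => sup_pairing B phi) =
   seminorm_topology setT (fun m (phi : DLinf R n) => Cm_norm m phi) /\
   seminorm_topology setT (fun m (phi : DLinf R n) => Cm_norm m phi) =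
   seminorm_topology setT (fun m (phi : DLinf R n) => bessel_norm m phi)) /\
  ((forall B : set (DL1 R n), @tvs_bounded R[i] (DL1 R n) B ->
      forall phi : Bdot R n, (sup_eval B phi < +oo)%E) /\
   seminorm_topology [set B | @tvs_bounded R[i] (DL1 R n) B]
     (fun B (phi : Bdot R n) => sup_eval B phi) =
   seminorm_topology setT (fun m (phi : Bdot R n) => Cm_norm m phi) /\
   seminorm_topology setT (fun m (phi : Bdot R n) => Cm_norm m phi) =
   seminorm_topology setT (fun m (phi : Bdot R n) => bessel_norm m phi)).
Proof.
split.
  move=> B; split.
    by rewrite beta_bounded_equicontinuous kappa_bounded_equicontinuous.
  by rewrite kappa_bounded_equicontinuous precompact_equicontinuous.
split; first exact: bounded_bessel.
split; split; [|split| |split].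
- move=> B /sup_pairing_bound[m [A [_ BA]]] phi.
  by apply: le_lt_trans (BA phi) _; exact: ltry.
- apply: bounded_sets_topology (@DLinf_bounded R n) (@sup_pairing_bound R n) _ => m phi s y sm.
  by apply: ereal_sup_ubound; exists (delta s y); [exists s, y|rewrite pairing_delta].
- exact: bessel_topology (@DLinf_bounded R n).
- move=> B /sup_eval_bound[m [A [_ BA]]] phi.
  by apply: le_lt_trans (BA phi) _; exact: ltry.
- apply: bounded_sets_topology (@Bdot_bounded R n) (@sup_eval_bound R n) _ => m phi s y sm.
  by apply: ereal_sup_ubound; exists (delta s y); [exists s, y|].
- exact: bessel_topology (@Bdot_bounded R n).
Qed.
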